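(* Consider the augmented system $$\partial_t^2u(t)+Au(t)+\gamma B\int_{\mathbb{R}}p(\xi)\varphi(t,\xi)\,\mathrm{d}\xi=0,\qquad \partial_t\varphi(t,\xi)+(|\xi|^2+\eta)\varphi(t,\xi)=p(\xi)B^*\partial_tu(t),\qquad t>0,\ \xi\in\mathbb{R},$$ $$u(0)=u^0,\quad \partial_tu(0)=u^1,\quad \varphi(0,\xi)=0,$$ that is, $X'(t)=\mathcal{A}X(t)$ with $X=(u,\partial_tu,\varphi)$ and $X(0)=(u^0,u^1,0)$. (1) For $(u^0,u^1,0)\in\mathcal{H}$, the system admits a unique solution $(u,\partial_tu,\varphi)\in\mathcal{C}([0,+\infty);\mathcal{H})$. (2) For $(u^0,u^1,0)\in\mathcal{D}(\mathcal{A})$, the system admits a unique solution $(u,\partial_tu,\varphi)\in\mathcal{C}([0,+\infty);\mathcal{D}(\mathcal{A}))\cap\mathcal{C}^1([0,+\infty);\mathcal{H})$. (3) Moreover, from the density of $\mathcal{D}(\mathcal{A})$ in $\mathcal{H}$, the energy of $(u(t),\varphi(t))$ at time $t\ge0$, given by $$E(t)=\frac12\left(\|u(t)\|_{H_{\frac12}}^2+\|\partial_tu(t)\|_H^2+\gamma\int_{\mathbb{R}}\|\varphi(t,\xi)\|_U^2\,\mathrm{d}\xi\right),$$ decays as follows: $$\frac{\mathrm{d}E}{\mathrm{d}t}(t)=-\gamma\int_{\mathbb{R}}(|\xi|^2+\eta)\|\varphi(t,\xi)\|_U^2\,\mathrm{d}\xi,\qquad\forall\,t\ge0.$$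
   Context: Let $H$ be a Hilbert space and $A:\mathcal{D}(A)\subset H\to H$ a self-adjoint and strictly positive operator. For $\beta\ge0$, $H_\beta=\mathcal{D}(A^\beta)$ with norm $\|z\|_{H_\beta}=\|A^\beta z\|_H$, and $H_{-\beta}=H_\beta^*$ is the dual with respect to the pivot space $H$; $A$ extends (or restricts) to a bounded operator $H_\beta\to H_{\beta-1}$ for every $\beta\in\mathbb{R}$. Let $U$ be a Hilbert space identified with its dual, $B:U\to H_{-\frac12}$ a bounded linear operator, and $B^*:H_{\frac12}\to U$ its adjoint. Let $0<\alpha<1$, $\eta\ge0$, $\gamma=\frac{2\sin(\alpha\pi)\Gamma(\frac12+1)}{\pi^{\frac12+1}}$, $p(\xi)=|\xi|^{\frac{2\alpha-1}{2}}$ ($\xi\in\mathbb{R}$). Let $V=L^2(\mathbb{R};U)$ and $\mathcal{H}=H_{\frac12}\times H\times V$ with inner product $$\langle(u_1,v_1,\varphi_1),(u_2,v_2,\varphi_2)\rangle_{\mathcal{H}}=\langle A^{\frac12}u_1,A^{\frac12}u_2\rangle_H+\langle v_1,v_2\rangle_H+\gamma\int_{\mathbb{R}}\langle\varphi_1(\xi),\varphi_2(\xi)\rangle_U\,\mathrm{d}\xi.$$ The operator $\mathcal{A}:\mathcal{D}(\mathcal{A})\subset\mathcal{H}\to\mathcal{H}$ is $$\mathcal{A}(u,v,\varphi)=\Big(v,\ -Au-\gamma B\int_{\mathbb{R}}p(\xi)\varphi(\xi)\,\mathrm{d}\xi,\ -(|\xi|^2+\eta)\varphi+p(\xi)B^*v\Big),$$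 with domain $$\mathcal{D}(\mathcal{A})=\Big\{(u,v,\varphi)\in\mathcal{H}:\ v\in H_{\frac12},\ Au+\gamma B\int_{\mathbb{R}}p(\xi)\varphi(\xi)\,\mathrm{d}\xi\in H,\ |\xi|\varphi\in L^2(\mathbb{R};U),\ -(|\xi|^2+\eta)\varphi+p(\xi)B^*v\in L^2(\mathbb{R};U)\Big\}.$$
   Formalization: In (3) the formula for dE/dt at every t ≥ 0 is stated for initial data in D(𝒜); for data only in ℋ, where it can fail at t = 0, it is replaced by its integrated form E(t1) − E(t2) = γ∫∫(|ξ|²+η)‖φ‖² over [t1,t2]. *)

(* Defs.v *)
From HB Require Import structures.
From mathcomp Require Import all_boot all_order all_algebra.
From mathcomp Require Import sesquilinear.
From mathcomp Require Import complex.
From mathcomp Require Import all_classical all_reals all_analysis.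

Set Implicit Arguments.
Unset Strict Implicit.
Unset Printing Implicit Defensive.
Import Order.TTheory GRing.Theory Num.Theory.
Import numFieldNormedType.Exports.
Local Open Scope classical_set_scope.
Local Open Scope ring_scope.

(* Hilbert spaces are taken over a field of scalars which is either the reals
   or the complex numbers; everything below is uniform in this choice. *)

Inductive scalars := RealScalars | ComplexScalars.

Definition scalar_field (R : realType) (s : scalars) : numFieldType :=
  match s with
  | RealScalars => R
  | ComplexScalars => complex R
  end.

Definition scalar_of (R : realType) (s : scalars) : R -> scalar_field R s :=
  match s with
  | RealScalars => fun x => x
  | ComplexScalars => fun x => real_complex R x
  end.

Definition scalar_Re (R : realType) (s : scalars) : scalar_field R s -> R :=
  match s with
  | RealScalars => fun x => x
  | ComplexScalars => fun x => complex.Re x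
  end.

Definition scalar_conj (R : realType) (s : scalars) :
    scalar_field R s -> scalar_field R s :=
  match s with
  | RealScalars => fun x => x
  | ComplexScalars => fun x => conjc x
  end.

(* The inner product is linear on the left and conjugate-linear on the right. *)
Record hilbertType (R : realType) (s : scalars) := HilbertType {
  hilbert_sort :> completeNormedModType (scalar_field R s);
  ip : {dot hilbert_sort for @scalar_conj R s};
  ip_norm : forall x : hilbert_sort, `|x| ^+ 2 = ip x x }.

Section Hilbert.
Variables (R : realType) (s : scalars).
Implicit Types H U : hilbertType R s.

(* In MathComp-Analysis the norm of a normed module takes its values in the
   scalars; this is the same norm with values in R. *)
Definition rnorm H (x : H) : R := scalar_Re `|x|.

Definition rscale H (a : R) (x : H) : H := scalar_of s a *: x.

(* Unbounded linear operators; the values outside the domain are irrelevant. *)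
Record operator H := Operator {
  op_dom : set H;
  op_fun :> H -> H;
  op_dom0 : op_dom 0;
  op_dom_lin : forall (a : scalar_field R s) x y,
    op_dom x -> op_dom y -> op_dom (a *: x + y);
  op_lin : forall (a : scalar_field R s) x y, op_dom x -> op_dom y ->
    op_fun (a *: x + y) = a *: op_fun x + op_fun y }.

(* The right-hand side of the equivalence is the graph of T, the left-hand side
   is the graph of its adjoint. *)
Definition self_adjoint H (T : operator H) : Prop :=
  dense (op_dom T) /\
  forall y z : H, (forall x, op_dom T x -> ip H (T x) y = ip H x z) <->
                  (op_dom T y /\ T y = z).

Definition nonnegative H (T : operator H) : Prop :=
  forall x, op_dom T x -> 0 <= ip H (T x) x.

Definition strictly_positive H (T : operator H) : Prop :=
  exists2 m : scalar_field R s, 0 < m &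
    forall x, op_dom T x -> m * `|x| ^+ 2 <= ip H (T x) x.

(* S = A^(1/2), the nonnegative self-adjoint operator such that S \o S = A,
   equality of domains included. *)
Definition is_sqrt H (A S : operator H) : Prop :=
  [/\ self_adjoint S, nonnegative S,
      forall x, op_dom A x <-> (op_dom S x /\ op_dom S (S x)) &
      forall x, op_dom A x -> A x = S (S x)].

(* With S = A^(1/2), the space H_(1/2) is op_dom S with the norm `|S z|.  Its
   dual H_(-1/2) is made of the bounded conjugate-linear functionals on
   H_(1/2), so that the pivot embedding h |-> ip h _ of H is linear.  A
   functional is given by a map on H, of which only the values on op_dom S
   matter. *)
Definition in_Hmhalf H (S : operator H) (f : H -> scalar_field R s) : Prop :=
  (forall (a : scalar_field R s) x y, op_dom S x -> op_dom S y ->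
     f (a *: x + y) = scalar_conj a * f x + f y) /\
  exists C : scalar_field R s, forall x, op_dom S x -> `|f x| <= C * `|S x|.

Definition bounded_into_Hmhalf U H (S : operator H)
    (B : U -> H -> scalar_field R s) : Prop :=
  [/\ forall w, in_Hmhalf S (B w),
      forall (a : scalar_field R s) w1 w2 x, op_dom S x ->
        B (a *: w1 + w2) x = a * B w1 x + B w2 x &
      exists C : scalar_field R s, forall w x, op_dom S x ->
        `|B w x| <= C * `|w| * `|S x|].

(* Bs : H_(1/2) -> U; the left-hand side is the duality bracket. *)
Definition is_adjoint U H (S : operator H)
    (B : U -> H -> scalar_field R s) (Bs : H -> U) : Prop :=
  forall w x, op_dom S x -> B w x = ip U w (Bs x).

(* The bounded extension of A = S \o S to an operator H_(1/2) -> H_(-1/2). *)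
Definition extend H (S : operator H) (u : H) : H -> scalar_field R s :=
  fun x => ip H (S u) (S x).

Definition represents H (S : operator H)
    (f : H -> scalar_field R s) (h : H) : Prop :=
  forall x, op_dom S x -> f x = ip H h x.

(* The functional f of H_(-1/2), seen as an element of H when it is one. *)
Definition pivot_repr H (S : operator H) (f : H -> scalar_field R s) : H :=
  xget 0 [set h | represents S f h].

End Hilbert.

Section BochnerL2.
Variables (R : realType) (s : scalars) (U : hilbertType R s).
Let mu := @lebesgue_measure R.

Record simple_map := SimpleMap {
  sm_size : nat;
  sm_set : 'I_sm_size -> set R;
  sm_val : 'I_sm_size -> U;
  sm_measurable : forall i, measurable (sm_set i);
  sm_finite : forall i, (mu (sm_set i) < +oo)%E }.

Definition sm_eval (f : simple_map) (x : R) : U :=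
  \sum_(i < sm_size f) rscale (\1_(sm_set i) x) (sm_val i).

Definition sm_integral (f : simple_map) : U :=
  \sum_(i < sm_size f) rscale (fine (mu (sm_set i))) (sm_val i).

(* The limit is required everywhere, and not almost everywhere, so that the
   norm of f is Borel; every class modulo a.e. equality has such a
   representative. *)
Definition strongly_measurable (f : R -> U) : Prop :=
  exists f_ : nat -> simple_map,
    forall x, (fun n => sm_eval (f_ n) x) @ \oo --> f x.

Definition is_bochner_integral (f : R -> U) (w : U) : Prop :=
  strongly_measurable f /\
  exists f_ : nat -> simple_map,
    (fun n => \int[mu]_x (rnorm (f x - sm_eval (f_ n) x))%:E)%E @ \oo --> 0%E /\
    (fun n => sm_integral (f_ n)) @ \oo --> w.

Definition bochner_integral (f : R -> U) : U :=
  xget 0 [set w | is_bochner_integral f w].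

(* Elements of L^2(R; U) are functions; they are compared modulo a.e. equality
   in state_eq below. *)
Definition in_L2 (f : R -> U) : Prop :=
  strongly_measurable f /\ (\int[mu]_x (rnorm (f x) ^+ 2)%:E < +oo)%E.

End BochnerL2.

Definition Gamma_fun (R : realType) (x : R) : R :=
  \int[@lebesgue_measure R]_(t in `]0, +oo[) (t `^ (x - 1) * expR (- t)).

Definition frac_gamma (R : realType) (alpha : R) : R :=
  2 * sin (alpha * pi) * Gamma_fun (2^-1 + 1) / (pi `^ (2^-1 + 1)).

Definition frac_weight (R : realType) (alpha : R) (xi : R) : R :=
  `|xi| `^ ((2 * alpha - 1) / 2).

Definition half_line (R : realType) : set R := `[0, +oo[.
Arguments half_line R : clear implicits.

Section System.
Variables (R : realType) (s : scalars) (H U : hilbertType R s).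
Variables (S : operator H) (B : U -> H -> scalar_field R s) (Bs : H -> U).
Variables (alpha eta : R).
Let mu := @lebesgue_measure R.
Let gam := frac_gamma alpha.
Let p := frac_weight alpha.

Definition state : Type := (H * H * (R -> U))%type.

Definition mkstate (u v : H) (phi : R -> U) : state := (u, v, phi).
Definition position (X : state) : H := X.1.1.
Definition velocity (X : state) : H := X.1.2.
Definition memory (X : state) : R -> U := X.2.

Definition state0 : state := mkstate 0 0 (fun=> 0).
Definition state_add (X Y : state) : state :=
  mkstate (position X + position Y) (velocity X + velocity Y)
    (fun xi => memory X xi + memory Y xi).
Definition state_sub (X Y : state) : state :=
  mkstate (position X - position Y) (velocity X - velocity Y)
    (fun xi => memory X xi - memory Y xi).
Definition state_scale (a : R) (X : state) : state :=
  mkstate (rscale a (position X)) (rscale a (velocity X))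
    (fun xi => rscale a (memory X xi)).

Definition state_eq (X Y : state) : Prop :=
  [/\ position X = position Y, velocity X = velocity Y &
      {ae mu, forall xi, memory X xi = memory Y xi}].

(* The energy space H_(1/2) x H x L^2(R; U) and the square of its norm. *)
Definition in_energy (X : state) : Prop :=
  op_dom S (position X) /\ in_L2 (memory X).

Definition sqnorm (X : state) : R :=
  rnorm (S (position X)) ^+ 2 + rnorm (velocity X) ^+ 2 +
  gam * \int[mu]_xi (rnorm (memory X xi) ^+ 2).

Definition state_norm (X : state) : R := Num.sqrt (sqnorm X).

(* A u + gamma B (\int p phi), an element of H_(-1/2) *)
Definition force (X : state) : H -> scalar_field R s :=
  fun x => extend S (position X) x +
    scalar_of s gam *
    B (bochner_integral (fun xi => rscale (p xi) (memory X xi))) x.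

Definition memory_rhs (X : state) : R -> U :=
  fun xi =>
    rscale (p xi) (Bs (velocity X)) - rscale (`|xi| ^+ 2 + eta) (memory X xi).

Definition gen_dom (X : state) : Prop :=
  [/\ in_energy X, op_dom S (velocity X),
      exists h : H, represents S (force X) h,
      in_L2 (fun xi => rscale `|xi| (memory X xi)) &
      in_L2 (memory_rhs X)].

Definition gen (X : state) : state :=
  mkstate (velocity X) (- pivot_repr S (force X)) (memory_rhs X).

(* Continuity and differentiability on the closed half-line [0, +oo[ (one-sided
   at 0), for the norm of the energy space. *)
Definition C0_energy (X : R -> state) : Prop :=
  (forall t, 0 <= t -> in_energy (X t)) /\
  forall t, 0 <= t ->
    state_norm (state_sub (X r) (X t))
      @[r --> within (half_line R) (nbhs t)] --> 0.

Definition has_time_derivative (X dX : R -> state) : Prop :=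
  forall t, 0 <= t ->
    state_norm
        (state_sub (state_scale (r - t)^-1 (state_sub (X r) (X t))) (dX t))
      @[r --> within (half_line R) t^'] --> 0.

Definition C1_energy (X dX : R -> state) : Prop :=
  [/\ C0_energy X, C0_energy dX & has_time_derivative X dX].

(* The domain carries the graph norm. *)
Definition C0_gen_dom (X : R -> state) : Prop :=
  [/\ forall t, 0 <= t -> gen_dom (X t), C0_energy X & C0_energy (gen \o X)].

Definition strong_solution (X0 : state) (X : R -> state) : Prop :=
  [/\ C0_gen_dom X,
      exists2 dX, C1_energy X dX &
        forall t, 0 < t -> state_eq (dX t) (gen (X t)) &
      state_eq (X 0) X0].

(* X is continuous and X(t) = X0 + gen (\int_0^t X) for all t >= 0.  The
   integral is the primitive Y of X which vanishes at 0. *)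
Definition mild_solution (X0 : state) (X : R -> state) : Prop :=
  C0_energy X /\
  exists Y : R -> state,
    [/\ C1_energy Y X, state_eq (Y 0) state0 &
        forall t, 0 <= t ->
          gen_dom (Y t) /\ state_eq (X t) (state_add X0 (gen (Y t)))].

Definition initial (u0 u1 : H) : state := mkstate u0 u1 (fun=> 0).

Definition energy (X : R -> state) (t : R) : R := sqnorm (X t) / 2.

Definition dissipation (X : R -> state) (t : R) : R :=
  gam * \int[mu]_xi ((`|xi| ^+ 2 + eta) * rnorm (memory (X t) xi) ^+ 2).

(* The same quantity, with value +oo when the integral diverges, as may happen
   at some times for a mild solution. *)
Definition edissipation (X : R -> state) (t : R) : \bar R :=
  (gam%:E *
   \int[mu]_xi ((`|xi| ^+ 2 + eta) * rnorm (memory (X t) xi) ^+ 2)%:E)%E.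

Definition gen_dom_dense : Prop :=
  forall X, in_energy X -> forall e : R, 0 < e ->
    exists2 Y, gen_dom Y & state_norm (state_sub X Y) < e.

Definition unique_solution (sol : (R -> state) -> Prop) : Prop :=
  exists2 X, sol X &
    forall Y, sol Y -> forall t, 0 <= t -> state_eq (Y t) (X t).

End System.

(* Main.v *)
Require Import Defs.
From HB Require Import structures.
From mathcomp Require Import all_boot all_order all_algebra.
From mathcomp Require Import sesquilinear complex.
From mathcomp Require Import all_classical all_reals all_analysis.
From mathcomp Require Import measurable_realfun.
From mathcomp Require Import ring lra.

(** The augmented system is the evolution equation of a maximal dissipative operator of
    the energy space, and all five assertions are consequences of this fact.

    Dissipativity is a computation. In the real part of the product of [gen X] with
    [X], the two elastic terms cancel because [A^(1/2)] is symmetric, and the two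
    coupling terms cancel because [Bs] is the adjoint of [B]; what remains is
    [- gamma \int (xi^2 + eta) |phi|^2] ([gen_dissipation]). Maximality means that
    [X - h gen X = F] can be solved for every [h > 0] ([gen_surjective]). The position is
    [f1 + h v], the memory variable is an explicit function of [v], and the equation
    that remains for [v] is symmetric and coercive on [H_(1/2)]: it is solved by the
    representation theorem [riesz]. Here the restriction [0 < alpha < 1] enters, through the
    integrability of [p^2 / (1 + xi^2)] ([weight_density_integrable]), which also gives
    a meaning to [\int p phi] ([memory_integrable]). A maximal dissipative operator on a
    Hilbert space has a dense domain ([dissipative_generator]).

    The semigroup is the limit of implicit Euler schemes with dyadic steps. A step of length
    [2 a] and two steps of length [a] differ by [O(a^2)] on the domain of the square of the
    generator ([resolvent_halving]), hence halving the step is a geometrically convergent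
    procedure; the contraction property extends the limit to all data. The Riemann sums
    of the schemes converge along with them and give the primitive of a trajectory, which
    is what mild solutions are made of ([primitive_deriv], [primitive_rep_gen]).
    Uniqueness holds because the norm of the difference of two solutions decreases; for
    mild solutions this applies to their primitives ([strong_sol_unique],
    [mild_sol_unique]).

    For strong solutions the energy identity is the chain rule. A mild solution [X] with
    primitive [Y] is the limit of the strong solutions [(Y (t + h) - Y t) / h]
    ([mild_sol_average]). The dissipation is not continuous for the energy norm, but it is
    the increasing limit of continuous quadratic forms, obtained by truncating the
    frequencies. Applied to differences of these strong solutions, the identity itself
    shows that their dissipations converge, and it passes to the limit ([mild_energy]).

    Two devices keep the proof uniform. Only the real vector space underlying [H] and [U]
    is used ([realified]): equalities between scalars are tested through their real parts.
    States being functions rather than classes of functions, the energy norm is a seminorm,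
    and equality of states is the vanishing of the seminorm of their difference
    ([state_eqP]); the abstract part of the proof is written for seminorms of semidefinite
    forms. *)

Set Implicit Arguments.
Unset Strict Implicit.
Unset Printing Implicit Defensive.
Import Order.TTheory GRing.Theory Num.Theory.
Import numFieldNormedType.Exports.
Local Open Scope classical_set_scope.
Local Open Scope ring_scope.

(** * Preliminaries *)

Lemma cvg0P (R : realType) (u : nat -> R) :
  (forall n, 0 <= u n) ->
  u @ \oo --> (0 : R) <->
  (forall e : R, 0 < e -> exists n0, forall n, (n0 <= n)%N -> u n < e).
Proof.
move=> u0; split=> [/cvgrPdist_lt ul e /ul [n0 _ h]|h].
  exists n0 => n /h /=; rewrite sub0r normrN; apply: le_lt_trans.
  exact: ler_norm.
apply/cvgrPdist_lt => e /h [n0 {}h]; exists n0 => // n /h /=.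
by rewrite sub0r normrN ger0_norm.
Qed.

Lemma le_eps0 (R : realType) (x c : R) :
  0 <= c -> (forall e : R, 0 < e -> x <= c * e) -> x <= 0.
Proof.
move=> c0 h; apply/ler_addgt0Pr => e e0; rewrite add0r.
have c1 : 0 < c + 1 by lra.
rewrite (le_trans (h (e / (c + 1)) _)) ?divr_gt0//.
by rewrite mulrA ler_pdivrMr// mulrC ler_pM2l//; lra.
Qed.

(** Minimize the polynomial at [t = - c / q]. *)
Lemma discriminant_le (R : realType) (a c q : R) : 0 <= q ->
  (forall t, 0 <= a + 2 * t * c + t ^+ 2 * q) -> c ^+ 2 <= a * q.
Proof.
rewrite le_eqVlt => /predU1P[<-|q0] h.
  rewrite mulr0; have [->|c0] := eqVneq c 0; first by rewrite expr0n.
  have := h (- (a + 1) / (2 * c)).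
  have -> : a + 2 * (- (a + 1) / (2 * c)) * c + (- (a + 1) / (2 * c)) ^+ 2 * 0 = -1.
    by field.
  by lra.
have := h (- c / q).
have -> : a + 2 * (- c / q) * c + (- c / q) ^+ 2 * q = a - c ^+ 2 / q.
  by field; rewrite gt_eqF.
by rewrite subr_ge0 ler_pdivrMr.
Qed.

Lemma EFin_cvg0 (R : realType) (u : nat -> R) :
  (fun n => (u n)%:E) @ \oo --> (0%:E : \bar R) -> u @ \oo --> (0 : R).
Proof. by move=> /fine_cvgP[]. Qed.

(** The form in which Fatou's lemma is applied: the integrals are only known to be
    bounded by a convergent sequence. *)
Lemma limn_einf_le (R : realType) (u : (\bar R)^nat) (r_ : nat -> R) (r : R) :
  r_ @ \oo --> r -> (forall n, (u n <= (r_ n)%:E)%E) -> (limn_einf u <= r%:E)%E.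
Proof.
move=> rr ur; rewrite limn_einf_lim.
have rE : (fun n => (r_ n)%:E) @ \oo --> r%:E by apply: cvg_EFin => //; exact: nearW.
rewrite -(cvg_lim _ rE)//; apply: lee_lim.
- exact: is_cvg_einfs.
- by apply/cvg_ex; exists r%:E.
- by apply: nearW => n; apply: le_trans (ur n); apply: ereal_inf_lbound; exists n => /=.
Qed.

(** Stated for an arbitrary measure, so that the filter instance of the almost
    everywhere filter is found without unfolding the Lebesgue measure. *)
Lemma ae_imply d (T : measurableType d) (R : realType)
    (mu : {measure set T -> \bar R}) (P Q : T -> Prop) :
  (forall x, P x -> Q x) -> {ae mu, forall x, P x} -> {ae mu, forall x, Q x}.
Proof. by move=> PQ; apply: filterS => x /PQ. Qed.

Lemma subBACA (V : zmodType) (x y z w : V) : x - y - (z - w) = (x - z) - (y - w).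
Proof. by rewrite !opprD !opprK addrACA. Qed.

(** Trajectories are only prescribed on the closed half-line, where limits are taken. *)
Lemma within_eq_cvg {T : Type} {U : topologicalType} (A : set T) (F : set_system T)
    {FF : Filter F} (f g : T -> U) (l : U) :
  (forall r, A r -> f r = g r) -> f @ within A F --> l -> g @ within A F --> l.
Proof.
move=> fg fl P lP; have : F [set r | A r -> P (f r)] := fl P lP.
move=> h; suff : F [set r | A r -> P (g r)] by [].
by apply: filterS h => r h Ar; rewrite -fg//; exact: h.
Qed.


(** * Scalars and the underlying real space *)

Section Scalars.
Context {R : realType} {s : scalars}.
Local Notation K := (scalar_field R s).
Local Notation of_R := (@scalar_of R s).
Local Notation Re := (@scalar_Re R s).
Local Notation conj := (@scalar_conj R s).

Lemma scalar_of0 : of_R 0 = 0. Proof. by case: (s). Qed.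
Lemma scalar_of1 : of_R 1 = 1. Proof. by case: (s). Qed.
Lemma scalar_ofD a b : of_R (a + b) = of_R a + of_R b.
Proof. by case: (s) => //=; rewrite rmorphD. Qed.
Lemma scalar_ofM a b : of_R (a * b) = of_R a * of_R b.
Proof. by case: (s) => //=; rewrite rmorphM. Qed.
Lemma scalar_Re_of a : Re (of_R a) = a. Proof. by case: (s). Qed.
Lemma scalar_Re0 : Re 0 = 0. Proof. by case: (s). Qed.
Lemma scalar_ReD c d : Re (c + d) = Re c + Re d.
Proof. by case: (s) c d => //= -[? ?] [? ?]. Qed.
Lemma scalar_ReN c : Re (- c) = - Re c.
Proof. by case: (s) c => //= -[? ?]. Qed.
Lemma scalar_ReM a c : Re (of_R a * c) = a * Re c.
Proof. by case: (s) c => //= -[? ?] /=; rewrite mul0r subr0. Qed.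
Lemma scalar_Re_conj c : Re (conj c) = Re c.
Proof. by case: (s) c => //= -[? ?]. Qed.
Lemma scalar_conj_of a : conj (of_R a) = of_R a.
Proof. by case: (s) => //=; rewrite /real_complex_def /= oppr0. Qed.
(** The defect [c] of an equality between scalars vanishes as soon as the real
    part of [c * conj c] does; applied after multiplying a test vector by
    [conj c], this reduces such an equality to its real part. *)
Lemma scalar_Re_normsq_eq0 c : Re (c * conj c) = 0 -> c = 0.
Proof.
case: (s) c => [c|[a b]] /=; first by move/eqP; rewrite mulf_eq0 => /orP[] /eqP.
rewrite mulrN opprK => /eqP; rewrite paddr_eq0 ?sqr_ge0 -?expr2 ?sqr_ge0//.
by rewrite !sqrf_eq0 => /andP[/eqP-> /eqP->].
Qed.
Lemma scalar_ge0_of c : 0 <= c -> c = of_R (Re c) /\ 0 <= Re c.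
Proof.
case: (s) c => //= -[a b]; rewrite lecE /= => /andP[/eqP-> a0].
by split.
Qed.
Lemma scalar_le_Re (c d : K) : c <= d -> Re c <= Re d.
Proof. by case: (s) c d => //= -[? ?] [? ?]; rewrite lecE => /andP[]. Qed.
Lemma scalar_of_lt a b : (of_R a < of_R b) = (a < b).
Proof. by case: (s) => //=; rewrite ltcR. Qed.
Lemma scalar_Re_norm c : Re c <= Re `|c|.
Proof.
case: (s) c => [c|[a b]] /=; first exact: ler_norm.
by rewrite (le_trans (ler_norm a))// -sqrtr_sqr ler_wsqrtr// lerDl sqr_ge0.
Qed.
End Scalars.

(** The real Hilbert space underlying a Hilbert space: all the estimates below
    only use its real structure, whatever the field of scalars is. *)
Definition realified (R : realType) (s : scalars) (H : hilbertType R s) : Type :=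
  H.

Section Realified.
Context {R : realType} {s : scalars} (H : hilbertType R s).
Local Notation of_R := (@scalar_of R s).

HB.instance Definition _ := GRing.Zmodule.copy (realified H) (hilbert_sort H).

Let rscaleA (a b : R) (x : realified H) : rscale a (rscale b x : H) = rscale (a * b) x.
Proof. by rewrite /rscale scalerA scalar_ofM. Qed.
Let rscale1 (x : realified H) : rscale 1 (x : H) = x.
Proof. by rewrite /rscale scalar_of1 scale1r. Qed.
Let rscaleDr : right_distributive (fun a (x : realified H) => rscale a (x : H)) +%R.
Proof. by move=> a x y; rewrite /rscale scalerDr. Qed.
Let rscaleDl (x : realified H) :
  {morph (fun a => rscale a (x : H) : realified H) : a b / a + b}.
Proof. by move=> a b; rewrite /rscale scalar_ofD scalerDl. Qed.
HB.instance Definition _ := GRing.Zmodule_isLmodule.Build R (realified H)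
  rscaleA rscale1 rscaleDr rscaleDl.


(** A real bilinear form with the same norm as the inner product. *)
Definition rip (x y : realified H) : R := scalar_Re (ip H x y).

Lemma rscaleE a (x : realified H) : rscale a (x : H) = a *: x.
Proof. by []. Qed.

Lemma ripE (x y : realified H) : rip x y = scalar_Re (ip H x y).
Proof. by []. Qed.

Lemma ip_conj (x y : H) : ip H x y = scalar_conj (ip H y x).
Proof. by rewrite (hermitian_subproof (s := ip H)) /= expr0 mul1r. Qed.

Lemma ripC x y : rip x y = rip y x.
Proof. by rewrite /rip ip_conj scalar_Re_conj. Qed.

Lemma ripDl x y z : rip (x + y) z = rip x z + rip y z.
Proof. by rewrite /rip -scalar_ReD -linearDl. Qed.

Lemma ripZl a x y : rip (a *: x) y = a * rip x y.
Proof. by rewrite /rip -rscaleE /rscale linearZl_LR scalar_ReM. Qed.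

Lemma ripDr x y z : rip z (x + y) = rip z x + rip z y.
Proof. by rewrite ripC ripDl !(ripC z). Qed.

Lemma ripZr a x y : rip y (a *: x) = a * rip y x.
Proof. by rewrite ripC ripZl (ripC y). Qed.

Lemma rip0l x : rip 0 x = 0.
Proof. by rewrite -(scale0r (0 : realified H)) ripZl mul0r. Qed.

Lemma rip0r x : rip x 0 = 0.
Proof. by rewrite ripC rip0l. Qed.

Lemma ripNl x y : rip (- x) y = - rip x y.
Proof. by rewrite -scaleN1r ripZl mulN1r. Qed.

Lemma ripNr x y : rip x (- y) = - rip x y.
Proof. by rewrite ripC ripNl ripC. Qed.

Lemma ripBl x y z : rip (x - y) z = rip x z - rip y z.
Proof. by rewrite ripDl ripNl. Qed.

Lemma ripBr x y z : rip z (x - y) = rip z x - rip z y.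
Proof. by rewrite ripDr ripNr. Qed.

Lemma normrE (x : H) : `|x| = of_R (rnorm x).
Proof. by have [] := scalar_ge0_of (normr_ge0 x). Qed.

Lemma rnorm_ge0 (x : H) : 0 <= rnorm x.
Proof. by have [] := scalar_ge0_of (normr_ge0 x). Qed.

Lemma rnorm_sqr (x : realified H) : rnorm (x : H) ^+ 2 = rip x x.
Proof.
by rewrite /rip -ip_norm normrE !expr2 scalar_ReM scalar_Re_of.
Qed.

Lemma rip_ge0 x : 0 <= rip x x.
Proof. by rewrite -rnorm_sqr sqr_ge0. Qed.

Lemma rnorm_eq0 (x : realified H) : rnorm (x : H) = 0 -> x = 0.
Proof. by move=> x0; apply/eqP; rewrite -(@normr_eq0 _ H) normrE x0 scalar_of0. Qed.

Lemma rip_eq0 x : rip x x = 0 -> x = 0.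
Proof. by rewrite -rnorm_sqr => /eqP; rewrite sqrf_eq0 => /eqP/rnorm_eq0. Qed.

Lemma rnormD (x y : realified H) :
  rnorm (x + y : H) <= rnorm (x : H) + rnorm (y : H).
Proof.
rewrite -scalar_ReD; apply: scalar_le_Re.
exact: (@ler_normD _ (hilbert_sort H)).
Qed.

Lemma rnormZ a (x : realified H) : rnorm (a *: x : H) = `|a| * rnorm (x : H).
Proof.
apply: (@pexpIrn _ 2) => //; rewrite ?nnegrE ?mulr_ge0 ?rnorm_ge0//.
rewrite exprMn !rnorm_sqr ripZl ripZr mulrA real_normK ?num_real// expr2.
Qed.

Lemma rnormN (x : realified H) : rnorm (- x : H) = rnorm (x : H).
Proof. by rewrite -scaleN1r rnormZ normrN1 mul1r. Qed.

Lemma rnormB (x y : realified H) : rnorm (x - y : H) = rnorm (y - x : H).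
Proof. by rewrite -rnormN opprB. Qed.

Lemma rnorm0 : rnorm (0 : H) = 0.
Proof. by rewrite /rnorm normr0 scalar_Re0. Qed.

Lemma cvg_rnorm {T : Type} (F : set_system T) (FF : Filter F) (f : T -> H) (l : H) :
  f @ F --> l <-> (fun t => rnorm (f t - l)) @ F --> (0 : R).
Proof.
split=> [/cvgrPdist_lt fl|fl].
  apply/cvgrPdist_lt => e e0.
  have /fl : 0 < of_R e by rewrite -(@scalar_of0 R s) scalar_of_lt.
  apply: filterS => t; rewrite normrE scalar_of_lt sub0r normrN ger0_norm ?rnorm_ge0//.
  by rewrite rnormB.
apply/cvgrPdist_lt => e e0.
have [ee re0] := scalar_ge0_of (ltW e0).
have {}re0 : 0 < scalar_Re e by rewrite -(@scalar_of_lt R s) scalar_of0 -ee.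
move/cvgrPdist_lt : fl => /(_ _ re0); apply: filterS => t.
rewrite sub0r normrN ger0_norm ?rnorm_ge0// => h.
by rewrite normrE ee scalar_of_lt rnormB.
Qed.
End Realified.

(** The energy seminorm is not attached to a topological structure, hence the
    elementary definition. *)
Definition cauchy_for (R : realType) (V : zmodType) (N : V -> R)
    (u : nat -> V) : Prop :=
  forall e : R, 0 < e -> exists n0, forall m n, (n0 <= m)%N -> (n0 <= n)%N ->
    N (u m - u n) < e.

Lemma hilbert_complete (R : realType) s (H : hilbertType R s)
    (u : nat -> realified H) :
  cauchy_for (fun x : realified H => rnorm (x : H)) u ->
  exists l : realified H, (fun n => rnorm (u n - l : H)) @ \oo --> (0 : R).
Proof.
move=> cu; have /cauchy_cvgP ul : cauchy ((u : nat -> H) @ \oo).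
  apply: cauchy_exP => e e0.
  have [ee re0] := scalar_ge0_of (ltW e0).
  have {}re0 : 0 < scalar_Re e by rewrite -(@scalar_of_lt R s) scalar_of0 -ee.
  have [n0 h] := cu _ re0.
  exists (u n0); exists n0 => // n /= n0n.
  by rewrite -ball_normE /ball_/= normrE ee scalar_of_lt h.
exists (lim ((u : nat -> H) @ \oo)).
exact/cvg_rnorm.
Qed.

(** * Semidefinite forms and the representation of bounded functionals *)

(** Forms live on a subspace [E] because [A^(1/2)] and the integrals of
    square-integrable functions only make sense on their domains, and they may
    degenerate because functions are not identified when they agree almost
    everywhere. *)
Record form_on (R : realType) (V : lmodType R) (E : set V) (b : V -> V -> R) :
    Prop := FormOn {
  form_dom0 : E 0;
  form_dom_lin : forall a x y, E x -> E y -> E (a *: x + y);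
  form_sym : forall x y, E x -> E y -> b x y = b y x;
  form_lin : forall a x y z, E x -> E y -> E z ->
    b (a *: x + y) z = a * b x z + b y z;
  form_ge0 : forall x, E x -> 0 <= b x x }.

Definition fnorm (R : realType) (V : Type) (b : V -> V -> R) (x : V) : R :=
  Num.sqrt (b x x).

Definition complete_on (R : realType) (V : zmodType) (E : set V) (N : V -> R) :=
  forall u : nat -> V, (forall n, E (u n)) -> cauchy_for N u ->
    exists2 l, E l & (fun n => N (u n - l)) @ \oo --> (0 : R).

Section Form.
Context {R : realType} {V : lmodType R} {E : set V} {b : V -> V -> R}.
Hypothesis bP : form_on E b.
Local Notation N := (fnorm b).

Lemma dom_add x y : E x -> E y -> E (x + y).
Proof. by move=> ? ?; rewrite -(scale1r x); exact: (form_dom_lin bP). Qed.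
Lemma dom_scale a x : E x -> E (a *: x).
Proof.
by move=> ?; rewrite -(addr0 (a *: x)); apply: (form_dom_lin bP) => //; exact: (form_dom0 bP).
Qed.
Lemma dom_opp x : E x -> E (- x).
Proof. by rewrite -scaleN1r; exact: dom_scale. Qed.
Lemma dom_sub x y : E x -> E y -> E (x - y).
Proof. by move=> ? ?; apply: dom_add => //; exact: dom_opp. Qed.

Lemma form_addl x y z : E x -> E y -> E z -> b (x + y) z = b x z + b y z.
Proof. by move=> *; rewrite -{1}(scale1r x) (form_lin bP)// mul1r. Qed.
Lemma form_0l z : E z -> b 0 z = 0.
Proof.
move=> Ez; have E0 := form_dom0 bP.
by have := form_addl E0 E0 Ez; rewrite addr0; lra.
Qed.
Lemma form_scalel a x z : E x -> E z -> b (a *: x) z = a * b x z.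
Proof.
move=> Ex Ez; rewrite -(addr0 (a *: x)) (form_lin bP) ?form_0l ?addr0//.
exact: (form_dom0 bP).
Qed.
Lemma form_oppl x z : E x -> E z -> b (- x) z = - b x z.
Proof. by move=> ? ?; rewrite -scaleN1r form_scalel// mulN1r. Qed.
Lemma form_subl x y z : E x -> E y -> E z -> b (x - y) z = b x z - b y z.
Proof. by move=> *; rewrite form_addl ?form_oppl//; exact: dom_opp. Qed.
Lemma form_addr x y z : E x -> E y -> E z -> b z (x + y) = b z x + b z y.
Proof.
move=> Ex Ey Ez; rewrite (form_sym bP Ez (dom_add Ex Ey)) form_addl//.
by rewrite (form_sym bP Ex Ez) (form_sym bP Ey Ez).
Qed.
Lemma form_scaler a x z : E x -> E z -> b z (a *: x) = a * b z x.
Proof.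
move=> Ex Ez; rewrite (form_sym bP Ez (dom_scale a Ex)) form_scalel//.
by rewrite (form_sym bP Ex Ez).
Qed.
Lemma form_oppr x z : E x -> E z -> b z (- x) = - b z x.
Proof. by move=> ? ?; rewrite -scaleN1r form_scaler// mulN1r. Qed.
Lemma form_subr x y z : E x -> E y -> E z -> b z (x - y) = b z x - b z y.
Proof. by move=> *; rewrite form_addr ?form_oppr//; exact: dom_opp. Qed.

Lemma fnorm_ge0 x : 0 <= N x. Proof. exact: sqrtr_ge0. Qed.

Lemma fnorm_sqr x : E x -> N x ^+ 2 = b x x.
Proof. by move=> Ex; rewrite sqr_sqrtr//; exact: (form_ge0 bP). Qed.

Lemma fnorm_expand t x y : E x -> E y ->
  b (x + t *: y) (x + t *: y) = b x x + 2 * t * b x y + t ^+ 2 * b y y.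
Proof.
move=> Ex Ey; have Ety := dom_scale t Ey.
rewrite form_addl ?form_addr ?form_scalel ?form_scaler//; last exact: dom_add.
by rewrite (form_sym bP Ey Ex); ring.
Qed.

Lemma cauchy_schwarz x y : E x -> E y -> `|b x y| <= N x * N y.
Proof.
move=> Ex Ey; rewrite -(@ler_pXn2r _ 2) ?nnegrE ?mulr_ge0 ?fnorm_ge0//.
rewrite exprMn !fnorm_sqr// real_normK ?num_real//.
apply: discriminant_le; first exact: (form_ge0 bP).
move=> t; rewrite -fnorm_expand//; apply: (form_ge0 bP).
by apply: dom_add => //; exact: dom_scale.
Qed.

Lemma fnormD x y : E x -> E y -> N (x + y) <= N x + N y.
Proof.
move=> Ex Ey; rewrite -(@ler_pXn2r _ 2) ?nnegrE ?addr_ge0 ?fnorm_ge0//.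
rewrite fnorm_sqr; last exact: dom_add.
rewrite -{1 2}(scale1r y) fnorm_expand// sqrrD !fnorm_sqr// expr1n mul1r mulr1.
rewrite lerD2r lerD2l mulr_natl lerMn2r/=.
exact: le_trans (ler_norm _) (cauchy_schwarz Ex Ey).
Qed.

Lemma fnormZ a x : E x -> N (a *: x) = `|a| * N x.
Proof.
move=> Ex; rewrite /fnorm form_scalel ?form_scaler//; last exact: dom_scale.
by rewrite mulrA -expr2 sqrtrM ?sqr_ge0// sqrtr_sqr.
Qed.

(** Any [v] minimizing [b x x - 2 * l x] represents [l]. A minimizing sequence is
    Cauchy by the parallelogram identity, and perturbing it in the direction [x]
    bounds the defect [b (u n) x - l x] by the square root of its distance to the
    infimum. The argument does not see the kernel of the form. *)
Lemma riesz (l : V -> R) (C : R) :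
  complete_on E N ->
  (forall a x y, E x -> E y -> l (a *: x + y) = a * l x + l y) ->
  (forall x, E x -> `|l x| <= C * N x) ->
  exists2 v, E v & forall x, E x -> b v x = l x.
Proof.
move=> Ec ll lC.
pose J x := b x x - 2 * l x.
have Jlb x : E x -> - C ^+ 2 <= J x.
  move=> Ex; rewrite /J -fnorm_sqr//.
  have : l x <= C * N x by rewrite (le_trans (ler_norm _) (lC _ Ex)).
  have := sqr_ge0 (N x - C); rewrite sqrrB; lra.
have Jexp x y t : E x -> E y ->
    J (x + t *: y) = J x + 2 * t * (b x y - l y) + t ^+ 2 * b y y.
  move=> Ex Ey; rewrite /J fnorm_expand// addrC (addrC x) ll//; ring.
have E0 := form_dom0 bP.
pose d := inf [set J x | x in E].
have hasinf : has_inf [set J x | x in E].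
  split; first by exists (J 0), 0.
  by exists (- C ^+ 2) => _ [x Ex <-]; exact: Jlb.
have dJ x : E x -> d <= J x.
  by move=> Ex; apply: (ge_inf hasinf.2); exists x.
have /choice[u_ uE] n : exists x, E x /\ J x < d + n.+1%:R^-1.
  have [//|_ [x Ex <-] h] := inf_adherent (_ : 0 < n.+1%:R^-1 :> R) hasinf.
  by exists x.
have Jc x n : E x -> `|b (u_ n) x - l x| <= Num.sqrt n.+1%:R^-1 * N x.
  move=> Ex; have [Eu Ju] := uE n.
  rewrite -(@ler_pXn2r _ 2) ?nnegrE ?mulr_ge0 ?fnorm_ge0 ?sqrtr_ge0//.
  rewrite exprMn fnorm_sqr// real_normK ?num_real// sqr_sqrtr//.
  apply: discriminant_le; first exact: (form_ge0 bP).
  move=> t; have := dJ (u_ n + t *: x) (dom_add Eu (dom_scale _ Ex)).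
  rewrite Jexp//; move: Ju; set X := _ * (_ - _); set Y := _ * b x x; set Z := J _.
  move: (n.+1%:R^-1) (X) (Y) (Z) => w x1 y1 z1; by lra.
have cu : cauchy_for N u_.
  move=> e e0.
  have [n0 n0e] : exists n0, n0.+1%:R^-1 < e ^+ 2 / 4.
    exists (Num.truncn (e ^+ 2 / 4)^-1).
    rewrite invf_plt ?posrE ?divr_gt0 ?exprn_gt0//.
    exact: truncnS_gt.
  exists n0 => m n n0m n0n.
  have [Em Jm] := uE m; have [En Jn] := uE n.
  have Emn := dom_sub Em En.
  rewrite -(@ltr_pXn2r _ 2) ?nnegrE ?fnorm_ge0 ?(ltW e0)// fnorm_sqr//.
  (* The midpoint of [u_ m] and [u_ n]. *)
  have hm : d <= J (u_ m + (- 2^-1) *: (u_ m - u_ n)).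
    by apply: dJ; apply: dom_add => //; exact: dom_scale.
  rewrite Jexp// in hm.
  have := Jexp (u_ m) (u_ m - u_ n) (-1) Em Emn.
  rewrite scaleN1r opprB addrC subrK => Jn'.
  have le1 k : (n0 <= k)%N -> k.+1%:R^-1 <= n0.+1%:R^-1 :> R.
    by move=> ?; rewrite lef_pV2 ?posrE// ler_nat.
  move: Jm Jn n0e (le1 _ n0m) (le1 _ n0n) hm Jn'.
  move: (J (u_ m)) (J (u_ n)) (b (u_ m) _ - _) (b (u_ m - u_ n) _).
  by move: (m.+1%:R^-1) (n.+1%:R^-1) (n0.+1%:R^-1) => a1 a2 a3 a4 a5 a6 a7; lra.
have [v Ev uv] := Ec u_ (fun n => (uE n).1) cu.
exists v => // x Ex; apply/eqP; rewrite -subr_eq0 -normr_le0.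
apply: (@le_eps0 _ _ (2 * N x)); first by rewrite mulr_ge0 ?fnorm_ge0.
move=> e e0.
have /cvg0P -/(_ (fun=> fnorm_ge0 _) e e0) [n1 h1] := uv.
pose n0 := Num.truncn (e ^+ 2)^-1.
have h0 : n0.+1%:R^-1 < e ^+ 2.
  by rewrite invf_plt ?posrE ?exprn_gt0//; exact: truncnS_gt.
pose n := maxn n0 n1.
have [Eu _] := uE n.
have -> : b v x - l x = (b (u_ n) x - l x) - b (u_ n - v) x.
  by rewrite form_subl//; ring.
rewrite (le_trans (ler_normB _ _))// -mulrA mulr_natl mulr2n lerD//.
  rewrite (le_trans (Jc _ _ Ex))// mulrC ler_wpM2l ?fnorm_ge0//.
  rewrite -(ger0_norm (ltW e0)) -sqrtr_sqr ler_wsqrtr// (le_trans _ (ltW h0))//.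
  by rewrite lef_pV2 ?posrE// ler_nat ltnS leq_maxl.
rewrite (le_trans (cauchy_schwarz (dom_sub Eu Ev) Ex))// mulrC.
by rewrite ler_wpM2l ?fnorm_ge0// ltW// h1// leq_maxr.
Qed.
End Form.

(** * Calculus in a complete seminormed space *)

(** The energy space consists of functions, and two states are the same when the
    norm of their difference is zero. Rather than passing to a quotient, limits are
    taken for a seminorm and are unique up to vectors of seminorm zero. *)
Record seminorm (R : realType) (V : lmodType R) (N : V -> R) : Prop :=
  Seminorm {
    semiD : forall x y, N (x + y) <= N x + N y;
    semiZ : forall a x, N (a *: x) = `|a| * N x }.

Section Seminorm.
Context {R : realType} {V : lmodType R} {N : V -> R}.
Hypothesis NP : seminorm N.

Lemma semi0 : N 0 = 0.
Proof. by rewrite -(scale0r (0 : V)) (semiZ NP) normr0 mul0r. Qed.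
Lemma semiN x : N (- x) = N x.
Proof. by rewrite -scaleN1r (semiZ NP) normrN1 mul1r. Qed.
Lemma semiBC x y : N (x - y) = N (y - x).
Proof. by rewrite -semiN opprB. Qed.
Lemma semi_ge0 x : 0 <= N x.
Proof. by have := semiD NP x (- x); rewrite subrr semi0 semiN; lra. Qed.
Lemma semiB x y : N (x - y) <= N x + N y.
Proof. by rewrite -(semiN y); exact: semiD. Qed.
Lemma semi_trans y x z : N (x - z) <= N (x - y) + N (y - z).
Proof. by rewrite -{1}(subrK y x) -addrA; exact: semiD. Qed.
Lemma semi_dist x y : `|N x - N y| <= N (x - y).
Proof.
rewrite ler_norml; apply/andP; split.
  by have := semiD NP (y - x) x; rewrite subrK semiBC; lra.
by have := semiD NP (x - y) y; rewrite subrK; lra.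
Qed.
Lemma semi_eq0 x y : N (x - y) = 0 -> N x = N y.
Proof.
move=> xy; apply/eqP; rewrite -subr_eq0 -normr_le0.
by rewrite (le_trans (semi_dist _ _)) ?xy.
Qed.

Definition cvg_semi (u : nat -> V) (l : V) : Prop :=
  (fun n => N (u n - l)) @ \oo --> (0 : R).

Lemma cvg_semi_cst c : cvg_semi (fun=> c) c.
Proof. by rewrite /cvg_semi subrr semi0; exact: cvg_cst. Qed.

Lemma cvg_semi_squeeze (u : nat -> V) l (r : nat -> R) :
  r @ \oo --> (0 : R) -> (forall n, N (u n - l) <= r n) -> cvg_semi u l.
Proof.
move=> r0 ur; apply: (squeeze_cvgr (f := fun=> 0) (h := r)) => //.
  by apply: nearW => n; rewrite semi_ge0 ur.
exact: cvg_cst.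
Qed.

Lemma cvg_semiD u v l m : cvg_semi u l -> cvg_semi v m ->
  cvg_semi (fun n => u n + v n) (l + m).
Proof.
move=> ul vm; apply: (cvg_semi_squeeze (r := fun n => N (u n - l) + N (v n - m))).
  by rewrite -(addr0 0); exact: cvgD.
by move=> n; rewrite opprD addrACA; exact: semiD.
Qed.

Lemma cvg_semiZ a u l : cvg_semi u l -> cvg_semi (fun n => a *: u n) (a *: l).
Proof.
move=> ul; rewrite /cvg_semi; under eq_fun do rewrite -scalerBr (semiZ NP).
by rewrite -(mulr0 `|a|); apply: cvgM ul; exact: cvg_cst.
Qed.

Lemma cvg_semi_scale (a : nat -> R) (b : R) u l : a @ \oo --> b -> cvg_semi u l ->
  cvg_semi (fun n => a n *: u n) (b *: l).
Proof.
move=> ab ul; apply: (cvg_semi_squeeze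
  (r := fun n => `|a n| * N (u n - l) + `|a n - b| * N l)).
  have -> : 0 = `|b| * 0 + `|b - b| * N l :> R by rewrite subrr normr0 mulr0 mul0r addr0.
  apply: cvgD; first by apply: cvgM => //; exact: cvg_norm.
  apply: cvgM; last exact: cvg_cst.
  by apply: cvg_norm; apply: cvgB => //; exact: cvg_cst.
move=> n; rewrite -!(semiZ NP).
have -> : a n *: u n - b *: l = a n *: (u n - l) + (a n - b) *: l.
  by rewrite scalerBr scalerBl addrA subrK.
exact: (semiD NP).
Qed.

Lemma cvg_semiN u l : cvg_semi u l -> cvg_semi (fun n => - u n) (- l).
Proof.
by move/(cvg_semiZ (-1)); rewrite scaleN1r; under eq_fun do rewrite scaleN1r.
Qed.

Lemma cvg_semiB u v l m : cvg_semi u l -> cvg_semi v m ->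
  cvg_semi (fun n => u n - v n) (l - m).
Proof. by move=> ul /cvg_semiN; exact: cvg_semiD. Qed.

Lemma cvg_semi_norm u l : cvg_semi u l -> (N \o u) @ \oo --> N l.
Proof.
move=> ul; apply/cvgrPdist_lt => e e0; move/cvgrPdist_lt : ul => /(_ e e0).
apply: filterS => n; rewrite sub0r normrN; apply: le_lt_trans.
rewrite distrC (le_trans (semi_dist _ _))//; exact: ler_norm.
Qed.

Lemma cvg_semi_le u l (r_ : nat -> R) (r : R) :
  cvg_semi u l -> r_ @ \oo --> r -> (forall n, N (u n) <= r_ n) -> N l <= r.
Proof.
move=> /cvg_semi_norm ul rr h.
by apply: ler_cvg_to ul rr _; apply: nearW.
Qed.

Lemma cvg_semi_unique u l m : cvg_semi u l -> cvg_semi u m -> N (l - m) = 0.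
Proof.
move=> ul um; apply/eqP; rewrite eq_le semi_ge0 andbT.
have := cvg_semiB ul um; under eq_fun do rewrite subrr.
move=> h; apply: (cvg_semi_le h (cvg_cst 0)) => n; by rewrite semi0.
Qed.

Lemma cauchy_semi_geometric (u : nat -> V) (C : R) :
  (forall n, N (u n - u n.+1) <= C * 2^-1 ^+ n) -> cauchy_for N u.
Proof.
move=> uC.
have C0 : 0 <= C.
  by have := uC 0%N; rewrite expr0 mulr1; apply: le_trans; exact: semi_ge0.
have tail n k : N (u n - u (n + k)%N) <= 2 * C * 2^-1 ^+ n * (1 - 2^-1 ^+ k).
  elim: k => [|k IH]; first by rewrite addn0 subrr semi0 expr0 subrr mulr0.
  rewrite addnS (le_trans (semi_trans (u (n + k)%N) _ _))//.
  rewrite (le_trans (lerD IH (uC _)))// exprD exprS.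
  by rewrite le_eqVlt; apply/orP; left; apply/eqP; field.
have tail' n k : N (u n - u (n + k)%N) <= 2 * C * 2^-1 ^+ n.
  by rewrite (le_trans (tail n k))// ler_piMr ?(mulr_ge0 (mulr_ge0 _ C0)) ?exprn_ge0//.
move=> e e0.
have : (fun n => 4 * C * 2^-1 ^+ n) @ \oo --> (0 : R).
  rewrite -(mulr0 (4 * C)); apply: cvgM; first exact: cvg_cst.
  by apply: cvg_expr; rewrite ger0_norm//; lra.
move/cvgrPdist_lt => /(_ e e0) [n0 _ /(_ n0 (leqnn _))] /=.
rewrite sub0r normrN ger0_norm ?(mulr_ge0 (mulr_ge0 _ C0)) ?exprn_ge0// => h.
exists n0 => m n /subnKC <- /subnKC <-.
rewrite (le_lt_trans (semi_trans (u n0) _ _))// (le_lt_trans _ h)//.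
by rewrite semiBC (le_trans (lerD (tail' _ _) (tail' _ _)))//; lra.
Qed.

Definition half_cont (X : R -> V) : Prop := forall t : R, 0 <= t ->
  N (X r - X t) @[r --> within (half_line R) (nbhs t)] --> (0 : R).

Definition half_deriv (X dX : R -> V) : Prop := forall t : R, 0 <= t ->
  N ((r - t)^-1 *: (X r - X t) - dX t)
    @[r --> within (half_line R) t^'] --> (0 : R).

(** The epsilon-delta form, in which all later arguments are carried out. *)
Lemma half_contP X : half_cont X <-> forall t e : R, 0 <= t -> 0 < e ->
  exists2 d : R, 0 < d & forall r : R, 0 <= r -> `|r - t| < d -> N (X r - X t) < e.
Proof.
split=> [h t e t0 e0|h t t0].
  have /cvgrPdist_lt/(_ e e0) := h t t0.
  rewrite /prop_near1/= nbhs_simpl/= => -[d /= d0 dh]; exists d => // r r0 rt.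
  have := dh r; rewrite /= distrC => /(_ rt).
  rewrite /half_line/= in_itv/= andbT sub0r normrN => /(_ r0).
  by rewrite ger0_norm ?semi_ge0.
apply/cvgrPdist_lt => e e0; have [d d0 dh] := h t e t0 e0.
exists d => //= r; rewrite /= distrC => rt.
rewrite /half_line/= in_itv/= andbT sub0r normrN ger0_norm ?semi_ge0// => r0.
exact: dh.
Qed.

Lemma half_derivP X dX : half_deriv X dX <-> forall t e : R, 0 <= t -> 0 < e ->
  exists2 d : R, 0 < d & forall r : R, 0 <= r -> r != t -> `|r - t| < d ->
    N ((r - t)^-1 *: (X r - X t) - dX t) < e.
Proof.
split=> [h t e t0 e0|h t t0].
  have /cvgrPdist_lt/(_ e e0) := h t t0.
  rewrite /prop_near1/= nbhs_simpl/= => -[d /= d0 dh]; exists d => // r r0 rnt rt.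
  have := dh r; rewrite /= distrC => /(_ rt rnt).
  rewrite /half_line/= in_itv/= andbT sub0r normrN => /(_ r0).
  by rewrite ger0_norm ?semi_ge0.
apply/cvgrPdist_lt => e e0; have [d d0 dh] := h t e t0 e0.
exists d => //= r; rewrite /= distrC => rt rnt.
rewrite /half_line/= in_itv/= andbT sub0r normrN ger0_norm ?semi_ge0// => r0.
exact: dh.
Qed.

End Seminorm.

Arguments cvg_semi {R V} N u l.
Arguments half_cont {R V} N X.
Arguments half_deriv {R V} N X dX.

(** ** The seminorm of a semidefinite form *)

Section TotalForm.
Context {R : realType} {V : lmodType R} {b : V -> V -> R}.
Hypothesis bP : form_on setT b.
Local Notation N := (fnorm b).

Lemma form_seminorm : seminorm N.
Proof. by split=> [x y|a x]; [exact: (fnormD bP)|exact: (fnormZ bP)]. Qed.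
Let NP := form_seminorm.

(** By the Cauchy-Schwarz inequality the form does not see vectors of seminorm
    zero: representatives can be changed freely under [b]. *)
Lemma form_null z x : N z = 0 -> b z x = 0.
Proof.
move=> z0; apply/eqP; rewrite -normr_le0 (le_trans (cauchy_schwarz bP _ _))//.
by rewrite z0 mul0r.
Qed.

Lemma form_dist x y x' y' :
  `|b x y - b x' y'| <= N (x - x') * N y + N x' * N (y - y').
Proof.
have -> : b x y - b x' y' = b (x - x') y + b x' (y - y').
  by rewrite (form_subl bP)// (form_subr bP)// addrA subrK.
rewrite (le_trans (ler_normD _ _))// lerD//; exact: (cauchy_schwarz bP).
Qed.

Lemma cvg_form u v x y : cvg_semi N u x -> cvg_semi N v y ->
  (fun n => b (u n) (v n)) @ \oo --> b x y.
Proof.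
move=> ux vy; apply/cvgrPdist_le => e e0.
have : (fun n => N (u n - x) * N (v n) + N x * N (v n - y)) @ \oo --> (0 : R).
  have -> : (0 : R) = 0 * N y + N x * 0 by rewrite mul0r mulr0 addr0.
  apply: cvgD; apply: cvgM => //; first exact: (cvg_semi_norm NP vy).
  exact: cvg_cst.
move/cvgrPdist_le => /(_ e e0); apply: filterS => n.
rewrite sub0r normrN distrC => /(le_trans (ler_norm _)); apply: le_trans.
exact: form_dist.
Qed.
End TotalForm.

(** * Generation of a contraction semigroup by implicit Euler steps *)

(** Maximal dissipative operators, with the dissipativity in its metric form.
    The equation [y - h *: G y = x] has an exact solution, unique as a vector and not
    only up to seminorm zero: this makes the resolvent linear and keeps its
    values in the domain. *)
Record generator (R : realType) (V : lmodType R) (N : V -> R) (D : set V)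
    (G : V -> V) : Prop := Generator {
  gen_seminorm : seminorm N;
  gen_complete : complete_on setT N;
  gen_dom0 : D 0;
  gen_dom_lin : forall a x y, D x -> D y -> D (a *: x + y);
  gen_lin : forall a x y, D x -> D y -> G (a *: x + y) = a *: G x + G y;
  gen_range : forall h x, 0 < h -> exists2 y, D y & y - h *: G y = x;
  gen_dissip : forall h y, 0 < h -> D y -> N y <= N (y - h *: G y);
  gen_inj : forall h y, 0 < h -> D y -> y - h *: G y = 0 -> y = 0;
  gen_dense : forall x e, 0 < e -> exists2 y, D y & N (x - y) < e }.

Section Semigroup.
Context {R : realType} {V : lmodType R} {N : V -> R} {D : set V} {G : V -> V}.
Hypothesis GP : generator N D G.
Let NP := gen_seminorm GP.
Local Notation semi_ge0 := (semi_ge0 NP).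
Local Notation semi_trans := (semi_trans NP).
Local Notation semiBC := (semiBC NP).
Local Notation semiD := (semiD NP).
Local Notation semiZ := (semiZ NP).
Local Notation semiB := (semiB NP).
Local Notation cvg_semi := (cvg_semi N).

Lemma domD x y : D x -> D y -> D (x + y).
Proof. by move=> ? ?; rewrite -(scale1r x); exact: (gen_dom_lin GP). Qed.
Lemma domZ a x : D x -> D (a *: x).
Proof.
by move=> ?; rewrite -(addr0 (a *: x)); apply: (gen_dom_lin GP) => //;
  exact: (gen_dom0 GP).
Qed.
Lemma domN x : D x -> D (- x).
Proof. by rewrite -scaleN1r; exact: domZ. Qed.
Lemma domB x y : D x -> D y -> D (x - y).
Proof. by move=> ? ?; apply: domD => //; exact: domN. Qed.
Lemma genD x y : D x -> D y -> G (x + y) = G x + G y.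
Proof. by move=> *; rewrite -{1}(scale1r x) (gen_lin GP)// scale1r. Qed.
Lemma gen0 : G 0 = 0.
Proof.
have D0 := gen_dom0 GP.
by apply: (addIr (G 0)); rewrite -genD// !add0r.
Qed.
Lemma genZ a x : D x -> G (a *: x) = a *: G x.
Proof.
move=> Dx; rewrite -(addr0 (a *: x)) (gen_lin GP) ?gen0 ?addr0//.
exact: (gen_dom0 GP).
Qed.
Lemma genB x y : D x -> D y -> G (x - y) = G x - G y.
Proof.
move=> Dx Dy; rewrite genD//; last exact: domN.
by rewrite -scaleN1r genZ// scaleN1r.
Qed.

(** ** The resolvent *)

Definition resolvent (h : R) (x : V) : V :=
  xget 0 [set y | D y /\ y - h *: G y = x].
Local Notation J := resolvent.

Section Resolvent.
Variable h : R.
Hypothesis h0 : 0 < h.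

Lemma resolventP x : D (J h x) /\ J h x - h *: G (J h x) = x.
Proof.
rewrite /J; case: xgetP => [y _ //|nJ].
by have [y Dy yx] := gen_range GP x h0; case: (nJ y).
Qed.
Lemma resolvent_dom x : D (J h x). Proof. by case: (resolventP x). Qed.
Lemma resolvent_eq x : J h x - h *: G (J h x) = x.
Proof. by case: (resolventP x). Qed.
Lemma resolvent_gen x : h *: G (J h x) = J h x - x.
Proof. by rewrite -{3}(resolvent_eq x) opprB addrC subrK. Qed.

Lemma resolvent_uniq x y : D y -> y - h *: G y = x -> J h x = y.
Proof.
move=> Dy yx; apply/eqP; rewrite -subr_eq0; apply/eqP.
have Dz := domB (resolvent_dom x) Dy.
apply: (gen_inj GP h0 Dz); rewrite genB//; last exact: resolvent_dom.
have -> : J h x - y - h *: (G (J h x) - G y) =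
    (J h x - h *: G (J h x)) - (y - h *: G y).
  by rewrite scalerBr !opprD !opprK addrACA.
by rewrite resolvent_eq yx subrr.
Qed.

Lemma resolvent_lin a x y : J h (a *: x + y) = a *: J h x + J h y.
Proof.
have [Dx xE] := resolventP x; have [Dy yE] := resolventP y.
apply: resolvent_uniq; first exact: (gen_dom_lin GP).
rewrite (gen_lin GP)// -[in RHS]xE -[in RHS]yE scalerBr scalerDr !scalerA.
by rewrite (mulrC h) opprD addrACA.
Qed.

Lemma resolvent_contract x : N (J h x) <= N x.
Proof. by rewrite -{2}(resolvent_eq x); exact: (gen_dissip GP h0 (resolvent_dom _)). Qed.

Lemma resolvent_comm_gen x : D x -> J h (G x) = G (J h x).
Proof.
move=> Dx; have h_neq0 : h != 0 by rewrite gt_eqF.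
have GJ : G (J h x) = h^-1 *: (J h x - x).
  by rewrite -resolvent_gen scalerA mulVf// scale1r.
apply: resolvent_uniq.
  by rewrite GJ; apply: domZ; apply: domB => //; exact: resolvent_dom.
have Dy := resolvent_dom x.
rewrite {2}GJ genZ; last exact: domB.
by rewrite genB// scalerA divff// scale1r opprB addrC subrK.
Qed.
End Resolvent.

Lemma resolvent_comm h k x : 0 < h -> 0 < k -> J h (J k x) = J k (J h x).
Proof.
move=> h0 k0; apply/esym/resolvent_uniq => //; first exact: resolvent_dom.
have Dz := resolvent_dom k0 x.
rewrite -resolvent_comm_gen// -scaleN1r scalerA mulN1r addrC -resolvent_lin//.
by rewrite scaleNr addrC resolvent_eq.
Qed.

(** The operators [J h] tend to the identity as [h] tends to [0]. They map the
    domain to the domain of the square of [G], where the error estimates hold. *)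
Lemma resolvent_dense x e : 0 < e ->
  exists y, [/\ D y, D (G y) & N (x - y) < e].
Proof.
move=> e0; have e20 : 0 < e / 2 by rewrite divr_gt0.
have [y Dy xy] := gen_dense GP x e20.
pose h := e / 2 / (N (G y) + 1).
have N1 : 0 < N (G y) + 1 by rewrite ltr_wpDl ?semi_ge0.
have h0 : 0 < h by rewrite divr_gt0.
exists (J h y); split; first exact: resolvent_dom.
  by rewrite -resolvent_comm_gen//; exact: resolvent_dom.
rewrite (le_lt_trans (semi_trans y _ _))// (splitr e) ltr_leD// semiBC.
rewrite -resolvent_gen// semiZ gtr0_norm// -resolvent_comm_gen//.
rewrite (le_trans (ler_wpM2l (ltW h0) (resolvent_contract h0 _)))//.
by rewrite /h mulrAC ler_pdivrMr// ler_wpM2l ?(ltW e20)// lerDl.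
Qed.

(** ** Euler steps *)

Definition euler (h : R) (n : nat) (x : V) : V := iter n (J h) x.

(** The Riemann sum, at right end points, of the Euler trajectory. *)
Fixpoint eulersum (h : R) (n : nat) (x : V) : V :=
  if n is m.+1 then eulersum h m x + h *: euler h m.+1 x else 0.

Section Euler.
Variable h : R.
Hypothesis h0 : 0 < h.

Lemma euler_lin n a x y :
  euler h n (a *: x + y) = a *: euler h n x + euler h n y.
Proof. by elim: n => //= n IH; rewrite IH resolvent_lin. Qed.

Lemma euler_contract n x : N (euler h n x) <= N x.
Proof.
elim: n => //= n IH; exact: le_trans (resolvent_contract h0 _) IH.
Qed.

Lemma eulerB n x y : euler h n (x - y) = euler h n x - euler h n y.
Proof. by rewrite addrC -scaleN1r euler_lin scaleN1r addrC. Qed.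

Lemma eulersum_lin n a x y :
  eulersum h n (a *: x + y) = a *: eulersum h n x + eulersum h n y.
Proof.
elim: n => [|n IH] /=; first by rewrite scaler0 addr0.
have /= -> := euler_lin n.+1 a x y.
by rewrite IH !scalerDr !scalerA (mulrC h) addrACA.
Qed.

Lemma eulersumB n x y : eulersum h n (x - y) = eulersum h n x - eulersum h n y.
Proof. by rewrite addrC -scaleN1r eulersum_lin scaleN1r addrC. Qed.

Lemma eulersum_dom n x : D (eulersum h n x).
Proof.
elim: n => [|n IH] /=; first exact: (gen_dom0 GP).
by apply: domD => //; apply: domZ; exact: resolvent_dom.
Qed.

(** The sum telescopes. It belongs to the domain whatever the starting point: in the
    limit this yields mild solutions. *)
Lemma eulersum_gen n x : G (eulersum h n x) = euler h n x - x.
Proof.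
elim: n => [|n IH]; first by rewrite /= gen0 subrr.
have De : D (euler h n.+1 x) by exact: resolvent_dom.
rewrite /eulersum -/eulersum genD; [|exact: eulersum_dom|exact: domZ].
by rewrite genZ// {2}/euler iterS -/(euler _ _ _) resolvent_gen// IH addrC addrA subrK.
Qed.

Lemma euler_comm_gen n x : D x -> D (euler h n x) /\ euler h n (G x) = G (euler h n x).
Proof.
move=> Dx; elim: n => //= n [De ->].
by rewrite resolvent_comm_gen//; split => //; exact: resolvent_dom.
Qed.

Lemma euler_eulersum n x : D x -> euler h n x = x + eulersum h n (G x).
Proof.
move=> Dx; elim: n => [|n IH]; first by rewrite /= addr0.
rewrite /eulersum -/eulersum addrA -IH (euler_comm_gen n.+1 Dx).2.
by rewrite /euler iterS -/(euler _ _ _) resolvent_gen// addrC subrK.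
Qed.

Lemma eulersum_lip n k x :
  N (eulersum h (n + k) x - eulersum h n x) <= h * k%:R * N x.
Proof.
elim: k => [|k IH]; first by rewrite addn0 subrr (semi0 NP) mulr0 mul0r.
rewrite addnS /eulersum -/eulersum addrAC (le_trans (semiD _ _))//.
rewrite mulrS mulrDr mulrDl mulr1 [leRHS]addrC lerD// semiZ gtr0_norm//.
by rewrite ler_wpM2l ?(ltW h0)// euler_contract.
Qed.

Lemma euler_lip n k x : D x ->
  N (euler h (n + k) x - euler h n x) <= h * k%:R * N (G x).
Proof.
move=> Dx; rewrite !euler_eulersum// opprD addrACA subrr add0r.
exact: eulersum_lip.
Qed.

(** The Riemann sums have the Euler trajectory as approximate derivative, on both
    sides. The error is quadratic in the time [h * k%:R], uniformly in [h], so that it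
    survives the limit. *)
Lemma eulersum_deriv n k x : D x ->
  N (eulersum h (n + k) x - eulersum h n x - (h * k%:R) *: euler h n x)
    <= (h * k%:R) ^+ 2 * N (G x) /\
  N (eulersum h n x - eulersum h (n + k) x + (h * k%:R) *: euler h (n + k) x)
    <= (h * k%:R) ^+ 2 * N (G x).
Proof.
move=> Dx.
have hk j m : (j <= k)%N -> (m <= k)%N ->
    N (euler h (n + j) x - euler h (n + m) x) <= h * k%:R * N (G x).
  wlog jm : j m / (m <= j)%N.
    move=> w jk mk; have [/w|/ltnW/w] := leqP m j; first exact.
    by rewrite semiBC; exact.
  move=> jk mk; rewrite -(subnKC jm) addnA (le_trans (euler_lip _ _ Dx))//.
  rewrite ler_wpM2r ?semi_ge0// ler_wpM2l ?(ltW h0)// ler_nat.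
  by rewrite (leq_trans (leq_subr _ _)).
have step m j : (m <= k)%N -> (j <= k)%N ->
    N (eulersum h (n + j) x - eulersum h n x - (h * j%:R) *: euler h (n + m) x)
      <= h * j%:R * (h * k%:R * N (G x)).
  move=> mk; elim: j => [|j IH] jk.
    by rewrite addn0 mulr0 scale0r subrr subr0 (semi0 NP) mul0r.
  rewrite addnS /eulersum -/eulersum.
  have -> : eulersum h (n + j) x + h *: euler h (n + j).+1 x - eulersum h n x -
      (h * j.+1%:R) *: euler h (n + m) x =
    (eulersum h (n + j) x - eulersum h n x - (h * j%:R) *: euler h (n + m) x) +
    h *: (euler h (n + j).+1 x - euler h (n + m) x).
    rewrite mulrS mulrDr mulr1 scalerDl scalerBr opprD.
    by rewrite [RHS]addrACA (addrAC _ _ (- eulersum h n x)); congr (_ + _); exact: addrC.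
  rewrite (le_trans (semiD _ _))// mulrS mulrDr mulrDl mulr1 [leRHS]addrC lerD ?(IH (ltnW _))//.
    by rewrite semiZ gtr0_norm// ler_wpM2l ?(ltW h0)// -addnS hk.
split.
  by have := step 0%N k (leq0n _) (leqnn _); rewrite addn0 expr2 mulrA.
rewrite -(semiN NP) opprD opprB expr2 -mulrA.
exact: step.
Qed.
End Euler.

(** ** Convergence when the step is halved *)

Section Halving.
Variable a : R.
Hypothesis a0 : 0 < a.
Let h0 : 0 < 2 * a. Proof. by rewrite mulr_gt0. Qed.

Lemma euler_comm n x : J (2 * a) (euler a n x) = euler a n (J (2 * a) x).
Proof. by elim: n => //= n <-; rewrite resolvent_comm. Qed.

(** One step of length [2 a] and two steps of length [a] differ by
    [a ^+ 2 *: G (G x)] up to contractions, since [(1 - a G) ^ 2] is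
    [1 - 2 a G + a ^ 2 G ^ 2]. *)
Lemma resolvent_halving x : D x -> D (G x) ->
  N (J (2 * a) x - J a (J a x)) <= a ^+ 2 * N (G (G x)).
Proof.
move=> Dx DGx; pose y := J a x; pose w := J a y.
have Dy : D y by exact: resolvent_dom.
have Dw : D w by exact: resolvent_dom.
have DGy : D (G y).
  by rewrite /y -resolvent_comm_gen//; exact: resolvent_dom.
have DGw : D (G w).
  by rewrite /w -resolvent_comm_gen//; exact: resolvent_dom.
have GGw : G (G w) = J a (J a (G (G x))).
  by rewrite (resolvent_comm_gen a0 DGx) (resolvent_comm_gen a0 Dx)
    (resolvent_comm_gen a0 DGy) (resolvent_comm_gen a0 Dy).
have E1 : w - (2 * a) *: G w + a ^+ 2 *: G (G w) = x.
  have wy : w - a *: G w = y by exact: resolvent_eq.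
  have yx : y - a *: G y = x by exact: resolvent_eq.
  have aGw : D (a *: G w) by exact: domZ.
  rewrite -yx -wy genB// genZ// scalerBr scalerA -expr2 opprB mulr_natl mulr2n.
  by rewrite scalerDl opprD !addrA addrAC.
rewrite -{1}E1 -/y -/w.
have -> : w - (2 * a) *: G w + a ^+ 2 *: G (G w) =
    1 *: (w - (2 * a) *: G w) + a ^+ 2 *: G (G w) by rewrite scale1r.
rewrite resolvent_lin// scale1r.
have -> : J (2 * a) (w - (2 * a) *: G w) = w by exact: resolvent_uniq.
rewrite addrAC subrr add0r.
rewrite -(addr0 (a ^+ 2 *: G (G w))) resolvent_lin//.
have -> : J (2 * a) 0 = 0.
  apply: resolvent_uniq => //; first exact: (gen_dom0 GP).
  by rewrite gen0 scaler0 subr0.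
rewrite addr0 semiZ ger0_norm ?sqr_ge0// ler_wpM2l ?sqr_ge0//.
rewrite (le_trans (resolvent_contract h0 _))// GGw.
by rewrite (le_trans (resolvent_contract a0 _))// resolvent_contract.
Qed.

(** Telescoping: the difference of the [n]-th powers of [J (2 * a)] and of the square of
    [J a] is a sum of [n] contractions applied to the defect of one step. *)
Lemma euler_halving n x : D x -> D (G x) ->
  N (euler (2 * a) n x - euler a n.*2 x) <= n%:R * (a ^+ 2 * N (G (G x))).
Proof.
move=> Dx DGx; elim: n => [|n IH]; first by rewrite /= subrr (semi0 NP) mul0r.
have -> : euler (2 * a) n.+1 x - euler a n.+1.*2 x =
    J (2 * a) (euler (2 * a) n x - euler a n.*2 x) +
    euler a n.*2 (J (2 * a) x - J a (J a x)).
  have -> : euler a n.+1.*2 x = euler a n.*2 (J a (J a x)).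
    by rewrite doubleS /euler !iterSr.
  rewrite eulerB// -euler_comm.
  rewrite -[J _ (_ - _)]/(euler (2 * a) 1 (_ - _)) eulerB//= addrA.
  by rewrite subrK.
rewrite (mulrS _ n) [leRHS]mulrDl mul1r [leRHS]addrC (le_trans (semiD _ _))// lerD//.
  exact: le_trans (resolvent_contract _ _) IH.
by rewrite (le_trans (euler_contract _ _ _))// resolvent_halving.
Qed.

(** Besides the defect of the trajectory, each double step contributes the defect of the
    Riemann sum, which samples the trajectory at one point instead of two. *)
Lemma eulersum_halving n x : D x -> D (G x) ->
  N (eulersum (2 * a) n x - eulersum a n.*2 x) <=
    n%:R * (2 * a * (n%:R * (a ^+ 2 * N (G (G x)))) + a ^+ 2 * N (G x)).
Proof.
move=> Dx DGx; pose M := n%:R * (a ^+ 2 * N (G (G x))).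
suff : forall m, (m <= n)%N ->
    N (eulersum (2 * a) m x - eulersum a m.*2 x) <=
    m%:R * (2 * a * M + a ^+ 2 * N (G x)) by apply.
elim=> [|m IH] mn; first by rewrite /= subrr (semi0 NP) mul0r.
have -> : eulersum (2 * a) m.+1 x - eulersum a m.+1.*2 x =
   (eulersum (2 * a) m x - eulersum a m.*2 x) +
   ((2 * a) *: (euler (2 * a) m.+1 x - euler a m.+1.*2 x) +
    a *: (euler a m.*2.+2 x - euler a m.*2.+1 x)).
  rewrite doubleS /eulersum -/eulersum -!/eulersum.
  set A := eulersum _ _ _; set B := eulersum _ _ _.
  set e1 := euler _ m.+1 _; set e2 := euler _ m.*2.+1 _; set e3 := euler _ m.*2.+2 _.
  have two : (2 * a) *: e3 = a *: e3 + a *: e3 by rewrite -scalerDl -mulr2n mulr_natl.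
  rewrite !scalerBr two [- (a *: e3 + _)]opprD -[in RHS](addrA ((2 * a) *: e1)).
  have -> : (2 * a) *: e1 + (- (a *: e3) - a *: e3 + (a *: e3 - a *: e2)) =
      (2 * a) *: e1 - (a *: e3 + a *: e2) by rewrite !addrA subrK -addrA -opprD.
  by rewrite -(addrA B) opprD addrACA (addrC (a *: e2)).
rewrite (mulrS _ m) [leRHS]mulrDl mul1r [leRHS]addrC (le_trans (semiD _ _))// lerD ?IH 1?ltnW//.
rewrite (le_trans (semiD _ _))// !semiZ !gtr0_norm// lerD//.
  rewrite ler_wpM2l ?(ltW h0)// (le_trans (euler_halving _ _ _))//.
  by rewrite /M ler_wpM2r// ?ler_nat// mulr_ge0 ?sqr_ge0 ?semi_ge0.
rewrite expr2 -mulrA ler_wpM2l ?(ltW a0)// -addn1.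
by rewrite (le_trans (euler_lip a0 _ _ Dx))// mulr1.
Qed.
End Halving.

(** ** The limit of the Euler schemes with dyadic steps *)

Definition dyadic (n : nat) : R := 2^-1 ^+ n.
Definition nsteps (n : nat) (t : R) : nat := Num.truncn (t * 2 ^+ n).

Lemma dyadic_gt0 n : 0 < dyadic n. Proof. by rewrite exprn_gt0. Qed.

Lemma dyadicS n : dyadic n = 2 * dyadic n.+1.
Proof. by rewrite /dyadic exprS mulrA divff// mul1r. Qed.

Lemma nsteps_bounds n t : 0 <= t ->
  t - dyadic n <= dyadic n * (nsteps n t)%:R <= t.
Proof.
move=> t0; have p0 : 0 < 2 ^+ n :> R by rewrite exprn_gt0.
have /andP[h1 h2] := truncn_itv (mulr_ge0 t0 (ltW p0)).
rewrite /dyadic exprVn [_^-1 * _]mulrC; apply/andP; split.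
  by rewrite ler_pdivlMr// mulrBl mulVf ?gt_eqF// lerBlDr natr1 ltW.
by rewrite ler_pdivrMr.
Qed.

Lemma dyadic_cvg0 : dyadic @ \oo --> (0 : R).
Proof. by apply: cvg_expr; rewrite ger0_norm//; lra. Qed.

Lemma nsteps_cvg t : 0 <= t -> (fun n => dyadic n * (nsteps n t)%:R) @ \oo --> t.
Proof.
move=> t0; apply: (squeeze_cvgr (f := fun n => t - dyadic n) (h := fun=> t)).
- by apply: nearW => n; exact: nsteps_bounds.
- rewrite -[X in _ --> X]subr0; apply: cvgB; first exact: cvg_cst.
  exact: dyadic_cvg0.
- exact: cvg_cst.
Qed.

(** Halving the step doubles the number of steps, up to one. *)
Lemma nstepsS n t : 0 <= t ->
  nsteps n.+1 t = (nsteps n t).*2 \/ nsteps n.+1 t = (nsteps n t).*2.+1.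
Proof.
move=> t0; have p m : 0 <= t * 2 ^+ m by rewrite mulr_ge0 ?exprn_ge0.
have /andP[h1 h2] := truncn_itv (p n); rewrite -/(nsteps n t) in h1 h2.
have k1 : ((nsteps n t).*2 <= nsteps n.+1 t)%N.
  by rewrite truncn_ge_nat// exprS mulrCA -muln2 natrM mulrC ler_pM2l.
have k2 : (nsteps n.+1 t < (nsteps n t).*2.+2)%N.
  by rewrite truncn_lt_nat// exprS mulrCA -doubleS -muln2 natrM mulrC ltr_pM2r.
by move: k1 k2; rewrite leq_eqVlt => /predU1P[->|]; [left|right; apply/eqP;
  rewrite eqn_leq andbC; apply/andP].
Qed.

(** Uniformly bounded linear maps: convergence on a dense set is enough. *)
Lemma cauchy_dense (L : nat -> V -> V) (C : R) (x : V) :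
  (forall n y z, L n (y - z) = L n y - L n z) ->
  (forall n y, N (L n y) <= C * N y) ->
  (forall e : R, 0 < e -> exists2 y, cauchy_for N (fun n => L n y) & N (x - y) < e) ->
  cauchy_for N (fun n => L n x).
Proof.
move=> LB LC dns e e0.
have C1 : 0 < `|C| + 1 by rewrite ltr_wpDl.
have [|y cy xy] := dns (e / 3 / (`|C| + 1)); first by rewrite !divr_gt0.
have [|n0 h] := cy (e / 3); first by rewrite divr_gt0.
have bnd n : N (L n x - L n y) < e / 3.
  rewrite -LB (le_lt_trans (LC _ _))// (le_lt_trans (y := (`|C| + 1) * N (x - y)))//.
    by rewrite ler_wpM2r ?semi_ge0// ler_wpDr// ler_norm.
  by rewrite mulrC -ltr_pdivlMr.
exists n0 => m n m0 n0'.
have := semi_trans (L m y) (L m x) (L n x).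
have := semi_trans (L n y) (L m y) (L n x).
have := bnd m; have := bnd n; have := h m n m0 n0'; rewrite (semiBC (L n y)).
lra.
Qed.

Definition usum n t x := eulersum (dyadic n) (nsteps n t) x.
Definition utraj n t x := euler (dyadic n) (nsteps n t) x.

Lemma usum_bound n t x : 0 <= t -> N (usum n t x) <= t * N x.
Proof.
move=> t0; have := eulersum_lip (dyadic_gt0 n) 0 (nsteps n t) x.
rewrite add0n subr0 => /le_trans; apply; rewrite ler_wpM2r ?semi_ge0//.
by have /andP[] := nsteps_bounds n t0.
Qed.

(** For [y] and [G y] in the domain, [eulersum_halving] gives consecutive
    differences of order [2^-n]: there are about [t / a] steps of defect
    [a ^+ 2]. *)
Lemma usum_cauchy t x : 0 <= t -> cauchy_for N (fun n => usum n t x).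
Proof.
move=> t0; apply: (@cauchy_dense (fun n => usum n t) t).
- by move=> n y z; exact: eulersumB (dyadic_gt0 n) _ _ _.
- by move=> n y; exact: usum_bound.
move=> e /(resolvent_dense x) [y [Dy DGy xy]]; exists y => //.
pose c2 := N (G (G y)); pose c1 := N (G y); pose c0 := N y.
apply: (cauchy_semi_geometric NP (C := 2 * t ^+ 2 * c2 + t * c1 + c0)) => n.
have a0 := dyadic_gt0 n.+1; set a := dyadic n.+1 in a0.
rewrite /usum dyadicS -/a; set k := nsteps n t.
have kat : k%:R * a <= t.
  have /andP[_] := nsteps_bounds n t0; rewrite -/k dyadicS -/a; apply: le_trans.
  rewrite mulrC ler_wpM2r//; lra.
have step1 := eulersum_halving a0 k Dy DGy.
have step2 : N (eulersum a k.*2 y - eulersum a (nsteps n.+1 t) y) <= a * c0.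
  have [->|->] := nstepsS n t0; first by rewrite subrr (semi0 NP) mulr_ge0 ?semi_ge0 ?ltW.
  by rewrite -addn1 semiBC (le_trans (eulersum_lip a0 _ _ _))// mulr1.
rewrite (le_trans (semi_trans (eulersum a k.*2 y) _ _))// (le_trans (lerD step1 step2))//.
rewrite -/c1 -/c2 mulrC.
have ka0 : 0 <= k%:R * a by rewrite mulr_ge0// ltW.
have c20 : 0 <= c2 by exact: semi_ge0.
have c10 : 0 <= c1 by exact: semi_ge0.
have c00 : 0 <= c0 by exact: semi_ge0.
have an : a <= 2^-1 ^+ n by rewrite -/(dyadic n) dyadicS -/a; lra.
have -> : (2 * a * (k%:R * (a ^+ 2 * c2)) + a ^+ 2 * c1) * k%:R + a * c0 =
   a * (2 * (k%:R * a) ^+ 2 * c2 + (k%:R * a) * c1 + c0) by ring.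
have le1 : 2 * (k%:R * a) ^+ 2 * c2 <= 2 * t ^+ 2 * c2.
  by rewrite ler_wpM2r// ler_wpM2l// lerXn2r ?nnegrE.
have le2 : k%:R * a * c1 <= t * c1 by rewrite ler_wpM2r.
rewrite mulrC; apply: ler_pM => //; last by rewrite !lerD.
- rewrite !addr_ge0 ?(mulr_ge0 ka0 c10)//; apply: mulr_ge0 => //.
  by apply: mulr_ge0 => //; exact: sqr_ge0.
- exact: ltW.
Qed.

Lemma utraj_sum n t x : D x -> utraj n t x = x + usum n t (G x).
Proof. by move=> Dx; rewrite /utraj euler_eulersum//; exact: dyadic_gt0. Qed.

Lemma utraj_contract n t x : N (utraj n t x) <= N x.
Proof. exact: euler_contract (dyadic_gt0 n) _ _. Qed.

Lemma utraj_cauchy t x : 0 <= t -> cauchy_for N (fun n => utraj n t x).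
Proof.
move=> t0; apply: (@cauchy_dense (fun n => utraj n t) 1).
- by move=> n y z; exact: eulerB (dyadic_gt0 n) _ _ _.
- by move=> n y; rewrite mul1r utraj_contract.
move=> e /(gen_dense GP x) [y Dy xy]; exists y => // e' /(usum_cauchy (G y) t0) [n0 h].
exists n0 => m n m0 n0'; rewrite !utraj_sum// opprD addrACA subrr add0r.
exact: h.
Qed.

(** The semigroup, and the primitive of its trajectories. *)
Definition traj t x : V := xget 0 [set y | cvg_semi (fun n => utraj n t x) y].
Definition primitive t x : V := xget 0 [set y | cvg_semi (fun n => usum n t x) y].

Lemma traj_cvg t x : 0 <= t -> cvg_semi (fun n => utraj n t x) (traj t x).
Proof.
move=> t0; rewrite /traj; case: xgetP => [y _ //|nl].
by have [//|y _ ly] := gen_complete GP _ (utraj_cauchy x t0); case: (nl y).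
Qed.

Lemma primitive_cvg t x : 0 <= t -> cvg_semi (fun n => usum n t x) (primitive t x).
Proof.
move=> t0; rewrite /primitive; case: xgetP => [y _ //|nl].
by have [//|y _ ly] := gen_complete GP _ (usum_cauchy x t0); case: (nl y).
Qed.

Lemma traj_contract t x : 0 <= t -> N (traj t x) <= N x.
Proof.
move=> t0; apply: (cvg_semi_le NP (traj_cvg x t0) (cvg_cst (N x))) => n.
exact: utraj_contract.
Qed.

Lemma nsteps0 n : nsteps n 0 = 0%N.
Proof. by rewrite /nsteps mul0r truncn0. Qed.

Lemma traj0 x : N (traj 0 x - x) = 0.
Proof.
apply: (cvg_semi_unique NP (traj_cvg x (lexx 0))).
rewrite (_ : (fun n => _) = (fun=> x)); first exact: cvg_semi_cst.
by apply/funext => n; rewrite /utraj nsteps0.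
Qed.

Lemma primitive0 x : N (primitive 0 x) = 0.
Proof.
rewrite -[primitive 0 x]subr0; apply: (cvg_semi_unique NP (primitive_cvg x (lexx 0))).
rewrite (_ : (fun n => _) = (fun=> 0)); first exact: cvg_semi_cst.
by apply/funext => n; rewrite /usum nsteps0.
Qed.

Lemma trajB t x y : 0 <= t -> N (traj t (x - y) - (traj t x - traj t y)) = 0.
Proof.
move=> t0; apply: (cvg_semi_unique NP (traj_cvg (x - y) t0)).
rewrite (_ : (fun n => _) = (fun n => utraj n t x - utraj n t y)).
  by apply: (cvg_semiB NP); exact: traj_cvg.
by apply/funext => n; exact: eulerB (dyadic_gt0 n) _ _ _.
Qed.

Lemma primitiveB t x y : 0 <= t ->
  N (primitive t (x - y) - (primitive t x - primitive t y)) = 0.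
Proof.
move=> t0; apply: (cvg_semi_unique NP (primitive_cvg (x - y) t0)).
rewrite (_ : (fun n => _) = (fun n => usum n t x - usum n t y)).
  by apply: (cvg_semiB NP); exact: primitive_cvg.
by apply/funext => n; exact: eulersumB (dyadic_gt0 n) _ _ _.
Qed.

Lemma traj_primitive t x : 0 <= t -> D x ->
  N (traj t x - (x + primitive t (G x))) = 0.
Proof.
move=> t0 Dx; apply: (cvg_semi_unique NP (traj_cvg x t0)).
rewrite (_ : (fun n => _) = (fun n => x + usum n t (G x))).
  by apply: (cvg_semiD NP (cvg_semi_cst NP x)); exact: primitive_cvg.
by apply/funext => n; exact: utraj_sum.
Qed.

Lemma nsteps_le n s t : s <= t -> (nsteps n s <= nsteps n t)%N.
Proof. by move=> st; apply: le_truncn; rewrite ler_wpM2r ?exprn_ge0. Qed.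

Lemma nsteps_diff n s t : s <= t ->
  dyadic n * (nsteps n t - nsteps n s)%:R =
  dyadic n * (nsteps n t)%:R - dyadic n * (nsteps n s)%:R.
Proof. by move=> st; rewrite natrB ?nsteps_le// mulrBr. Qed.

Lemma primitive_lip s t x : 0 <= s -> 0 <= t ->
  N (primitive t x - primitive s x) <= `|t - s| * N x.
Proof.
wlog st : s t / s <= t.
  move=> w s0 t0; have [/w|/ltW/w] := leP s t; first exact.
  by rewrite semiBC distrC; exact.
move=> s0 t0; rewrite ger0_norm ?subr_ge0//.
apply: (cvg_semi_le NP (cvg_semiB NP (primitive_cvg x t0) (primitive_cvg x s0))
  (r_ := fun n => (dyadic n * (nsteps n t)%:R - dyadic n * (nsteps n s)%:R) * N x)).
  by apply: cvgM; [apply: cvgB; exact: nsteps_cvg|exact: cvg_cst].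
move=> n; rewrite -nsteps_diff// /usum -{1}(subnKC (nsteps_le n st)).
exact: eulersum_lip (dyadic_gt0 n) _ _ _.
Qed.

(** The limit of [eulersum_deriv], for both signs of [t - s]. *)
Lemma primitive_taylor s t x : 0 <= s -> 0 <= t -> D x ->
  N (primitive t x - primitive s x - (t - s) *: traj s x) <= (t - s) ^+ 2 * N (G x).
Proof.
move=> s0 t0 Dx.
pose c n := dyadic n * (nsteps n t)%:R - dyadic n * (nsteps n s)%:R.
have cts : c @ \oo --> t - s by apply: cvgB; exact: nsteps_cvg.
apply: (cvg_semi_le NP (cvg_semiB NP (cvg_semiB NP (primitive_cvg x t0)
  (primitive_cvg x s0)) (cvg_semi_scale NP cts (traj_cvg x s0)))
  (r_ := fun n => c n ^+ 2 * N (G x))).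
  apply: cvgM; last exact: cvg_cst.
  by rewrite expr2; under eq_fun do rewrite expr2; exact: cvgM.
move=> n; rewrite /usum /utraj.
have [st|/ltW ts] := leP s t.
  rewrite /c -nsteps_diff// -{1}(subnKC (nsteps_le n st)).
  exact: (eulersum_deriv (dyadic_gt0 n) _ _ Dx).1.
have -> : c n = - (dyadic n * (nsteps n s - nsteps n t)%:R).
  by rewrite nsteps_diff// opprB.
rewrite sqrrN scaleNr opprK.
have := (eulersum_deriv (dyadic_gt0 n) (nsteps n t) (nsteps n s - nsteps n t) Dx).2.
by rewrite subnKC// nsteps_le.
Qed.

(** On the domain this is [primitive_taylor]. The difference quotients of [primitive] and
    the operators [traj s] are contractions, which extends the convergence to the closure of
    the domain. *)
Lemma primitive_deriv x : half_deriv N (primitive ^~ x) (traj ^~ x).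
Proof.
apply/(half_derivP NP) => s e s0 e0.
have [|y Dy xy] := gen_dense GP x (_ : 0 < e / 3); first by rewrite divr_gt0.
have N1 : 0 < N (G y) + 1 by rewrite ltr_wpDl ?semi_ge0.
exists (e / 3 / (N (G y) + 1)); first by rewrite !divr_gt0.
move=> r r0 rs rse; have rs0 : r - s != 0 by rewrite subr_eq0.
pose F z := (r - s)^-1 *: (primitive r z - primitive s z).
have Flip z : N (F z) <= N z.
  rewrite /F semiZ normfV ler_pdivrMl ?normr_gt0//; exact: primitive_lip.
have Fy : N (F y - traj s y) < e / 3.
  have -> : F y - traj s y =
      (r - s)^-1 *: (primitive r y - primitive s y - (r - s) *: traj s y).
    by rewrite scalerBr scalerA mulVf// scale1r.
  rewrite semiZ normfV ltr_pdivrMl ?normr_gt0//.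
  rewrite (le_lt_trans (primitive_taylor s0 r0 Dy))//.
  rewrite -real_normK ?num_real// expr2 -mulrA ltr_pM2l ?normr_gt0//.
  rewrite (le_lt_trans (y := `|r - s| * (N (G y) + 1)))//.
    by rewrite ler_wpM2l// lerDl.
  by rewrite -ltr_pdivlMr.
have Fxy : N (F (x - y) - (F x - F y)) = 0.
  rewrite /F -!scalerBr semiZ; apply/eqP; rewrite mulf_eq0; apply/orP; right.
  apply/eqP/le_anti; rewrite semi_ge0 andbT.
  have -> : primitive r (x - y) - primitive s (x - y) -
      (primitive r x - primitive s x - (primitive r y - primitive s y)) =
     (primitive r (x - y) - (primitive r x - primitive r y)) -
     (primitive s (x - y) - (primitive s x - primitive s y)).
    by rewrite !opprD !opprK [in RHS]addrACA; congr (_ + _); rewrite [in RHS]addrACA.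
  by rewrite (le_trans (semiB _ _))// !primitiveB// addr0.
have : N (F x - traj s x) <= N (F x - F y) + N (F y - traj s y) + N (traj s x - traj s y).
  rewrite (le_trans (semi_trans (F y) _ _))// -addrA lerD2l semiBC.
  rewrite (le_trans (semi_trans (traj s y) _ _))// addrC lerD2l//.
  by rewrite semiBC.
rewrite -(semi_eq0 NP Fxy) -(semi_eq0 NP (trajB x y s0)).
have := Flip (x - y); have := traj_contract (x - y) s0.
by rewrite -/(F x); lra.
Qed.

Lemma traj_lip s t x : 0 <= s -> 0 <= t -> D x ->
  N (traj t x - traj s x) <= `|t - s| * N (G x).
Proof.
move=> s0 t0 Dx; rewrite (le_trans _ (primitive_lip (G x) s0 t0))//.
rewrite (le_trans (semi_trans (x + primitive t (G x)) _ _))//.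
rewrite traj_primitive// add0r (le_trans (semi_trans (x + primitive s (G x)) _ _))//.
rewrite opprD addrACA subrr add0r -[leRHS]addr0 lerD2l semiBC.
by rewrite traj_primitive.
Qed.

Lemma traj_cont x : half_cont N (traj ^~ x).
Proof.
apply/(half_contP NP) => t e t0 e0.
have [|y Dy xy] := gen_dense GP x (_ : 0 < e / 3); first by rewrite divr_gt0.
have N1 : 0 < N (G y) + 1 by rewrite ltr_wpDl ?semi_ge0.
exists (e / 3 / (N (G y) + 1)); first by rewrite !divr_gt0.
move=> r r0 rt.
have : N (traj r y - traj t y) < e / 3.
  rewrite (le_lt_trans (traj_lip _ _ _))//.
  rewrite (le_lt_trans (y := `|r - t| * (N (G y) + 1)))//.
    by rewrite ler_wpM2l// lerDl.
  by rewrite -ltr_pdivlMr.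
have := semi_trans (traj r y) (traj r x) (traj t x).
have := semi_trans (traj t y) (traj r y) (traj t x).
rewrite -(semi_eq0 NP (trajB x y r0)) (semiBC (traj t y)).
rewrite -(semi_eq0 NP (trajB x y t0)).
by have := traj_contract (x - y) r0; have := traj_contract (x - y) t0; lra.
Qed.

Lemma resolvent_cvg h u l : 0 < h -> cvg_semi u l ->
  cvg_semi (fun n => J h (u n)) (J h l).
Proof.
move=> h0 ul; apply: (cvg_semi_squeeze NP ul) => n.
by rewrite -[J h (u n) - _]/(euler h 1 (u n) - euler h 1 l) -eulerB// euler_contract.
Qed.

(** [primitive t x] itself may differ from an element of the domain by a vector
    of norm zero; the resolvent provides a representative in the domain. *)
Definition primitive_rep t x : V := J 1 (primitive t x - (traj t x - x)).
(** The same correction for trajectories: [J 1 (x - G x)] is [x] when [x] is in the domain. *)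
Definition traj_rep t x : V := J 1 (traj t (x - G x)).

Lemma primitive_repE t x : 0 <= t -> N (primitive_rep t x - primitive t x) = 0.
Proof.
move=> t0; apply: (cvg_semi_unique NP); last exact: primitive_cvg t0.
rewrite (_ : (fun n => _) = (fun n => J 1 (usum n t x - (utraj n t x - x)))).
  apply: resolvent_cvg => //; apply: (cvg_semiB NP (primitive_cvg x t0)).
  exact: (cvg_semiB NP (traj_cvg x t0) (cvg_semi_cst NP x)).
apply/funext => n; apply/esym/resolvent_uniq => //.
  exact: eulersum_dom (dyadic_gt0 n) _ _.
by rewrite scale1r (eulersum_gen (dyadic_gt0 n)).
Qed.

Lemma primitive_rep_gen t x : 0 <= t ->
  N (traj t x - (x + G (primitive_rep t x))) = 0.
Proof.
move=> t0; have := @resolvent_gen 1 ltr01 (primitive t x - (traj t x - x)).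
rewrite scale1r -/(primitive_rep t x) => ->.
have -> : x + (primitive_rep t x - (primitive t x - (traj t x - x))) =
    traj t x + (primitive_rep t x - primitive t x).
  by rewrite opprB addrCA (addrA x) [x + _]addrC subrK [RHS]addrCA.
by rewrite opprD addrA subrr add0r (semiN NP) primitive_repE.
Qed.

Lemma traj_repE t x : 0 <= t -> D x -> N (traj_rep t x - traj t x) = 0.
Proof.
move=> t0 Dx; apply: (cvg_semi_unique NP); last exact: traj_cvg t0.
rewrite (_ : (fun n => _) = (fun n => J 1 (utraj n t (x - G x)))).
  by apply: resolvent_cvg => //; exact: traj_cvg.
apply/funext => n; apply/esym/resolvent_uniq => //.
  exact: (euler_comm_gen (dyadic_gt0 n) _ Dx).1.
rewrite scale1r /utraj (eulerB (dyadic_gt0 n)).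
by rewrite (euler_comm_gen (dyadic_gt0 n) _ Dx).2.
Qed.

Lemma traj_rep_gen t x : 0 <= t -> D x ->
  N (G (traj_rep t x) - traj t (G x)) = 0.
Proof.
move=> t0 Dx; have := @resolvent_gen 1 ltr01 (traj t (x - G x)).
rewrite scale1r -/(traj_rep t x) => ->.
apply/eqP; rewrite eq_le semi_ge0 andbT.
have -> : traj_rep t x - traj t (x - G x) - traj t (G x) =
    (traj_rep t x - traj t x) - (traj t (x - G x) - (traj t x - traj t (G x))).
  by rewrite opprB !addrA subrK addrAC.
by rewrite (le_trans (semiB _ _))// traj_repE// trajB// addr0.
Qed.
End Semigroup.

Arguments resolvent {R V} D G h x.
Arguments traj {R V} N D G t x.
Arguments primitive {R V} N D G t x.
Arguments traj_rep {R V} N D G t x.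
Arguments primitive_rep {R V} N D G t x.

(** * Maximal dissipative operators *)

Section MaximalDissipative.
Context {R : realType} {V : lmodType R} {b : V -> V -> R} {D : set V} {G : V -> V}.
Hypothesis bP : form_on setT b.
Hypothesis bcomplete : complete_on setT (fnorm b).
Hypothesis D0 : D 0.
Hypothesis Dlin : forall a x y, D x -> D y -> D (a *: x + y).
Hypothesis Glin : forall a x y, D x -> D y -> G (a *: x + y) = a *: G x + G y.
Hypothesis Grange : forall (h : R) x, 0 < h -> exists2 y, D y & y - h *: G y = x.
Hypothesis Gdiss : forall x, D x -> b (G x) x <= 0.
Hypothesis Gnull : forall x, D x -> fnorm b x = 0 -> fnorm b (G x) = 0.
Hypothesis Ginj : forall (h : R) y, 0 < h -> D y -> y - h *: G y = 0 -> y = 0.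
Local Notation N := (fnorm b).
Let NP := form_seminorm bP.

(** The vector [v] below is the projection of [x] on the closure of [D], obtained by
    representing [b x] on this closure; then [x - v] is orthogonal to [D]. *)
Lemma subspace_dense : (forall z, (forall x, D x -> b z x = 0) -> N z = 0) ->
  forall x (e : R), 0 < e -> exists2 y, D y & N (x - y) < e.
Proof.
move=> orth x e e0.
pose E : set V := [set y | forall e : R, 0 < e -> exists2 z, D z & N (y - z) < e].
have DE y : D y -> E y.
  by move=> Dy d d0; exists y => //; rewrite subrr (semi0 NP).
have bE : form_on E b.
  split=> //; first exact: DE.
  - move=> a y z Ey Ez d d0.
    have a0 : 0 < `|a| + 1 by rewrite ltr_pwDr.
    have [y' Dy' hy] := Ey (d / 2 / (`|a| + 1)) (divr_gt0 (divr_gt0 d0 (ltr0Sn _ 1)) a0).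
    have [z' Dz' hz] := Ez (d / 2) (divr_gt0 d0 (ltr0Sn _ 1)).
    exists (a *: y' + z'); first exact: Dlin.
    rewrite opprD addrACA -scalerBr (le_lt_trans (semiD NP _ _))// (semiZ NP).
    rewrite [ltRHS](splitr d) ltr_leD ?(ltW hz)//.
    move: hy; rewrite ltr_pdivlMr// mulrC; apply: le_lt_trans.
    by rewrite ler_wpM2r ?(semi_ge0 NP)// lerDl.
  - by move=> y z _ _; exact: (form_sym bP).
  - by move=> a y z w _ _ _; exact: (form_lin bP).
  - by move=> y _; exact: (form_ge0 bP).
have Ec : complete_on E N.
  move=> u Eu cu; have [l _ ul] := bcomplete (fun=> I) cu.
  exists l => // d d0.
  have N0 n : 0 <= N (u n - l) := semi_ge0 NP _.
  have [n0 h] := (cvg0P N0).1 ul _ (divr_gt0 d0 (ltr0Sn _ 1)).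
  have [z Dz hz] := Eu n0 (d / 2) (divr_gt0 d0 (ltr0Sn _ 1)).
  exists z => //; rewrite (le_lt_trans (semi_trans NP (u n0) _ _))//.
  by rewrite [ltRHS](splitr d) ltrD// (semiBC NP) h.
have [|y Ey|v Ev vx] := riesz bE (l := b x) (C := N x) Ec.
- by move=> a y z _ _; rewrite (form_addr bP)// (form_scaler bP).
- exact: (cauchy_schwarz bP).
have xv : N (x - v) = 0.
  apply: orth => y Dy; rewrite (form_subl bP)// vx ?subrr//; exact: DE.
have [y Dy vy] := Ev e e0; exists y => //.
by rewrite (le_lt_trans (semi_trans NP v _ _))// xv add0r.
Qed.

(** A maximal dissipative operator on a Hilbert space is densely defined. If [z] is
    orthogonal to [D], write [z = y - G y] with [y] in [D]: then
    [b y y <= b z y = 0], so that [y], [G y] and [z] are null. *)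
Lemma dissipative_generator : generator N D G.
Proof.
split=> //.
- move=> h y h0 Dy; apply: ler_wsqrtr.
  rewrite (form_subl bP)// !(form_subr bP)// !(form_scalel bP)// !(form_scaler bP)//.
  have := form_ge0 bP (x := G y) I; have := Gdiss Dy.
  rewrite (form_sym bP (x := y) (y := G y))//.
  move: (b y y) (b (G y) y) (b (G y) (G y)) => p q r q0 r0.
  have := mulr_ge0 (mulr_ge0 (ltW h0) (ltW h0)) r0.
  have := mulr_ge0_le0 (ltW h0) q0; rewrite -mulrA; lra.
- apply: subspace_dense => z orth; have [y Dy zy] := Grange z ltr01.
  have N0 : N y = 0.
    have := orth y Dy; rewrite -zy scale1r (form_subl bP)// => h.
    have := Gdiss Dy; have := form_ge0 bP (x := y) I.
    move: (b (G y) y) h => q h y0 q0; apply/eqP; rewrite sqrtr_eq0; lra.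
  apply/le_anti; rewrite (semi_ge0 NP) andbT -zy scale1r.
  by rewrite (le_trans (semiB NP _ _))// N0 (Gnull Dy N0) addr0.
Qed.
End MaximalDissipative.

(** ** Derivatives on the half-line *)

Section HalfLine.
Context {R : realType} {V : lmodType R} {N : V -> R}.
Hypothesis NP : seminorm N.
Implicit Types X dX : R -> V.

Lemma half_cont_ext X X' : (forall t : R, 0 <= t -> N (X t - X' t) = 0) ->
  half_cont N X -> half_cont N X'.
Proof.
move=> XX' /(half_contP NP) cX; apply/(half_contP NP) => t e t0 e0.
have [d d0 dX] := cX t e t0 e0; exists d => // r r0 rt.
rewrite (le_lt_trans _ (dX r r0 rt))//.
have := semi_trans NP (X r) (X' r) (X' t); have := semi_trans NP (X t) (X r) (X' t).
by rewrite (semiBC NP (X' r) (X r)) !XX'//; lra.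
Qed.

Lemma half_deriv_ext X X' dX dX' : (forall t : R, 0 <= t -> N (X t - X' t) = 0) ->
  (forall t : R, 0 <= t -> N (dX t - dX' t) = 0) ->
  half_deriv N X dX -> half_deriv N X' dX'.
Proof.
move=> XX' dXX' /(half_derivP NP) h; apply/(half_derivP NP) => t e t0 e0.
have [d d0 hd] := h t e t0 e0; exists d => // r r0 rnt rt.
have := hd r r0 rnt rt; apply: le_lt_trans.
pose q (Z : R -> V) := (r - t)^-1 *: (Z r - Z t).
have qq : N (q X' - q X) = 0.
  rewrite /q -scalerBr (semiZ NP); apply/eqP; rewrite mulf_eq0; apply/orP; right.
  have -> : X' r - X' t - (X r - X t) = (X t - X' t) - (X r - X' r).
    by rewrite !opprB addrACA [RHS]addrACA (addrC (X t)).
  by rewrite eq_le (semi_ge0 NP) (le_trans (semiB NP _ _))// !XX'// addr0.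
have := semi_trans NP (q X) (q X') (dX' t).
have := semi_trans NP (dX t) (q X) (dX' t).
by rewrite qq dXX'// -/(q X) -/(q X'); lra.
Qed.

Lemma half_deriv_cont X dX : half_deriv N X dX -> half_cont N X.
Proof.
move=> /(half_derivP NP) h; apply/(half_contP NP) => t e t0 e0.
have [d d0 hd] := h t 1 t0 ltr01.
have N1 : 0 < N (dX t) + 1 by rewrite ltr_wpDl ?(semi_ge0 NP).
exists (Num.min d (e / (N (dX t) + 1))); first by rewrite lt_min d0 divr_gt0.
move=> r r0; rewrite lt_min => /andP[rd re].
have [->|rt] := eqVneq r t; first by rewrite subrr (semi0 NP).
have rt0 : r - t != 0 by rewrite subr_eq0.
have -> : X r - X t = (r - t) *: ((r - t)^-1 *: (X r - X t)).
  by rewrite scalerA divff// scale1r.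
rewrite (semiZ NP); move: re; rewrite ltr_pdivlMr//; apply: le_lt_trans.
rewrite ler_wpM2l// -{1}(subrK (dX t) (_ *: _)) (le_trans (semiD NP _ _))//.
by rewrite addrC lerD2l ltW// hd.
Qed.

Lemma half_contB X Y : half_cont N X -> half_cont N Y ->
  half_cont N (fun t => X t - Y t).
Proof.
move=> /(half_contP NP) cX /(half_contP NP) cY; apply/(half_contP NP) => t e t0 e0.
have e20 : 0 < e / 2 by rewrite divr_gt0.
have [d1 d10 h1] := cX t _ t0 e20; have [d2 d20 h2] := cY t _ t0 e20.
exists (Num.min d1 d2); first by rewrite lt_min d10.
move=> r r0; rewrite lt_min => /andP[/(h1 _ r0) k1 /(h2 _ r0) k2].
have -> : X r - Y r - (X t - Y t) = (X r - X t) - (Y r - Y t).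
  by rewrite !opprD !opprK addrACA.
by rewrite (le_lt_trans (semiB NP _ _))//; lra.
Qed.

Lemma half_contZ a X : half_cont N X -> half_cont N (fun t => a *: X t).
Proof.
move=> /(half_contP NP) cX; apply/(half_contP NP) => t e t0 e0.
have a1 : 0 < `|a| + 1 by rewrite ltr_wpDl.
have [d d0 h] := cX t (e / (`|a| + 1)) t0 (divr_gt0 e0 a1); exists d => // r r0 rt.
rewrite -scalerBr (semiZ NP).
have := h r r0 rt; rewrite ltr_pdivlMr// mulrC; apply: le_lt_trans.
by rewrite ler_wpM2r ?(semi_ge0 NP)// lerDl.
Qed.

Let shiftB (r t h : R) : r + h - (t + h) = r - t.
Proof. by rewrite opprD addrACA subrr addr0. Qed.

Lemma half_cont_shift h X : 0 <= h -> half_cont N X ->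
  half_cont N (fun t => X (t + h)).
Proof.
move=> h0 /(half_contP NP) cX; apply/(half_contP NP) => t e t0 e0.
have [d d0 hd] := cX (t + h) e (addr_ge0 t0 h0) e0; exists d => // r r0 rt.
by apply: hd; [exact: addr_ge0|rewrite shiftB].
Qed.

Lemma half_derivB X Y dX dY : half_deriv N X dX -> half_deriv N Y dY ->
  half_deriv N (fun t => X t - Y t) (fun t => dX t - dY t).
Proof.
move=> /(half_derivP NP) cX /(half_derivP NP) cY; apply/(half_derivP NP) => t e t0 e0.
have e20 : 0 < e / 2 by rewrite divr_gt0.
have [d1 d10 h1] := cX t _ t0 e20; have [d2 d20 h2] := cY t _ t0 e20.
exists (Num.min d1 d2); first by rewrite lt_min d10.
move=> r r0 rnt; rewrite lt_min => /andP[/(h1 _ r0 rnt) k1 /(h2 _ r0 rnt) k2].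
have -> : X r - Y r - (X t - Y t) = (X r - X t) - (Y r - Y t).
  by rewrite !opprD !opprK addrACA.
have -> : (r - t)^-1 *: (X r - X t - (Y r - Y t)) - (dX t - dY t) =
   ((r - t)^-1 *: (X r - X t) - dX t) - ((r - t)^-1 *: (Y r - Y t) - dY t).
  by rewrite scalerBr ![- (_ - _)]opprD !opprK addrACA.
by rewrite (le_lt_trans (semiB NP _ _))//; lra.
Qed.

Lemma half_derivZ a X dX : half_deriv N X dX ->
  half_deriv N (fun t => a *: X t) (fun t => a *: dX t).
Proof.
move=> /(half_derivP NP) cX; apply/(half_derivP NP) => t e t0 e0.
have a1 : 0 < `|a| + 1 by rewrite ltr_wpDl.
have [d d0 h] := cX t (e / (`|a| + 1)) t0 (divr_gt0 e0 a1); exists d => // r r0 rnt rt.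
rewrite -scalerBr scalerA mulrC -scalerA -scalerBr (semiZ NP).
have := h r r0 rnt rt; rewrite ltr_pdivlMr// mulrC; apply: le_lt_trans.
by rewrite ler_wpM2r ?(semi_ge0 NP)// lerDl.
Qed.

Lemma half_deriv_shift h X dX : 0 <= h -> half_deriv N X dX ->
  half_deriv N (fun t => X (t + h)) (fun t => dX (t + h)).
Proof.
move=> h0 /(half_derivP NP) cX; apply/(half_derivP NP) => t e t0 e0.
have [d d0 hd] := cX (t + h) e (addr_ge0 t0 h0) e0; exists d => // r r0 rnt rt.
have := hd (r + h); rewrite shiftB; apply => //; first exact: addr_ge0.
by apply: contra rnt => /eqP /addIr ->.
Qed.

Lemma half_deriv_null X dX : half_deriv N X dX ->
  (forall t : R, 0 <= t -> N (X t) = 0) -> forall t : R, 0 <= t -> N (dX t) = 0.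
Proof.
move=> /(half_derivP NP) cX X0 t t0; apply/eqP; rewrite eq_le (semi_ge0 NP) andbT.
apply/ler_addgt0Pr => e e0; rewrite add0r.
have [d d0 h] := cX t e t0 e0.
have := h (t + d / 2); rewrite addrAC subrr add0r.
have d2 : 0 < d / 2 by rewrite divr_gt0.
rewrite gtr0_norm// -subr_eq0 addrAC subrr add0r gt_eqF// ltr_pdivrMr//.
rewrite addr_ge0 ?(ltW d2)// mulr_natr mulr2n ltrDl => /(_ isT isT d0) /ltW.
have : N ((d / 2)^-1 *: (X (t + d / 2) - X t)) = 0.
  rewrite (semiZ NP); apply/eqP; rewrite mulf_eq0; apply/orP; right.
  rewrite eq_le (semi_ge0 NP) (le_trans (semiB NP _ _))// !X0// ?addr0//.
  by rewrite addr_ge0// ltW.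
have := semi_trans NP ((d / 2)^-1 *: (X (t + d / 2) - X t)) (dX t) 0.
by rewrite !subr0 (semiBC NP (dX t) (_ *: _)); lra.
Qed.

(** Sequences are needed to take limits under the integral sign. *)
Lemma half_deriv_seq X dX t : half_deriv N X dX -> 0 <= t ->
  cvg_semi N (fun n => (n.+1%:R^-1)^-1 *: (X (t + n.+1%:R^-1) - X t)) (dX t).
Proof.
move=> /(half_derivP NP) cX t0; apply/cvg0P; first by move=> n; exact: (semi_ge0 NP).
move=> e e0; have [d d0 h] := cX t e t0 e0.
exists (Num.truncn d^-1) => n kn.
have n0 : 0 < n.+1%:R^-1 :> R by rewrite invr_gt0.
have := h (t + n.+1%:R^-1); rewrite (addrAC t) subrr add0r; apply.
- by rewrite addr_ge0// ltW.
- by rewrite -subr_eq0 addrAC subrr add0r gt_eqF.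
- rewrite gtr0_norm// invf_plt ?posrE// (lt_le_trans (truncnS_gt _))//.
  by rewrite ler_nat ltnS.
Qed.
End HalfLine.

(** ** Real functions on the half-line *)

Section RealHalfLine.
Context {R : realType}.
Implicit Types f d : R -> R^o.
Local Notation abs := (fun x : R^o => `|x : R|).

Lemma abs_seminorm : @seminorm R R^o abs.
Proof. by split=> [x y|a x]; [exact: ler_normD|exact: normrM]. Qed.
Let NP := abs_seminorm.

Lemma half_cont_within f (a b : R) : half_cont abs f -> 0 <= a -> a < b ->
  {within `[a, b], continuous (f : R -> R)}.
Proof.
move=> /(half_contP NP) fc a0 ab; apply/continuous_within_itvP => //; split.
- move=> t; rewrite in_itv/= => /andP[at_ tb].
  have t0 : 0 < t by exact: le_lt_trans at_.
  rewrite /continuous_at; apply/cvgrPdist_lt => e e0.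
  have [d d0 h] := fc t e (ltW t0) e0.
  exists (Num.min d t); first by rewrite /= lt_min d0.
  move=> r /=; rewrite lt_min !(distrC t) => /andP[rd rt]; rewrite distrC; apply: h => //.
  by have := ler_norm (t - r); rewrite (distrC t); lra.
- apply/cvgrPdist_lt => e e0; have [d d0 h] := fc a e a0 e0.
  exists d => // r /=; rewrite !(distrC a) => rd ar; rewrite distrC; apply: h => //.
  exact: le_trans a0 (ltW ar).
- have b0 := le_lt_trans a0 ab.
  apply/cvgrPdist_lt => e e0; have [d d0 h] := fc b e (ltW b0) e0.
  exists (Num.min d b); first by rewrite /= lt_min d0.
  move=> r /=; rewrite lt_min !(distrC b) => /andP[rd rt] _; rewrite distrC; apply: h => //.
  by have := ler_norm (b - r); rewrite (distrC b); lra.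
Qed.

Lemma half_deriv_is_derive f d (t : R) : half_deriv abs f d -> 0 < t ->
  is_derive t (1 : R) (f : R -> R) (d t : R).
Proof.
move=> /(half_derivP NP) fd t0.
have fl : (fun h : R => h^-1 *: ((f : R -> R) (h *: 1 + t) - f t)) @ 0^' --> (d t : R).
  apply/cvgrPdist_lt => e e0; have [k k0 h] := fd t e (ltW t0) e0.
  exists (Num.min k t); first by rewrite /= lt_min k0.
  move=> r /=; rewrite sub0r normrN lt_min => /andP[rk rt] r0.
  have := h (r + t); rewrite addrK [r *: 1]mulr1 distrC; apply => //.
    by have := ler_norm (- r); rewrite normrN; lra.
  by rewrite -subr_eq0 addrK.
apply: DeriveDef; first by apply/cvg_ex; exists (d t).
exact: cvg_lim.
Qed.

Lemma half_deriv_nonincreasing f d (s t : R) : half_deriv abs f d ->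
  (forall r : R, 0 <= r -> d r <= 0) -> 0 <= s -> s <= t -> f t <= f s.
Proof.
move=> fd d0 s0; rewrite le_eqVlt => /predU1P[->//|st].
have fi (r : R) : 0 < r -> is_derive r (1 : R) (f : R -> R) (d r : R) by exact: half_deriv_is_derive.
have rpos (r : R) : r \in `]s, t[ -> 0 < r.
  by rewrite in_itv/= => /andP[sr _]; exact: le_lt_trans s0 sr.
apply: (@ler0_derive1_nincr R f s t) => //.
- by move=> r /rpos /fi [].
- by move=> r /rpos r0; have h := fi r r0; rewrite derive1E derive_val d0// ltW.
- by apply: half_cont_within => //; exact: half_deriv_cont fd.
- exact: ltW.
Qed.

Lemma half_FTC f d (s t : R) : half_deriv abs f d -> half_cont abs d -> 0 <= s -> s <= t ->
  (\int[lebesgue_measure]_(r in `[s, t]) ((d r : R)%:E) = (f t - f s)%:E)%E.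
Proof.
move=> fd dc s0; rewrite le_eqVlt => /predU1P[<-|st].
  by rewrite set_itv1 integral_set1 subrr.
have fi (r : R) : 0 < r -> is_derive r (1 : R) (f : R -> R) (d r : R) by exact: half_deriv_is_derive.
have rpos (r : R) : r \in `]s, t[ -> 0 < r.
  by rewrite in_itv/= => /andP[sr _]; exact: le_lt_trans s0 sr.
rewrite (@continuous_FTC2 R d f s t)//.
- exact: half_cont_within.
- have /continuous_within_itvP := half_cont_within (half_deriv_cont NP fd) s0 st.
  move=> /(_ st)[_ ls lt]; split=> // r /rpos /fi []//.
- by move=> r /rpos /fi; rewrite derive1E => h; rewrite derive_val.
Qed.
End RealHalfLine.

(** ** Calculus for a semidefinite form *)

Section FormCalculus.
Context {R : realType} {V : lmodType R} {b : V -> V -> R}.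
Hypothesis bP : form_on setT b.
Local Notation N := (fnorm b).
Local Notation abs := (fun x : R^o => `|x : R|).
Let NP := form_seminorm bP.

Lemma half_cont_form X Y : half_cont N X -> half_cont N Y ->
  half_cont abs (fun t => b (X t) (Y t) : R^o).
Proof.
move=> /(half_contP NP) cX /(half_contP NP) cY.
apply/(half_contP abs_seminorm) => t e t0 e0.
pose M := N (X t) + N (Y t) + 1.
have NX := semi_ge0 NP (X t); have NY := semi_ge0 NP (Y t).
have M0 : 0 < M by rewrite /M; lra.
pose k := Num.min 1 (e / M).
have k0 : 0 < k by rewrite lt_min ltr01 divr_gt0.
have [d1 d10 h1] := cX t k t0 k0; have [d2 d20 h2] := cY t k t0 k0.
exists (Num.min d1 d2); first by rewrite lt_min d10.
move=> r r0; rewrite lt_min => /andP[/(h1 _ r0) k1 /(h2 _ r0) k2].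
rewrite (le_lt_trans (form_dist bP _ _ _ _))//.
have Yr : N (Y r) <= N (Y t) + 1.
  have := semiD NP (Y r - Y t) (Y t); rewrite subrK.
  have : N (Y r - Y t) < 1 by rewrite (lt_le_trans k2)// ge_min lexx.
  lra.
apply: (@le_lt_trans _ _ (N (X r - X t) * (N (Y t) + 1) + N (X t) * k)).
  by rewrite lerD// ?ler_wpM2l ?(semi_ge0 NP)// ltW.
apply: (@lt_le_trans _ _ (k * M)).
  have : N (X r - X t) * (N (Y t) + 1) < k * (N (Y t) + 1) by rewrite ltr_pM2r//; lra.
  by rewrite /M; move: (N (X r - _)) (N (X t)) (N (Y t)) (k) => u v w z; lra.
by rewrite -ler_pdivlMr// /k ge_min lexx orbT.
Qed.

(** The difference quotient of [b X X / 2] at [t] is [b q (X t) + b q (X r - X t) / 2],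
    where [q] is the one of [X]; the second term tends to [0]. *)
Lemma half_deriv_form X dX : half_deriv N X dX ->
  half_deriv abs (fun t => b (X t) (X t) / 2 : R^o) (fun t => b (dX t) (X t) : R^o).
Proof.
move=> Xd; have cX := half_deriv_cont NP Xd.
move: Xd cX => /(half_derivP NP) Xd /(half_contP NP) cX.
apply/(half_derivP abs_seminorm) => t e t0 e0.
have NX := semi_ge0 NP (X t); have ND := semi_ge0 NP (dX t).
pose M := N (X t) + N (dX t) + 2.
have M0 : 0 < M by rewrite /M; lra.
pose k := Num.min 1 (e / M).
have k0 : 0 < k by rewrite lt_min ltr01 divr_gt0.
have k1 : k <= 1 by rewrite ge_min lexx.
have kM : k * M <= e by rewrite -ler_pdivlMr// /k ge_min lexx orbT.
have [d1 d10 h1] := cX t k t0 k0; have [d2 d20 h2] := Xd t k t0 k0.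
exists (Num.min d1 d2); first by rewrite lt_min d10.
move=> r r0 rnt; rewrite lt_min => /andP[/(h1 _ r0) hx /(h2 _ r0 rnt) hd].
set q := (r - t)^-1 *: (X r - X t) in hd *.
have -> : (r - t)^-1 *: ((b (X r) (X r) / 2 : R^o) - b (X t) (X t) / 2) =
    b q (X t) + b q (X r - X t) / 2.
  rewrite /q !(form_scalel bP)// !(form_subl bP)// !(form_subr bP)//.
  rewrite (form_sym bP (x := X r) (y := X t))//.
  rewrite -[LHS]/((r - t)^-1 * (b (X r) (X r) / 2 - b (X t) (X t) / 2)).
  by field; rewrite subr_eq0.
have -> : b q (X t) + b q (X r - X t) / 2 - b (dX t) (X t) =
    b (q - dX t) (X t) + b q (X r - X t) / 2.
  by rewrite (form_subl bP)//; ring.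
have qN : N q <= N (dX t) + 1.
  have := semiD NP (q - dX t) (dX t); rewrite subrK; move: k1 hd; lra.
have B1 := cauchy_schwarz bP (x := q - dX t) (y := X t) I I.
have B2 := cauchy_schwarz bP (x := q) (y := X r - X t) I I.
rewrite (le_lt_trans (ler_normD _ _))// normrM (ger0_norm (x := 2^-1)) ?invr_ge0//.
have C1 : N (q - dX t) * N (X t) <= k * N (X t) by rewrite ler_wpM2r// ltW.
have C2 : N q * N (X r - X t) <= (N (dX t) + 1) * k.
  by rewrite ler_pM ?(semi_ge0 NP)// ltW.
have C3 : 0 <= k * N (dX t) by rewrite mulr_ge0// ltW.
move: B1 B2 C1 C2 C3 kM; rewrite /M.
move: (`|b (q - dX t) (X t)|) (`|b q _|) (N (q - dX t) * _) (N q * _) => a1 a2 a3 a4.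
by move: (N (X t)) (N (dX t)) (k) k0 => u v w w0; lra.
Qed.

Lemma half_dissip X dX s t : half_deriv N X dX ->
  (forall r : R, 0 <= r -> b (dX r) (X r) <= 0) -> 0 <= s -> s <= t ->
  N (X t) <= N (X s).
Proof.
move=> Xd d0 s0 st; rewrite /fnorm ler_wsqrtr//.
have := half_deriv_nonincreasing (half_deriv_form Xd) d0 s0 st.
by rewrite ler_pM2r.
Qed.
End FormCalculus.

(** ** Solutions of the evolution equation of a dissipative generator *)

Section Evolution.
Context {R : realType} {V : lmodType R} {b : V -> V -> R} {D : set V} {G : V -> V}.
Hypothesis bP : form_on setT b.
Hypothesis GP : generator (fnorm b) D G.
Hypothesis Gdiss : forall x, D x -> b (G x) x <= 0.
Local Notation N := (fnorm b).
Let NP := form_seminorm bP.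

Definition strong_sol (X dX : R -> V) : Prop :=
  [/\ half_cont N dX, half_deriv N X dX, forall t : R, 0 <= t -> D (X t) &
      forall t : R, 0 <= t -> N (dX t - G (X t)) = 0].

(** [Y] is the primitive of [X]; since [Y' = x + G Y] up to null vectors, [Y] is itself
    a strong solution of an inhomogeneous equation, which yields uniqueness. *)
Definition mild_sol (x : V) (X Y : R -> V) : Prop :=
  [/\ half_cont N X, half_deriv N Y X, forall t : R, 0 <= t -> D (Y t) &
      forall t : R, 0 <= t -> N (X t - (x + G (Y t))) = 0].

(** For [x] in the domain, [G] commutes with the semigroup, hence
    [traj x = x + primitive (G x)] is differentiable, with derivative
    [traj (G x) = G (traj x)]. *)
Lemma strong_sol_exists x : D x ->
  exists X dX, strong_sol X dX /\ N (X 0 - x) = 0.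
Proof.
move=> Dx; exists (fun t => traj_rep N D G t x), (fun t => traj N D G t (G x)).
have XE t : 0 <= t -> N (traj N D G t x - traj_rep N D G t x) = 0.
  by move=> t0; rewrite (semiBC NP); exact: traj_repE GP _ _ _ _.
split; last first.
  apply/eqP; rewrite eq_le (semi_ge0 NP) andbT.
  rewrite (le_trans (semi_trans NP (traj N D G 0 x) _ _))// (semiBC NP (traj_rep _ _ _ _ _)).
  by rewrite XE// (traj0 GP) addr0.
split.
- exact: traj_cont.
- have pd := primitive_deriv GP (G x).
  apply: (half_deriv_ext NP (X := fun t => primitive N D G t (G x)
    - (- x)) (dX := fun t => traj N D G t (G x) - 0)).
  + move=> t t0; rewrite opprK (addrC (primitive _ _ _ _ _)); apply/eqP; rewrite eq_le (semi_ge0 NP) andbT.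
    rewrite (le_trans (semi_trans NP (traj N D G t x) _ _))// XE// addr0.
    by rewrite (semiBC NP) (traj_primitive GP).
  + by move=> t t0; rewrite subr0 subrr (semi0 NP).
  + apply: (half_derivB NP pd); apply/(half_derivP NP) => t e t0 e0.
    by exists 1 => // r _ _ _; rewrite subrr scaler0 subrr (semi0 NP).
- by move=> t t0; exact: (resolvent_dom GP ltr01).
- by move=> t t0; rewrite (semiBC NP) (traj_rep_gen GP).
Qed.

Lemma mild_sol_exists x : exists X Y, mild_sol x X Y /\ N (Y 0) = 0.
Proof.
exists (fun t => traj N D G t x), (fun t => primitive_rep N D G t x).
have YE t : 0 <= t -> N (primitive N D G t x - primitive_rep N D G t x) = 0.
  by move=> t0; rewrite (semiBC NP); exact: (primitive_repE GP).
split; last first.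
  by rewrite (semi_eq0 NP (primitive_repE GP x (lexx 0))) (primitive0 GP).
split.
- exact: (traj_cont GP).
- apply: (half_deriv_ext NP YE _ (primitive_deriv GP x)).
  by move=> t t0; rewrite subrr (semi0 NP).
- by move=> t t0; exact: (resolvent_dom GP ltr01).
- by move=> t t0; exact: (primitive_rep_gen GP).
Qed.

Lemma half_dissip_sol X dX : half_deriv N X dX ->
  (forall t : R, 0 <= t -> D (X t)) ->
  (forall t : R, 0 <= t -> N (dX t - G (X t)) = 0) ->
  forall s t : R, 0 <= s -> s <= t -> N (X t) <= N (X s).
Proof.
move=> Xd DX dXG s t s0 st; apply: (half_dissip bP Xd _ s0 st) => r r0.
have -> : dX r = (dX r - G (X r)) + G (X r) by rewrite subrK.
rewrite (form_addl bP)// (form_null bP _ (dXG r r0)) add0r.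
by apply: Gdiss; exact: DX.
Qed.

Lemma strong_solB X dX Y dY : strong_sol X dX -> strong_sol Y dY ->
  strong_sol (fun t => X t - Y t) (fun t => dX t - dY t).
Proof.
move=> [cX dXX DX GX] [cY dYY DY GY]; split.
- exact: (half_contB NP).
- exact: (half_derivB NP).
- by move=> t t0; apply: (domB GP); [exact: DX|exact: DY].
- move=> t t0; rewrite (genB GP); [|exact: DX|exact: DY].
  have -> : dX t - dY t - (G (X t) - G (Y t)) =
      (dX t - G (X t)) - (dY t - G (Y t)).
    by rewrite !opprD !opprK addrACA.
  apply/eqP; rewrite eq_le (semi_ge0 NP) andbT (le_trans (semiB NP _ _))//.
  by rewrite GX// GY// addr0.
Qed.

Lemma strong_sol_unique X dX Y dY : strong_sol X dX -> strong_sol Y dY ->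
  N (X 0 - Y 0) = 0 -> forall t : R, 0 <= t -> N (X t - Y t) = 0.
Proof.
move=> sX sY XY0 t t0; have [_ dZ DZ GZ] := strong_solB sX sY.
apply/eqP; rewrite eq_le (semi_ge0 NP) andbT -XY0.
exact: (half_dissip_sol dZ DZ GZ (lexx 0) t0).
Qed.

(** The difference [Z] of the two primitives satisfies [Z' = G Z] and starts at [0]:
    it vanishes, and so does its derivative. *)
Lemma mild_sol_unique x X Y X' Y' : mild_sol x X Y -> mild_sol x X' Y' ->
  N (Y 0 - Y' 0) = 0 -> forall t : R, 0 <= t -> N (X t - X' t) = 0.
Proof.
move=> [cX dY DY GY] [cX' dY' DY' GY'] Y0.
have dZ := half_derivB NP dY dY'; apply: (half_deriv_null NP dZ) => t t0.
apply/eqP; rewrite eq_le (semi_ge0 NP) andbT -Y0.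
apply: (half_dissip_sol dZ _ _ (lexx 0) t0) => r r0.
  by apply: (domB GP); [exact: DY|exact: DY'].
rewrite (genB GP); [|exact: DY|exact: DY'].
have -> : X r - X' r - (G (Y r) - G (Y' r)) =
    (X r - (x + G (Y r))) - (X' r - (x + G (Y' r))).
  by rewrite [RHS]subBACA; congr (_ - _); rewrite opprD addrACA subrr add0r.
apply/eqP; rewrite eq_le (semi_ge0 NP) andbT (le_trans (semiB NP _ _))//.
by rewrite GY// GY'// addr0.
Qed.

(** Averaging over [[t, t + h]] regularizes: the differences of [Y] are differentiable,
    with derivative the differences of [X], and remain in the domain. *)
Lemma mild_sol_average x X Y h : 0 < h -> mild_sol x X Y ->
  strong_sol (fun t => h^-1 *: (Y (t + h) - Y t)) (fun t => h^-1 *: (X (t + h) - X t)).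
Proof.
move=> h0 [cX dY DY GY]; have h0' := ltW h0.
have DYh t : 0 <= t -> D (Y (t + h)) by move=> t0; apply: DY; exact: addr_ge0.
split.
- apply: (half_contZ NP); apply: (half_contB NP) => //.
  exact: (half_cont_shift NP).
- apply: (half_derivZ NP); apply: (half_derivB NP) => //.
  exact: (half_deriv_shift NP).
- by move=> t t0; apply: (domZ GP); apply: (domB GP); [exact: DYh|exact: DY].
- move=> t t0; rewrite (genZ GP); last by apply: (domB GP); [exact: DYh|exact: DY].
  rewrite (genB GP); [|exact: DYh|exact: DY].
  rewrite -scalerBr (semiZ NP); apply/eqP; rewrite mulf_eq0; apply/orP; right.
  have -> : X (t + h) - X t - (G (Y (t + h)) - G (Y t)) =
      (X (t + h) - (x + G (Y (t + h)))) - (X t - (x + G (Y t))).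
    by rewrite [RHS]subBACA; congr (_ - _); rewrite opprD addrACA subrr add0r.
  rewrite eq_le (semi_ge0 NP) andbT (le_trans (semiB NP _ _))//.
  by rewrite !GY ?addr0 ?addr_ge0.
Qed.
End Evolution.

(** ** The energy identity for mild solutions *)

Section EnergyIdentity.
Context {R : realType} {V : lmodType R} {b : V -> V -> R} {D : set V} {G : V -> V}.
Hypothesis bP : form_on setT b.
Hypothesis GP : generator (fnorm b) D G.
Local Notation N := (fnorm b).
Local Notation mu := (@lebesgue_measure R).
Let NP := form_seminorm bP.

(** The dissipation is not controlled by [N], and may be infinite outside the domain. It
    is accessible through the forms [q m], which are continuous for [N] and increase
    to it. *)
Variables (q : nat -> V -> V -> R) (C : nat -> R) (Dis : V -> \bar R).
Hypothesis qP : forall m, form_on setT (q m).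
Hypothesis qC : forall m x, q m x x <= C m * b x x.
Hypothesis qS : forall m x, q m x x <= q m.+1 x x.
Hypothesis qDis : forall x, (fun m => (q m x x)%:E) @ \oo --> Dis x.
Hypothesis DisD : forall x, D x -> Dis x = (- b (G x) x)%:E.

Let energyat (X : R -> V) (t : R) : R := b (X t) (X t) / 2.

Lemma q_ge0 m x : 0 <= q m x x. Proof. exact: (form_ge0 (qP m)). Qed.

Lemma Dis_ge0 x : (0 <= Dis x)%E.
Proof.
rewrite -(cvg_lim _ (@qDis x))//; apply: lime_ge; first by apply/cvg_ex; eexists; exact: qDis.
by apply: nearW => m; rewrite lee_fin q_ge0.
Qed.

Lemma dissipative_of_Dis x : D x -> b (G x) x <= 0.
Proof. by move=> Dx; have := Dis_ge0 x; rewrite DisD// lee_fin oppr_ge0. Qed.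

Let qnorm_le m x : fnorm (q m) x <= Num.sqrt `|C m| * N x.
Proof.
rewrite /fnorm -sqrtrM// ler_wsqrtr// (le_trans (qC m x))// ler_wpM2r//.
  exact: (form_ge0 bP).
exact: ler_norm.
Qed.

Lemma q_measurable m X (s t : R) : half_cont N X -> 0 <= s -> s < t ->
  measurable_fun `[s, t] (fun r => (q m (X r) (X r))%:E).
Proof.
move=> /(half_contP NP) cX s0 st; apply/measurable_EFinP.
have qSN := form_seminorm (qP m).
have cq : half_cont (fun x : R^o => `|x : R|) (fun r => fnorm (q m) (X r) : R^o).
  apply/(half_contP abs_seminorm) => r e r0 e0.
  have C1 : 0 < Num.sqrt `|C m| + 1 by rewrite ltr_wpDl ?sqrtr_ge0.
  have [d d0 h] := cX r _ r0 (divr_gt0 e0 C1); exists d => // r' r'0 rr.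
  rewrite (le_lt_trans (semi_dist qSN _ _))// (le_lt_trans (qnorm_le _ _))//.
  have := h r' r'0 rr; rewrite ltr_pdivlMr// mulrC; apply: le_lt_trans.
  by rewrite ler_wpM2r ?(semi_ge0 NP)// lerDl.
have mq : measurable_fun `[s, t] (fun r => fnorm (q m) (X r)).
  apply: subspace_continuous_measurable_fun => //.
  exact: half_cont_within cq s0 st.
rewrite (_ : (fun r => _) = (fun r => fnorm (q m) (X r) ^+ 2)); first exact: measurable_funX.
by apply/funext => r; rewrite (fnorm_sqr (qP m)).
Qed.

Lemma Dis_measurable X (s t : R) : half_cont N X -> 0 <= s -> s < t ->
  measurable_fun `[s, t] (fun r => Dis (X r)).
Proof.
move=> cX s0 st; apply: (emeasurable_fun_cvg (fun m r => (q m (X r) (X r))%:E)).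
  by move=> m; exact: q_measurable.
by move=> r _; exact: qDis.
Qed.

Lemma q_le m n x : (m <= n)%N -> q m x x <= q n x x.
Proof.
move=> /subnKC <-; elim: (n - m)%N => [|k IH]; first by rewrite addn0.
by rewrite addnS (le_trans IH).
Qed.

Lemma integral_Dis_le X (s t : R) (c : \bar R) : half_cont N X -> 0 <= s -> s < t ->
  (forall m, (\int[mu]_(r in `[s, t]) (q m (X r) (X r))%:E <= c)%E) ->
  (\int[mu]_(r in `[s, t]) Dis (X r) <= c)%E.
Proof.
move=> cX s0 st qc.
have := @cvg_monotone_convergence _ _ R mu `[s, t]%classic _
  (fun m r => (q m (X r) (X r))%:E).
move=> /(_ (measurable_itv _) (fun m => q_measurable m cX s0 st)).
rewrite (_ : (fun r => limn _) = Dis \o X); last first.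
  by apply/funext => r; apply: cvg_lim => //; exact: qDis.
move=> H; have {}H : (fun m => \int[mu]_(r in `[s, t]) (q m (X r) (X r))%:E)%E @ \oo -->
    (\int[mu]_(r in `[s, t]) Dis (X r))%E.
  apply: H; first by move=> m r _; rewrite lee_fin q_ge0.
  by move=> r _ m n mn; rewrite lee_fin q_le.
rewrite -(cvg_lim _ H)//; apply: lime_le; first by apply/cvg_ex; eexists; exact: H.
exact: nearW.
Qed.

Lemma integral_q_le_Dis m X (s t : R) : half_cont N X -> 0 <= s -> s < t ->
  (\int[mu]_(r in `[s, t]) (q m (X r) (X r))%:E <=
   \int[mu]_(r in `[s, t]) Dis (X r))%E.
Proof.
move=> cX s0 st; apply: ge0_le_integral => //.
- by move=> r _; rewrite lee_fin q_ge0.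
- exact: q_measurable.
- exact: Dis_measurable.
move=> r _; rewrite -(cvg_lim _ (@qDis (X r)))//.
apply: lime_ge; first by apply/cvg_ex; eexists; exact: qDis.
by exists m => // n /= mn; rewrite lee_fin q_le.
Qed.

Lemma strong_energy X dX (s t : R) : strong_sol (D := D) (b := b) (G := G) X dX -> 0 <= s -> s < t ->
  (\int[mu]_(r in `[s, t]) Dis (X r) = (energyat X s - energyat X t)%:E)%E.
Proof.
move=> [cdX dXX DX GX] s0 st.
have cX := half_deriv_cont NP dXX.
have dE := half_deriv_form bP dXX.
have cE := half_cont_form bP cdX cX.
have H := half_FTC (half_derivZ abs_seminorm (-1) dE)
  (half_contZ abs_seminorm (-1) cE) s0 (ltW st).
have -> : energyat X s - energyat X t = -1 * energyat X t - -1 * energyat X s.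
  by rewrite !mulN1r opprK addrC.
rewrite -[RHS]H.
apply: eq_integral => r; rewrite inE/= in_itv/= => /andP[sr _].
have r0 := le_trans s0 sr.
rewrite DisD; last exact: DX.
congr (_%:E); rewrite -[RHS]/(-1 * b (dX r) (X r)) mulN1r.
have -> : dX r = (dX r - G (X r)) + G (X r) by rewrite subrK.
by rewrite (form_addl bP)// (form_null bP _ (GX r r0)) add0r.
Qed.

Lemma young (e u v : R) : 0 < e ->
  (u + v) ^+ 2 <= (1 + e) * u ^+ 2 + (1 + e^-1) * v ^+ 2.
Proof.
move=> e0; have -> : (1 + e) * u ^+ 2 + (1 + e^-1) * v ^+ 2 =
    (u + v) ^+ 2 + e^-1 * (e * u - v) ^+ 2 by field; rewrite gt_eqF.
by rewrite lerDl mulr_ge0 ?sqr_ge0 ?invr_ge0 ?ltW.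
Qed.

(** The weights [1 + e] and [1 + e^-1] make it possible to compare the dissipations of two
    trajectories whose difference dissipates little, even before they are known to be
    finite. *)
Lemma Dis_young (e : R) x y : 0 < e ->
  (Dis (x + y)%R <= (1 + e)%:E * Dis x + (1 + e^-1)%:E * Dis y)%E.
Proof.
move=> e0; have e1 : 0 <= 1 + e by rewrite addr_ge0// ltW.
have e2 : 0 <= 1 + e^-1 by rewrite addr_ge0// invr_ge0 ltW.
have qx m : ((q m x x)%:E <= Dis x)%E.
  rewrite -(cvg_lim _ (@qDis x))//; apply: lime_ge; first by apply/cvg_ex; eexists; exact: qDis.
  by exists m => // n /= mn; rewrite lee_fin q_le.
have qy m : ((q m y y)%:E <= Dis y)%E.
  rewrite -(cvg_lim _ (@qDis y))//; apply: lime_ge; first by apply/cvg_ex; eexists; exact: qDis.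
  by exists m => // n /= mn; rewrite lee_fin q_le.
rewrite -(cvg_lim _ (@qDis (x + y)))//; apply: lime_le.
  by apply/cvg_ex; eexists; exact: qDis.
apply: nearW => m; rewrite (@le_trans _ _
  ((1 + e)%:E * (q m x x)%:E + (1 + e^-1)%:E * (q m y y)%:E)%E)//.
  rewrite -!EFinM -EFinD lee_fin -!(fnorm_sqr (qP m))//.
  apply: le_trans (young _ _ e0).
  rewrite lerXn2r ?nnegrE ?addr_ge0 ?fnorm_ge0//.
  exact: (fnormD (qP m)).
by apply: leeD; apply: lee_wpmul2l; rewrite ?lee_fin.
Qed.

Lemma integral_young X Y Z (e s t : R) : half_cont N X -> half_cont N Y -> half_cont N Z ->
  (forall r : R, 0 <= r -> X r = Y r + Z r) -> 0 < e -> 0 <= s -> s < t ->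
  (\int[mu]_(r in `[s, t]) Dis (X r) <=
   (1 + e)%:E * \int[mu]_(r in `[s, t]) Dis (Y r) +
   (1 + e^-1)%:E * \int[mu]_(r in `[s, t]) Dis (Z r))%E.
Proof.
move=> cX cY cZ XYZ e0 s0 st.
have e1 : 0 <= 1 + e by rewrite addr_ge0// ltW.
have e2 : 0 <= 1 + e^-1 by rewrite addr_ge0// invr_ge0 ltW.
have mY := Dis_measurable cY s0 st; have mZ := Dis_measurable cZ s0 st.
have D0 W r : `[s, t]%classic r -> (0 <= Dis (W r))%E by move=> _; exact: Dis_ge0.
rewrite -(ge0_integralZl_EFin mu (measurable_itv _) (D0 Y) mY e1).
rewrite -(ge0_integralZl_EFin mu (measurable_itv _) (D0 Z) mZ e2).
have D1 r : `[s, t]%classic r -> (0 <= (1 + e)%:E * Dis (Y r))%E.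
  by move=> _; rewrite mule_ge0 ?Dis_ge0.
have D2 r : `[s, t]%classic r -> (0 <= (1 + e^-1)%:E * Dis (Z r))%E.
  by move=> _; rewrite mule_ge0 ?Dis_ge0.
rewrite -ge0_integralD//; [|exact: measurable_funeM|exact: measurable_funeM].
apply: ge0_le_integral => //.
- by move=> r _; exact: Dis_ge0.
- exact: Dis_measurable.
- by apply: emeasurable_funD; exact: measurable_funeM.
move=> r; rewrite /= in_itv/= => /andP[sr _].
by rewrite XYZ ?(le_trans s0)// Dis_young.
Qed.

(** The averages [Z k] of the mild solution [X] are strong solutions, which satisfy the
    identity. The dissipation of the differences [Z k - Z j] is bounded by their initial
    energy; by Fatou's lemma for the forms [q m], the dissipation of [X - Z j] is at most
    [rho j], which tends to [0]. By [integral_young] the dissipations of [X] and of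
    [Z j] then have the same limit, up to factors [1 + e]. *)
Lemma mild_energy x X Y (s t : R) :
  mild_sol (b := b) (D := D) (G := G) x X Y -> 0 <= s -> s < t ->
  (\int[mu]_(r in `[s, t]) Dis (X r) = (energyat X s - energyat X t)%:E)%E.
Proof.
move=> mX s0 st; have t0 := le_trans s0 (ltW st).
have [cX dY DY GY] := mX.
pose h (k : nat) : R := k.+1%:R^-1.
have h0 k : 0 < h k by rewrite invr_gt0.
pose Z k r := (h k)^-1 *: (Y (r + h k) - Y r).
pose dZ k r := (h k)^-1 *: (X (r + h k) - X r).
have sZ k : strong_sol (b := b) (D := D) (G := G) (Z k) (dZ k).
  exact: (mild_sol_average bP GP (h0 k) mX).
have cZ k : half_cont N (Z k) by have [_ /(half_deriv_cont NP)] := sZ k.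
have ZX r : 0 <= r -> cvg_semi N (Z ^~ r) (X r) by exact: (half_deriv_seq NP dY).
have EX r : 0 <= r -> (fun k => energyat (Z k) r) @ \oo --> energyat X r.
  move=> r0; apply: cvgM; last exact: cvg_cst.
  rewrite -(fnorm_sqr bP) // expr2.
  under eq_fun do rewrite -(fnorm_sqr bP)// expr2.
  by apply: cvgM; exact: (cvg_semi_norm NP (ZX r r0)).
have cXZ j : half_cont N (fun r => X r - Z j r) by exact: (half_contB NP).
pose rho j := N (X s - Z j s) ^+ 2 / 2.
have rho0 : rho @ \oo --> (0 : R).
  rewrite -(mul0r (2^-1)) -[X in X * _](mulr0 0); apply: cvgM; last exact: cvg_cst.
  rewrite /rho; under eq_fun do rewrite expr2 (semiBC NP).
  by apply: cvgM; exact: ZX.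
have DXZ j : (\int[mu]_(r in `[s, t]) Dis (X r - Z j r)%R <= (rho j)%:E)%E.
  apply: (integral_Dis_le (X := fun r => X r - Z j r)) => // m.
  pose u k r : \bar R := (q m (Z k r - Z j r) (Z k r - Z j r))%:E.
  have cZZ k : half_cont N (fun r => Z k r - Z j r) by exact: (half_contB NP).
  have -> : (\int[mu]_(r in `[s, t]) (q m (X r - Z j r) (X r - Z j r))%:E =
      \int[mu]_(r in `[s, t]) limn_einf (u ^~ r))%E.
    apply: eq_integral => r; rewrite inE/= in_itv/= => /andP[sr _].
    have r0 := le_trans s0 sr; apply/esym.
    apply: (cvg_limn_einf_sup _).1; apply: cvg_EFin; first exact: nearW.
    have qSN := form_seminorm (qP m).
    have : cvg_semi (fnorm (q m)) (fun k => Z k r - Z j r) (X r - Z j r).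
      apply: (cvg_semiB qSN _ (cvg_semi_cst qSN _)).
      apply: (cvg_semi_squeeze qSN (r := fun k => Num.sqrt `|C m| * N (Z k r - X r))).
        rewrite -(mulr0 (Num.sqrt `|C m|)); apply: cvgM; first exact: cvg_cst.
        exact: ZX.
      by move=> k; exact: qnorm_le.
    move=> /(cvg_semi_norm qSN) qc.
    rewrite -(fnorm_sqr (qP m))// expr2 /u.
    rewrite (_ : _ \o _ = fun k => fnorm (q m) (Z k r - Z j r) * fnorm (q m) (Z k r - Z j r)).
      exact: cvgM.
    by apply/funext => k /=; rewrite -expr2 (fnorm_sqr (qP m)).
  apply: (le_trans (fatou mu (measurable_itv _) _ _)).
  - by move=> k; exact: (q_measurable m (cZZ k) s0 st).
  - by move=> k r _; rewrite lee_fin q_ge0.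
  apply: (limn_einf_le (r_ := fun k => N (Z k s - Z j s) ^+ 2 / 2)).
    rewrite /rho; apply: cvgM; last exact: cvg_cst.
    rewrite expr2; under eq_fun do rewrite expr2.
    have /(cvg_semi_norm NP) := cvg_semiB NP (ZX s s0) (cvg_semi_cst NP (Z j s)).
    by move=> zc; apply: cvgM.
  move=> k; have sZZ := strong_solB bP GP (sZ k) (sZ j).
  apply: (le_trans (integral_q_le_Dis m (cZZ k) s0 st)).
  rewrite (strong_energy sZZ s0 st) lee_fin /energyat (fnorm_sqr bP)//.
  by rewrite lerBlDr lerDl divr_ge0// (form_ge0 bP).
have EZ j := strong_energy (sZ j) s0 st.
set I := (\int[mu]_(r in `[s, t]) Dis (X r))%E.
pose E := energyat X s - energyat X t.
pose Ej j := energyat (Z j) s - energyat (Z j) t.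
have EjE : Ej @ \oo --> E by apply: cvgB; exact: EX.
have I0 : (0 <= I)%E by apply: integral_ge0 => r _; exact: Dis_ge0.
have up e j : 0 < e -> (I <= ((1 + e) * Ej j + (1 + e^-1) * rho j)%:E)%E.
  move=> e0.
  have := integral_young cX (cZ j) (cXZ j) _ e0 s0 st.
  rewrite EZ -/I => /(_ _)/le_trans; apply.
    by move=> r _; rewrite addrC subrK.
  rewrite [leRHS]EFinD !EFinM leeD2l// lee_wpmul2l// lee_fin addr_ge0// invr_ge0 ltW//.
have Ifin : I \is a fin_num.
  by rewrite ge0_fin_numE//; apply: le_lt_trans (up 1 0%N ltr01) _; rewrite ltry.
have rhoM e : 0 < e -> (fun j => (1 + e^-1) * rho j) @ \oo --> (0 : R).
  by move=> e0; rewrite -(mulr0 (1 + e^-1)); apply: cvgM rho0; exact: cvg_cst.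
have up' e : 0 < e -> fine I <= (1 + e) * E.
  move=> e0; rewrite -[leRHS]addr0.
  apply: (ler_cvg_to (f := fun=> fine I) (cvg_cst _)
    (cvgD (cvgM (cvg_cst _) EjE) (rhoM e e0))).
  by apply: nearW => j; rewrite -lee_fin fineK// up.
have dn' e : 0 < e -> E <= (1 + e) * fine I.
  move=> e0; rewrite -[leRHS]addr0.
  apply: (ler_cvg_to EjE (cvgD (cvg_cst ((1 + e) * fine I)) (rhoM e e0))).
  apply: nearW => j.
  have cZX : half_cont N (fun r => - 1 *: (X r - Z j r)) by exact: (half_contZ NP).
  have := integral_young (cZ j) cX cZX _ e0 s0 st.
  rewrite EZ -/(Ej j) -/I => /(_ _) H.
  have e2 : 0 <= 1 + e^-1 by rewrite addr_ge0// invr_ge0 ltW.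
  rewrite -lee_fin [leRHS]EFinD (EFinM (1 + e)) (EFinM (1 + e^-1)) fineK//; apply: (le_trans (H _)).
    by move=> r _; rewrite scaleN1r opprB addrC subrK.
  rewrite leeD2l// lee_wpmul2l ?lee_fin//.
  rewrite (_ : (\int[mu]_(r in _) _ = \int[mu]_(r in `[s, t]) Dis (X r - Z j r)%R)%E).
    exact: DXZ.
  apply: eq_integral => r _.
  rewrite -(cvg_lim _ (@qDis (X r - Z j r)))// -(cvg_lim _ (@qDis (-1 *: _)))//.
  congr (limn _); apply/funext => m.
  by rewrite (form_scalel (qP m))// (form_scaler (qP m))// !mulN1r opprK.
have E0 : 0 <= E.
  have := dn' 1 ltr01; have := up' 1 ltr01; have := fine_ge0 I0; lra.
rewrite -(fineK Ifin); congr (_%:E); rewrite -/E; move: (E) EjE up' dn' E0 => {}E _ up' dn' E0.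
apply/le_anti/andP; split.
  rewrite -subr_le0; apply: (le_eps0 E0) => e /up'.
  by rewrite mulrDl mul1r lerBlDl (mulrC E).
rewrite -subr_le0; apply: (le_eps0 (fine_ge0 I0)) => e /dn'.
by rewrite mulrDl mul1r lerBlDl (mulrC (fine I)).
Qed.
End EnergyIdentity.

(** * Vector-valued simple maps and strong measurability *)

Section SimpleMaps.
Import HBSimple HBNNSimple.
Context {R : realType} {s : scalars} {U : hilbertType R s}.
Local Notation W := (realified U).
Local Notation mu := (@lebesgue_measure R).
Local Notation smap := (simple_map U).

Lemma sm_evalE (f : smap) x :
  (sm_eval f x : W) = \sum_(i < sm_size f) (\1_(@sm_set _ _ _ f i) x : R) *: (sm_val i : W).
Proof. by []. Qed.

Lemma sm_integralE (f : smap) : (sm_integral f : W) =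
  \sum_(i < sm_size f) fine (mu (@sm_set _ _ _ f i)) *: (sm_val i : W).
Proof. by []. Qed.

Lemma split_prop (m n : nat) (T : Type) (P : T -> Prop) (f : 'I_m -> T) (g : 'I_n -> T)
    (i : 'I_(m + n)) :
  (forall j, P (f j)) -> (forall k, P (g k)) ->
  P (match fintype.split i with inl j => f j | inr k => g k end).
Proof. by move=> Pf Pg; case: (fintype.split i). Qed.

Definition sm_add (f g : smap) : smap := @SimpleMap R s U (sm_size f + sm_size g)
  (fun i => match fintype.split i with inl j => sm_set j | inr k => sm_set k end)
  (fun i => match fintype.split i with inl j => sm_val j | inr k => sm_val k end)
  (fun i => split_prop i (@sm_measurable _ _ _ f) (@sm_measurable _ _ _ g))
  (fun i => split_prop (P := fun A => (mu A < +oo)%E) i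
     (@sm_finite _ _ _ f) (@sm_finite _ _ _ g)).

Lemma sm_eval_add (f g : smap) x :
  sm_eval (sm_add f g) x = (sm_eval f x : W) + sm_eval g x.
Proof.
rewrite !sm_evalE big_split_ord/=; congr (_ + _); apply: eq_bigr => i _.
  by rewrite (unsplitK (inl i)).
by rewrite (unsplitK (inr i)).
Qed.

Definition sm_scale (a : R) (f : smap) : smap := @SimpleMap R s U (sm_size f)
  (@sm_set _ _ _ f) (fun i => a *: (sm_val i : W)) (@sm_measurable _ _ _ f)
  (@sm_finite _ _ _ f).

Lemma sm_eval_scale a (f : smap) x : sm_eval (sm_scale a f) x = a *: (sm_eval f x : W).
Proof.
rewrite !sm_evalE scaler_sumr; apply: eq_bigr => i _.
by rewrite /= !scalerA mulrC.
Qed.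

Lemma sm_restrict_finite (A : set R) (f : smap) i : measurable A ->
  (mu (A `&` @sm_set _ _ _ f i) < +oo)%E.
Proof.
move=> mA; apply: le_lt_trans (sm_finite i); apply: le_measure; rewrite ?inE//.
- by apply: measurableI => //; exact: sm_measurable.
- exact: sm_measurable.
Qed.

Definition sm_restrict (A : set R) (mA : measurable A) (f : smap) : smap :=
  @SimpleMap R s U (sm_size f) (fun i => A `&` sm_set i) (@sm_val _ _ _ f)
  (fun i => measurableI _ _ mA (sm_measurable i))
  (fun i => sm_restrict_finite i mA).

Lemma sm_eval_restrict A (mA : measurable A) (f : smap) x :
  sm_eval (sm_restrict mA f) x = (\1_A x : R) *: (sm_eval f x : W).
Proof.
rewrite !sm_evalE scaler_sumr; apply: eq_bigr => i _ /=.
by rewrite indicI scalerA.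
Qed.

Lemma set0_finite : (mu set0 < +oo)%E.
Proof. by rewrite measure0. Qed.

Definition sm_zero : smap := @SimpleMap R s U 0 (fun=> set0) (fun=> 0)
  (fun=> measurable0) (fun=> set0_finite).

Lemma sm_eval_zero x : sm_eval sm_zero x = (0 : W).
Proof. by rewrite sm_evalE big_ord0. Qed.

Definition ball0 (n : nat) : set R := `[- n%:R, n%:R]%classic.

Lemma ball_finite (n : nat) : (mu (ball0 n) < +oo)%E.
Proof.
rewrite /ball0 lebesgue_measure_itv/= lte_fin; case: ifPn => // _.
by rewrite -EFinD ltry.
Qed.

Definition sm_ball (n : nat) (w : U) : smap := @SimpleMap R s U 1
  (fun=> ball0 n) (fun=> w) (fun=> measurable_itv _)
  (fun=> ball_finite n).

Lemma sm_eval_ball n w (x : R) :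
  sm_eval (sm_ball n w) x = (\1_(ball0 n) x : R) *: (w : W).
Proof. by rewrite sm_evalE big_ord1. Qed.

(** A simple function is the sum of its values times the indicators of its fibers, on
    which the vector-valued map is restricted. *)
Definition sm_mul (h : {nnsfun R >-> R}) (f : smap) : smap :=
  foldr (fun y g => sm_add (sm_scale y (sm_restrict (measurable_sfunP h (measurable_set1 y)) f)) g)
  sm_zero (finmap.enum_fset (fset_set (range h))).

Lemma sm_eval_mul (h : {nnsfun R >-> R}) (f : smap) x :
  sm_eval (sm_mul h f) x = h x *: (sm_eval f x : W).
Proof.
rewrite (fimfunE h x) fsbig_finite//=.
rewrite /sm_mul; elim: (finmap.enum_fset _) => [|y l IH] /=.
  by rewrite big_nil scale0r sm_eval_zero.
by rewrite sm_eval_add sm_eval_scale sm_eval_restrict IH big_cons scalerDl scalerA.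
Qed.
End SimpleMaps.

Section StrongMeasurability.
Import HBSimple HBNNSimple.
Context {R : realType} {s : scalars} {U : hilbertType R s}.
Local Notation W := (realified U).
Local Notation mu := (@lebesgue_measure R).
Local Notation smap := (simple_map U).
Local Notation rip := (@rip R s U).
Local Notation rn := (fun w : W => rnorm (w : U)).
Local Notation smeas f := (@strongly_measurable R s U f).
Implicit Types f g : R -> W.

Lemma rip_form : form_on setT rip.
Proof.
split=> // [x y _ _|a x y z _ _ _|x _]; first exact: ripC.
  by rewrite ripDl ripZl.
exact: rip_ge0.
Qed.

Lemma rnorm_fnorm : rn = fnorm rip.
Proof.
by apply/funext => w; rewrite /fnorm -rnorm_sqr sqrtr_sqr ger0_norm ?rnorm_ge0.
Qed.

Lemma rnorm_seminorm : @seminorm R W rn.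
Proof. by rewrite rnorm_fnorm; exact: form_seminorm rip_form. Qed.

Lemma rip_le (v w : W) : `|rip v w| <= rn v * rn w.
Proof. by rewrite rnorm_fnorm; exact: cauchy_schwarz rip_form _ _ I I. Qed.

Lemma rip_suml n (v : 'I_n -> W) w : rip (\sum_i v i) w = \sum_i rip (v i) w.
Proof. by rewrite (big_morph (rip^~ w) (fun a b => ripDl a b w) (rip0l w)). Qed.

Lemma smeasP f : smeas f <-> exists f_ : nat -> smap,
  forall x, cvg_semi rn (fun n => sm_eval (f_ n) x) (f x).
Proof.
split=> -[f_ ff]; exists f_ => x; first by have /cvg_rnorm := ff x.
by apply/cvg_rnorm; exact: ff.
Qed.

Lemma smeasD f g : smeas f -> smeas g -> smeas (fun x => f x + g x).
Proof.
move=> /smeasP[f_ ff] /smeasP[g_ gg]; apply/smeasP.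
exists (fun n => sm_add (f_ n) (g_ n)) => x.
rewrite [X in cvg_semi _ X](_ : _ = fun n => (sm_eval (f_ n) x : W) + sm_eval (g_ n) x).
  exact: (cvg_semiD rnorm_seminorm (ff x) (gg x)).
by apply/funext => n; exact: sm_eval_add.
Qed.

Lemma smeasZ a f : smeas f -> smeas (fun x => a *: f x).
Proof.
move=> /smeasP[f_ ff]; apply/smeasP; exists (fun n => sm_scale a (f_ n)) => x.
rewrite [X in cvg_semi _ X](_ : _ = fun n => a *: (sm_eval (f_ n) x : W)).
  exact: (cvg_semiZ rnorm_seminorm _ (ff x)).
by apply/funext => n; exact: sm_eval_scale.
Qed.

Lemma smeasB f g : smeas f -> smeas g -> smeas (fun x => f x - g x).
Proof.
move=> mf /(smeasZ (-1)) mg; have := smeasD mf mg.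
by under eq_fun do rewrite scaleN1r.
Qed.

Lemma smeas_simple (f : smap) : smeas (sm_eval f).
Proof. by exists (fun=> f) => x; exact: cvg_cst. Qed.

(** A constant is not a simple map, whose pieces have finite measure: it is cut off on
    growing intervals. *)
Lemma smeas_cst (w : W) : smeas (fun=> w).
Proof.
apply/smeasP; exists (fun n => sm_ball n w) => x.
apply/cvg0P => [n|e e0]; first exact: rnorm_ge0.
exists (Num.truncn `|x|).+1 => n xn.
rewrite sm_eval_ball indicE mem_set ?scale1r ?subrr ?rnorm0//.
have := truncnS_gt `|x|; rewrite /ball0/= in_itv/= -ler_norml => h.
by rewrite (le_trans (ltW h))// ler_nat.
Qed.

Lemma smeasM (m : R -> R) f : measurable_fun setT m -> (forall x, 0 <= m x) ->
  smeas f -> smeas (fun x => m x *: f x).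
Proof.
move=> mm m0 /smeasP[f_ ff].
have mm' : measurable_fun setT (EFin \o m) by exact/measurable_EFinP.
pose h := nnsfun_approx measurableT mm'.
apply/smeasP; exists (fun n => sm_mul (h n) (f_ n)) => x.
rewrite [X in cvg_semi _ X](_ : _ = fun n => h n x *: (sm_eval (f_ n) x : W)); last first.
  by apply/funext => n; exact: sm_eval_mul.
apply: (cvg_semi_scale rnorm_seminorm _ (ff x)).
have m0' y : setT y -> (0 <= (EFin \o m) y)%E by move=> _; rewrite lee_fin.
have := cvg_nnsfun_approx measurableT mm' m0' (x := x) I.
by move=> /fine_cvgP[].
Qed.

Lemma measurable_rip_simple (f g : smap) :
  measurable_fun setT (fun x => rip (sm_eval f x) (sm_eval g x)).
Proof.
rewrite (_ : (fun x => _) = fun x => \sum_(i < sm_size f) \sum_(j < sm_size g)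
  \1_(sm_set i) x * \1_(sm_set j) x * rip (sm_val i) (sm_val j)).
  apply: measurable_sum => i; apply: measurable_sum => j.
  apply: measurable_funM => //; apply: measurable_funM;
    by apply: measurable_indic; exact: sm_measurable.
apply/funext => x; rewrite !sm_evalE rip_suml; apply: eq_bigr => i _.
rewrite ripC rip_suml; apply: eq_bigr => j _.
by rewrite ripC ripZl ripZr mulrA.
Qed.

(** Weak measurability follows from strong measurability, by pointwise limits. *)
Lemma measurable_rip f g : smeas f -> smeas g ->
  measurable_fun setT (fun x => rip (f x) (g x)).
Proof.
move=> /smeasP[f_ ff] /smeasP[g_ gg].
apply: (measurable_fun_cvg (fun n => measurable_rip_simple (f_ n) (g_ n))) => x _.
by apply: (cvg_form rip_form); rewrite -rnorm_fnorm.
Qed.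

Lemma measurable_rnorm f : smeas f -> measurable_fun setT (fun x => rn (f x)).
Proof.
move=> mf; rewrite rnorm_fnorm /fnorm.
apply: (measurableT_comp (f := @Num.sqrt R)); last exact: measurable_rip.
apply: continuous_measurable_fun; exact: sqrt_continuous.
Qed.

(** Simple approximations can be cut off where they are too large, so that they
    are dominated by the function. *)
Lemma smeas_dominated f : smeas f -> exists f_ : nat -> smap,
  (forall x, cvg_semi rn (fun n => sm_eval (f_ n) x) (f x)) /\
  (forall n x, rn (sm_eval (f_ n) x) <= 2 * rn (f x)).
Proof.
move=> mf; have /smeasP[g gf] := mf.
pose A n := [set x | 0 <= 2 * rn (f x) - rn (sm_eval (g n) x)].
have mA n : measurable (A n).
  have : measurable_fun setT (fun x => 2 * rn (f x) - rn (sm_eval (g n) x)).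
    apply: measurable_funB; last by apply: measurable_rnorm; exact: smeas_simple.
    by apply: measurable_funM => //; exact: measurable_rnorm.
  move=> /(_ measurableT `[0, +oo[%classic (measurable_itv _)); rewrite setTI.
  by congr measurable; apply/seteqP; split => x; rewrite /A/= in_itv/= andbT.
exists (fun n => sm_restrict (mA n) (g n)); split=> [x|n x]; last first.
  rewrite sm_eval_restrict indicE; have [|_] := boolP (x \in A n).
    by rewrite inE /A/= subr_ge0 scale1r.
  by rewrite scale0r rnorm0 mulr_ge0 ?rnorm_ge0.
have [fx0|fx0] := eqVneq (rn (f x)) 0.
  have -> : f x = 0 by exact: rnorm_eq0.
  rewrite /cvg_semi (_ : (fun n => _) = fun=> 0); first exact: cvg_cst.
  apply/funext => n; rewrite subr0 sm_eval_restrict indicE.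
  have [|_] := boolP (x \in A n); last by rewrite scale0r rnorm0.
  rewrite inE /A/= fx0 mulr0 sub0r oppr_ge0 scale1r => h.
  by apply/le_anti; rewrite h rnorm_ge0.
have fxp : 0 < rn (f x) by rewrite lt_neqAle eq_sym fx0 rnorm_ge0.
apply/cvg0P => [n|e e0]; first exact: rnorm_ge0.
have [|n0 h] := (cvg0P (fun n => rnorm_ge0 _)).1 (gf x) (Num.min e (rn (f x))).
  by rewrite lt_min e0.
exists n0 => n n0n; have := h n n0n; rewrite lt_min => /andP[he hf].
rewrite sm_eval_restrict indicE mem_set ?scale1r//.
rewrite /A/= subr_ge0 mulr_natl mulr2n.
by rewrite -{1}(subrK (f x) (sm_eval _ x)) (le_trans (rnormD _ _))// lerD2r ltW.
Qed.
End StrongMeasurability.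

(** * The space of square-integrable vector-valued functions *)

Section L2.
Context {R : realType} {s : scalars} {U : hilbertType R s}.
Local Notation W := (realified U).
Local Notation mu := (@lebesgue_measure R).
Local Notation smap := (simple_map U).
Local Notation rip := (@rip R s U).
Local Notation rn := (fun w : W => rnorm (w : U)).
Local Notation smeas f := (@strongly_measurable R s U f).
Local Notation L2 := (@in_L2 R s U : set (R -> W)).
Local Notation Int h := (mu.-integrable setT (EFin \o h)).
Implicit Types f g : R -> W.

Lemma measurable_rnorm2 f : smeas f -> measurable_fun setT (fun x => rn (f x) ^+ 2).
Proof. by move=> mf; apply: measurable_funX; exact: measurable_rnorm. Qed.

Lemma in_L2P f : L2 f <-> smeas f /\ Int (fun x => rn (f x) ^+ 2).
Proof.
split=> -[mf If]; split=> //.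
  apply/integrableP; split; first by apply/measurable_EFinP; exact: measurable_rnorm2.
  under eq_integral do rewrite /= ger0_norm ?sqr_ge0//.
  exact: If.
move/integrableP : If => [_]; under eq_integral do rewrite /= ger0_norm ?sqr_ge0//.
by [].
Qed.

Lemma le_integrableR (h k : R -> R) : measurable_fun setT h ->
  (forall x, `|h x| <= k x) -> Int k -> Int h.
Proof.
move=> mh hk; apply: le_integrable => //; first exact/measurable_EFinP.
by move=> x _ /=; rewrite lee_fin (le_trans (hk x))// ler_norm.
Qed.

Lemma integrableDR (h k : R -> R) : Int h -> Int k -> Int (fun x => h x + k x).
Proof.
move=> Ih Ik; rewrite (_ : _ \o _ = (EFin \o h) \+ (EFin \o k))%E//.
exact: integrableD.
Qed.

Lemma integrableZR c (h : R -> R) : Int h -> Int (fun x => c * h x).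
Proof.
move=> Ih; rewrite (_ : _ \o _ = fun x => c%:E * (EFin \o h) x)%E//.
exact: integrableZl.
Qed.

Lemma in_L2_le f (h : R -> R) : smeas f -> Int h ->
  (forall x, rn (f x) ^+ 2 <= h x) -> L2 f.
Proof.
move=> mf Ih fh; apply/in_L2P; split=> //.
apply: le_integrableR Ih; first exact: measurable_rnorm2.
by move=> x; rewrite ger0_norm ?sqr_ge0.
Qed.

Lemma rn_sqrD (v w : W) : rn (v + w) ^+ 2 <= 2 * rn v ^+ 2 + 2 * rn w ^+ 2.
Proof.
have := rnormD v w; have := rnorm_ge0 (v + w : U).
move: (rnorm (v + w)) (rnorm v) (rnorm w) => a b c a0 abc.
rewrite (@le_trans _ _ ((b + c) ^+ 2))//; first by rewrite lerXn2r ?nnegrE ?(le_trans a0).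
by have := sqr_ge0 (b - c); rewrite sqrrB sqrrD; lra.
Qed.

Lemma in_L2D f g : L2 f -> L2 g -> L2 (fun x => f x + g x).
Proof.
move=> /in_L2P[mf If] /in_L2P[mg Ig].
apply: (in_L2_le (h := fun x => 2 * rn (f x) ^+ 2 + 2 * rn (g x) ^+ 2)).
- exact: smeasD.
- by apply: integrableDR; apply: integrableZR.
- by move=> x; exact: rn_sqrD.
Qed.

Lemma in_L2M (m : R -> R) (C : R) f : measurable_fun setT m ->
  (forall x, 0 <= m x) -> (forall x, m x <= C) -> L2 f ->
  L2 (fun x => m x *: f x).
Proof.
move=> mm m0 mC /in_L2P[mf If].
apply: (in_L2_le (h := fun x => C ^+ 2 * rn (f x) ^+ 2)).
- exact: smeasM.
- exact: integrableZR.
- move=> x; rewrite rnormZ exprMn ler_wpM2r ?sqr_ge0//.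
  by rewrite ger0_norm// lerXn2r ?nnegrE ?(le_trans (m0 x)).
Qed.

Lemma in_L2Z a f : L2 f -> L2 (fun x => a *: f x).
Proof.
move=> /in_L2P[mf If]; apply: (in_L2_le (h := fun x => `|a| ^+ 2 * rn (f x) ^+ 2)).
- exact: smeasZ.
- exact: integrableZR.
- by move=> x; rewrite rnormZ exprMn.
Qed.

Lemma in_L2B f g : L2 f -> L2 g -> L2 (fun x => f x - g x).
Proof.
move=> Lf /(in_L2Z (-1)) Lg; have := in_L2D Lf Lg.
by under eq_fun do rewrite scaleN1r.
Qed.

Lemma in_L2_0 : L2 (fun=> 0).
Proof.
apply: (in_L2_le (h := fun=> 0)); first exact: smeas_cst.
- exact: integrable0.
- by move=> x; rewrite rnorm0 expr0n.
Qed.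

(** With weight [1] this is the inner product of the space; truncations of [xi ^+ 2] give
    the forms which approximate the dissipation. *)
Definition l2form (w : R -> R) f g : R := \int[mu]_x (w x * rip (f x) (g x)).

Lemma l2form_integrable (w : R -> R) (C : R) f g : measurable_fun setT w ->
  (forall x, `|w x| <= C) -> L2 f -> L2 g -> Int (fun x => w x * rip (f x) (g x)).
Proof.
move=> mw wC /in_L2P[mf If] /in_L2P[mg Ig].
have C0 : 0 <= C by exact: le_trans (wC 0).
apply: (le_integrableR (k := fun x => C * (rn (f x) ^+ 2 + rn (g x) ^+ 2))).
- by apply: measurable_funM => //; exact: measurable_rip.
- move=> x; rewrite normrM ler_pM// (le_trans (rip_le _ _))//.
  have := sqr_ge0 (rn (f x) - rn (g x)); rewrite sqrrB.
  have := sqr_ge0 (rn (f x)); have := sqr_ge0 (rn (g x)).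
  by lra.
- by apply: integrableZR; exact: integrableDR.
Qed.

Lemma l2form_on (w : R -> R) (C : R) : measurable_fun setT w ->
  (forall x, 0 <= w x) -> (forall x, w x <= C) -> form_on L2 (l2form w).
Proof.
move=> mw w0 wC.
have II f g : L2 f -> L2 g -> Int (fun x => w x * rip (f x) (g x)).
  by apply: (l2form_integrable (C := C)) => // x; rewrite ger0_norm.
split.
- exact: in_L2_0.
- by move=> a f g Lf Lg; apply: in_L2D => //; exact: in_L2Z.
- by move=> f g _ _; apply: eq_Rintegral => x _; rewrite ripC.
- move=> a f g h Lf Lg Lh; rewrite /l2form -RintegralZl ?II//.
  rewrite -RintegralD ?II//; last by apply: integrableZR; exact: II.
  by apply: eq_Rintegral => x _; rewrite ripDl ripZl; ring.
- by move=> f Lf; apply: Rintegral_ge0 => x _; rewrite mulr_ge0 ?rip_ge0.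
Qed.

Local Notation ip2 := (l2form (fun=> 1)).
Local Notation N2 := (fnorm ip2).

Lemma ip2_on : form_on L2 ip2.
Proof. by apply: (l2form_on (C := 1)). Qed.

Lemma ip2E f : ip2 f f = \int[mu]_x (rn (f x) ^+ 2).
Proof. by apply: eq_Rintegral => x _; rewrite mul1r rnorm_sqr. Qed.

Lemma ip2_EFin f : L2 f -> (ip2 f f)%:E = (\int[mu]_x (rn (f x) ^+ 2)%:E)%E.
Proof.
move=> /in_L2P[mf If]; rewrite ip2E /Rintegral fineK//.
exact: integrable_fin_num.
Qed.

Lemma ip2_null f : L2 f -> ip2 f f = 0 -> {ae mu, forall x, f x = 0}.
Proof.
move=> Lf f0; have /in_L2P[mf If] := Lf.
have : (\int[mu]_x `|(rn (f x) ^+ 2)%:E| = 0)%E.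
  under eq_integral do rewrite abse_EFin ger0_norm ?sqr_ge0//.
  by rewrite -ip2_EFin// f0.
move/ae_eq_integral_abs => H.
have {}H := H measurableT _; apply: filterS (H _) => [x /(_ I)|].
  by move=> -[] /eqP; rewrite sqrf_eq0 => /eqP/rnorm_eq0.
by apply/measurable_EFinP; exact: measurable_rnorm2.
Qed.

Lemma ip2_ae0 f : L2 f -> {ae mu, forall x, f x = 0} -> ip2 f f = 0.
Proof.
move=> Lf f0; have /in_L2P[mf If] := Lf.
apply: EFin_inj; rewrite ip2_EFin//.
rewrite (ae_eq_integral (fun=> 0%E))//; first by rewrite integral0.
- by apply/measurable_EFinP; exact: measurable_rnorm2.
- apply: (ae_imply (mu := lebesgue_measure) _ f0) => x -> _.
  by rewrite rnorm0 expr0n.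
Qed.

Lemma L2_simple_dense f e : L2 f -> 0 < e ->
  exists2 g : smap, L2 (sm_eval g) & N2 (f - sm_eval g) < e.
Proof.
move=> Lf e0; have /in_L2P[mf If] := Lf.
have [g [gf gd]] := smeas_dominated mf.
have Lg n : L2 (sm_eval (g n)).
  apply: (in_L2_le (h := fun x => 4 * rn (f x) ^+ 2)); first exact: smeas_simple.
    exact: integrableZR.
  move=> x; rewrite (_ : 4 = 2 ^+ 2 :> R); last by rewrite -natrX.
  by rewrite -exprMn lerXn2r ?nnegrE ?mulr_ge0 ?rnorm_ge0.
have Ld n : L2 (f - (sm_eval (g n) : R -> W)) by exact: in_L2B.
have c0 : (fun n => ip2 (f - (sm_eval (g n) : R -> W)) (f - (sm_eval (g n) : R -> W))) @ \oo --> (0 : R).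
  apply: EFin_cvg0.
  rewrite (_ : (fun n => _) = (fun n => \int[mu]_x
      (rn (f x - sm_eval (g n) x) ^+ 2)%:E)%E); last first.
    by apply/funext => n; rewrite ip2_EFin.
  have := @dominated_cvg _ _ _ mu setT measurableT
    (fun n x => (rn (f x - sm_eval (g n) x) ^+ 2)%:E) (fun=> 0%E)
    (fun x => (9 * rn (f x) ^+ 2)%:E).
  rewrite integral0; apply.
  - move=> n; apply/measurable_EFinP; apply: measurable_rnorm2.
    by have /in_L2P[] := Ld n.
  - move=> x _; have : (fun n => (rn (f x - sm_eval (g n) x) ^+ 2)%:E) @ \oo --> (0 : R)%:E.
      apply: cvg_EFin; first by exists 0%N.
      have h := cvgM (gf x) (gf x); rewrite mulr0 in h.
      rewrite (_ : fine \o _ = fun n => rn (sm_eval (g n) x - f x) * rn (sm_eval (g n) x - f x)).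
        exact: h.
      by apply/funext => n /=; rewrite rnormB expr2.
    by [].
  - by [].
  - exact: integrableZR.
  - move=> n x _; rewrite /= ger0_norm ?sqr_ge0// lee_fin.
    rewrite (_ : 9 = 3 ^+ 2 :> R); last by rewrite -natrX.
    rewrite -exprMn lerXn2r ?nnegrE ?mulr_ge0 ?rnorm_ge0//.
    rewrite (le_trans (rnormD _ _))// rnormN.
    by have := gd n x; lra.
have [|n0 h] := (cvg0P (fun n => form_ge0 ip2_on (Ld n))).1 c0 (e ^+ 2).
  by rewrite exprn_gt0.
exists (g n0) => //; rewrite -(@ltr_pXn2r _ 2) ?nnegrE ?fnorm_ge0 ?(ltW e0)//.
rewrite (fnorm_sqr ip2_on)//; exact: h.
Qed.

(** The series of the integrals of [4 ^+ n * rn (g n x - g n.+1 x) ^+ 2] converges, hence its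
    sum is finite for almost every [x]. There [rn (g n x - g n.+1 x)] is of order [2 ^- n],
    and the sequence [g n x] is Cauchy. *)
Lemma fast_simple_ae (g : nat -> smap) :
  (forall n, L2 (sm_eval (g n))) ->
  (forall n, N2 ((sm_eval (g n) : R -> W) - sm_eval (g n.+1)) <= 3 * 4^-1 ^+ n) ->
  exists2 A : set R, measurable A & {ae mu, forall x, A x} /\
    (forall x, A x -> cauchy_for rn (fun n => sm_eval (g n) x)).
Proof.
move=> Lg gg.
pose d n x : R := rn ((sm_eval (g n) x : W) - sm_eval (g n.+1) x) ^+ 2.
have Ld n : L2 ((sm_eval (g n) : R -> W) - sm_eval (g n.+1)) by exact: in_L2B.
have md n : measurable_fun setT (d n).
  by apply: measurable_rnorm2; have /in_L2P[] := Ld n.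
pose h n x : \bar R := (4 ^+ n * d n x)%:E.
have h0 n x : (0 <= h n x)%E by rewrite lee_fin mulr_ge0 ?sqr_ge0 ?exprn_ge0.
have mh n : measurable_fun setT (h n).
  by apply/measurable_EFinP; exact: measurable_funM.
pose F x : \bar R := (\sum_(0 <= n <oo) h n x)%E.
have Fcvg x : (fun n => \sum_(0 <= i < n) h i x)%E @ \oo --> F x.
  by apply: is_cvg_nneseries => n _ _; exact: h0.
have mF : measurable_fun setT F.
  apply: (emeasurable_fun_cvg (fun n x => \sum_(0 <= i < n) h i x)%E) => [n|x _].
    by apply: emeasurable_sum.
  exact: Fcvg.
have F0 x : (0 <= F x)%E by apply: nneseries_ge0 => n _ _; exact: h0.
have IF : (\int[mu]_x F x < +oo)%E.
  rewrite integral_nneseries//.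
  apply: (@le_lt_trans _ _ (\sum_(0 <= n <oo) (18 / (2 ^ n.+1)%:R)%:E)%E); last first.
    by apply: le_lt_trans (epsilon_trick0 xpredT (_ : 0 <= 18)) _; rewrite ?ltry.
  apply: lee_nneseries => [n _ _|n _].
    by apply: integral_ge0 => x _; exact: h0.
  have me : measurable_fun setT (EFin \o d n) by apply/measurable_EFinP; exact: md.
  have e0 x : setT x -> (0 <= (EFin \o d n) x)%E by move=> _; rewrite lee_fin sqr_ge0.
  have p4 : 0 <= 4 ^+ n :> R by rewrite exprn_ge0.
  have -> : (\int[mu]_x h n x = (4 ^+ n)%:E * \int[mu]_x (EFin \o d n) x)%E.
    rewrite -(ge0_integralZl_EFin mu measurableT e0 me p4).
    by apply: eq_integral => x _; rewrite /h EFinM.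
  rewrite -(ip2_EFin (Ld n)) -EFinM lee_fin.
  rewrite -(fnorm_sqr ip2_on)//.
  have : N2 ((sm_eval (g n) : R -> W) - sm_eval (g n.+1)) ^+ 2 <= (3 * 4^-1 ^+ n) ^+ 2.
    by rewrite lerXn2r ?nnegrE ?fnorm_ge0 ?mulr_ge0 ?exprn_ge0.
  move=> /(ler_wpM2l p4) /le_trans; apply.
  rewrite exprVn natrX (exprS _ n) (_ : 4 ^+ n = (2 ^+ n) ^+ 2 :> R); last first.
    by rewrite -exprM mulnC exprM; congr (_ ^+ n); rewrite -natrX.
  have p2 : 1 <= 2 ^+ n :> R by rewrite exprn_ege1// ler1n.
  have p20 : 2 ^+ n != 0 :> R by rewrite gt_eqF// (lt_le_trans ltr01).
  have -> : 2 ^+ n ^+ 2 * (3 / 2 ^+ n ^+ 2) ^+ 2 = 9 / (2 ^+ n) ^+ 2 :> R.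
    by field.
  have -> : 18 / (2 * 2 ^+ n) = 9 / 2 ^+ n :> R by field.
  by rewrite ler_pM2l// lef_pV2 ?posrE ?exprn_gt0// expr2 ler_peMr.
exists [set x | F x \is a fin_num].
  by rewrite -[X in measurable X]setTI; exact: emeasurable_fin_num.
split.
  have : mu.-integrable setT F.
    apply/integrableP; split=> //.
    by under eq_integral do rewrite gee0_abs//.
  move=> /(integrable_ae measurableT); apply: ae_imply => x; exact.
move=> x /= Fx; pose C := fine (F x).
have dC n : d n x <= C / 4 ^+ n.
  rewrite ler_pdivlMr ?exprn_gt0// mulrC -lee_fin fineK//.
  rewrite -(cvg_lim _ (Fcvg x))//.
  apply: lime_ge; first by apply/cvg_ex; exists (F x); exact: Fcvg.
  exists n.+1 => // m /= nm; rewrite big_mkord (bigD1 (Ordinal nm))//= leeDl//.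
  by apply: sume_ge0 => i _; exact: h0.
apply: (cauchy_semi_geometric rnorm_seminorm (C := Num.sqrt C)) => n.
rewrite -(@ler_pXn2r _ 2) ?nnegrE ?rnorm_ge0 ?mulr_ge0 ?sqrtr_ge0 ?exprn_ge0//.
rewrite exprMn sqr_sqrtr ?fine_ge0// -exprM mulnC exprM.
by have := dC n; rewrite -exprVn (_ : 4^-1 = 2^-1 ^+ 2)// exprVn -natrX.
Qed.

(** Pointwise convergence need not preserve the norm of [G n - g], but Fatou's lemma shows
    that a bound on these norms passes to the limit. *)
Lemma L2_fatou (G : nat -> R -> W) (f g : R -> W) (e : R) :
  (forall n, L2 (G n)) -> smeas f -> L2 g -> 0 <= e ->
  (forall x, cvg_semi rn (fun n => G n x) (f x)) ->
  (forall n, N2 (G n - g) <= e) -> L2 (f - g) /\ N2 (f - g) <= e.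
Proof.
move=> LG mf Lg e0 Gf Ge.
have mfg : smeas (f - g) by apply: smeasB => //; exact: Lg.1.
have Ld n : L2 (G n - g) by exact: in_L2B.
have bound : (\int[mu]_x (rn ((f - g) x) ^+ 2)%:E <= (e ^+ 2)%:E)%E.
  have -> : (\int[mu]_x (rn ((f - g) x) ^+ 2)%:E =
      \int[mu]_x limn_einf (fun n => (rn ((G n - g) x) ^+ 2)%:E))%E.
    apply: eq_integral => x _; apply/esym.
    apply: (cvg_limn_einf_sup _).1; apply: cvg_EFin; first by apply: nearW.
    have /(cvg_semi_norm rnorm_seminorm) c :=
      cvg_semiB rnorm_seminorm (Gf x) (cvg_semi_cst rnorm_seminorm (g x)).
    have h := cvgM c c; rewrite (_ : fine \o _ =
      fun n => rn (G n x - g x) * rn (G n x - g x)).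
      by rewrite expr2; exact: h.
    by apply/funext => n /=; rewrite expr2.
  apply: le_trans (fatou mu measurableT _ _) _.
  - by move=> n; apply/measurable_EFinP; apply: measurable_rnorm2; exact: (Ld n).1.
  - by move=> n x _; rewrite lee_fin sqr_ge0.
  apply: (limn_einf_le (r_ := fun=> e ^+ 2)); first exact: cvg_cst.
  move=> n; rewrite -(ip2_EFin (Ld n)) lee_fin -(fnorm_sqr ip2_on)//.
  by rewrite lerXn2r ?nnegrE ?fnorm_ge0.
have Lfg : L2 (f - g) by split=> //; apply: le_lt_trans bound _; rewrite ltry.
split=> //; rewrite -(@ler_pXn2r _ 2) ?nnegrE ?fnorm_ge0// (fnorm_sqr ip2_on)//.
by rewrite -lee_fin ip2_EFin.
Qed.

Lemma N2_trans g f h : L2 f -> L2 g -> L2 h -> N2 (f - h) <= N2 (f - g) + N2 (g - h).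
Proof.
move=> Lf Lg Lh; rewrite -{1}(subrK g f) -addrA.
by apply: (fnormD ip2_on); exact: in_L2B.
Qed.

Lemma N2_sym f g : L2 f -> L2 g -> N2 (f - g) = N2 (g - f).
Proof.
move=> Lf Lg; rewrite -[f - g]opprB -scaleN1r (fnormZ ip2_on) ?normrN1 ?mul1r//.
exact: in_L2B.
Qed.

(** Completeness is not the classical statement for scalar functions: limits must again be
    pointwise limits, everywhere, of simple maps. Hence a Cauchy sequence is approximated,
    along a subsequence [K n], by simple maps [g n]; these are set to [0] outside the set
    [A] of full measure where they converge, and the resulting simple maps [G n] converge
    everywhere. *)
Lemma L2_complete : complete_on L2 N2.
Proof.
move=> u Lu cu.
have /choice[k kP] : forall n : nat, exists k, forall i j, (k <= i)%N -> (k <= j)%N ->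
    N2 (u i - u j) < 4^-1 ^+ n by move=> n; apply: cu; rewrite exprn_gt0.
pose K n := (\sum_(i < n.+1) k i)%N.
have kK i n : (i <= n)%N -> (k i <= K n)%N.
  by move=> ij; rewrite /K (bigD1 (Ordinal (ij : (i < n.+1)%N)))//= leq_addr.
have /choice[g gP] : forall n : nat, exists g : smap,
    L2 (sm_eval g) /\ N2 (u (K n) - sm_eval g) < 4^-1 ^+ n.
  move=> n; have [|g Lg ug] := @L2_simple_dense (u (K n)) (4^-1 ^+ n) (Lu _).
    by rewrite exprn_gt0.
  by exists g.
have Lg n : L2 (sm_eval (g n)) by have [] := gP n.
have [|A mA [aeA gA]] := fast_simple_ae Lg.
  move=> n; have p0 : 0 <= 4^-1 ^+ n :> R by rewrite exprn_ge0.
  have h1 := (gP n).2; have h2 := (gP n.+1).2.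
  have h3 := kP n _ _ (kK n n (leqnn n)) (kK n n.+1 (leqnSn n)).
  have := N2_trans (Lg n) (Lu (K n)) (Lg n.+1).
  have := N2_trans (Lu (K n)) (Lu (K n.+1)) (Lg n.+1).
  rewrite (N2_sym (Lg n) (Lu (K n))); rewrite exprS in h2.
  by move: p0 h1 h2 h3; move: (4^-1 ^+ n) => z; lra.
pose G n := sm_restrict mA (g n).
have GE n x : sm_eval (G n) x = (\1_A x : R) *: (sm_eval (g n) x : W).
  exact: sm_eval_restrict.
have LG n : L2 (sm_eval (G n)).
  have -> : (sm_eval (G n) : R -> W) = fun x => (\1_A x : R) *: (sm_eval (g n) x : W).
    by apply/funext => x; exact: GE.
  by apply: (in_L2M (C := 1)).
have Gg n : N2 ((sm_eval (G n) : R -> W) - sm_eval (g n)) = 0.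
  rewrite /fnorm ip2_ae0 ?sqrtr0//; first exact: in_L2B.
  apply: (ae_imply (mu := lebesgue_measure) _ aeA) => x Ax.
  by rewrite -[LHS]/((sm_eval (G n) x : W) - sm_eval (g n) x) GE indicE mem_set// scale1r subrr.
have Glim x : exists l : W, cvg_semi rn (fun n => sm_eval (G n) x) l.
  have [Ax|nAx] := pselect (A x).
    have [l ll] := hilbert_complete (gA x Ax); exists l.
    rewrite (_ : (fun n => _) = fun n => sm_eval (g n) x)//.
    by apply/funext => n; rewrite GE indicE mem_set// scale1r.
  exists 0; have -> : (fun n => sm_eval (G n) x) = (fun=> 0 : W).
    by apply/funext => n; rewrite GE indicE memNset// scale0r.
  exact: (cvg_semi_cst rnorm_seminorm).
have [f fG] := choice Glim.
have mf : smeas f by apply/smeasP; exists G.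
have close i n : (K n <= i)%N -> N2 (u i - sm_eval (G n)) < 2 * 4^-1 ^+ n.
  move=> Ki; have h1 := (gP n).2.
  have h2 := kP n _ _ (leq_trans (kK n n (leqnn n)) Ki) (kK n n (leqnn n)).
  have := N2_trans (Lu i) (Lu (K n)) (LG n).
  have := N2_trans (Lu (K n)) (Lg n) (LG n).
  rewrite (N2_sym (Lg n) (LG n)) Gg addr0.
  by move: h1 h2; move: (4^-1 ^+ n) => z; lra.
have GG n m : (n <= m)%N -> N2 ((sm_eval (G m) : R -> W) - sm_eval (G n)) <= 4 * 4^-1 ^+ n.
  move=> nm; have h1 := close (maxn (K n) (K m)) n (leq_maxl _ _).
  have h2 := close (maxn (K n) (K m)) m (leq_maxr _ _).
  have h3 : 4^-1 ^+ m <= 4^-1 ^+ n :> R.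
    by rewrite ler_wiXn2l// invf_le1// ler1n.
  have := N2_trans (LG m) (Lu (maxn (K n) (K m))) (LG n).
  rewrite (N2_sym (LG m) (Lu _)).
  by move: h1 h2 h3; move: (4^-1 ^+ n) (4^-1 ^+ m) => z w; lra.
have fGn n : L2 (f - sm_eval (G n)) /\ N2 (f - sm_eval (G n)) <= 4 * 4^-1 ^+ n.
  have p0 : 0 <= 4 * 4^-1 ^+ n :> R by rewrite mulr_ge0 ?exprn_ge0.
  apply: (@L2_fatou (fun m => sm_eval (G (m + n)%N)) f _ _ (fun m => LG _) mf (LG n) p0).
  - move=> x; apply/cvg0P => [m|e e0]; first exact: rnorm_ge0.
    have [n0 h] := (cvg0P (fun n => rnorm_ge0 _)).1 (fG x) e e0.
    by exists n0 => m nm; apply: h; exact: leq_trans nm (leq_addr _ _).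
  - by move=> m; apply: GG; exact: leq_addl.
have Lf : L2 f.
  by have := in_L2D (fGn 0%N).1 (LG 0%N); under eq_fun do rewrite subrK.
exists f => //; apply/cvg0P => [n|e e0]; first exact: fnorm_ge0.
have : (fun n => 8 * 4^-1 ^+ n) @ \oo --> (0 : R).
  rewrite -(mulr0 8); apply: cvgM; first exact: cvg_cst.
  by apply: cvg_expr; rewrite ger0_norm//; lra.
move/cvg0P => /(_ _ e e0)[n|n0 /(_ n0 (leqnn _)) h]; first by rewrite mulr_ge0 ?exprn_ge0.
exists (K n0) => i Ki.
rewrite (le_lt_trans (N2_trans (Lu i) (LG n0) Lf))//.
rewrite (N2_sym (LG n0) Lf); have := (fGn n0).2; have := close i n0 Ki.
have : 0 <= 4^-1 ^+ n0 :> R by rewrite exprn_ge0.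
by move: h; move: (4^-1 ^+ n0) => z; lra.
Qed.
End L2.

(** ** The Bochner integral is the weak integral *)

Section Bochner.
Context {R : realType} {s : scalars} {U : hilbertType R s}.
Local Notation W := (realified U).
Local Notation mu := (@lebesgue_measure R).
Local Notation smap := (simple_map U).
Local Notation rip := (@rip R s U).
Local Notation rn := (fun w : W => rnorm (w : U)).
Local Notation smeas f := (@strongly_measurable R s U f).
Local Notation Int h := (mu.-integrable setT (EFin \o h)).
Implicit Types f : R -> W.

Lemma integrable_indicR (A : set R) : measurable A -> (mu A < +oo)%E ->
  Int (\1_A : R -> R) /\ \int[mu]_x (\1_A x : R) = fine (mu A).
Proof.
move=> mA fA.
have IA : (\int[mu]_x (\1_A x : R)%:E = mu A)%E by rewrite integral_indic// setIT.
split; last by rewrite /Rintegral IA.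
apply/integrableP; split; first by apply/measurable_EFinP; exact: measurable_indic.
by under eq_integral do rewrite /= ger0_norm ?indicE//; rewrite -IA in fA.
Qed.

Lemma simple_rip (g : smap) (z : W) :
  Int (fun x => rip (sm_eval g x) z) /\
  \int[mu]_x rip (sm_eval g x) z = rip (sm_integral g) z.
Proof.
have Ii i := integrable_indicR (@sm_measurable _ _ _ g i) (@sm_finite _ _ _ g i).
pose h (i : 'I_(sm_size g)) x : R := rip (sm_val i) z * \1_(sm_set i) x.
have Ih i : Int (h i) by apply: integrableZR; exact: (Ii i).1.
have E : (EFin \o fun x => rip (sm_eval g x) z) =
    (fun x => \sum_(i <- index_enum 'I_(sm_size g)) (EFin \o h i) x)%E.
  apply/funext => x /=; rewrite sm_evalE rip_suml sumEFin; congr (_%:E).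
  by apply: eq_bigr => i _; rewrite ripZl mulrC.
split; first by rewrite E; exact: integrable_sum.
rewrite /Rintegral -[X in integral _ _ X]/(EFin \o fun x => rip (sm_eval g x) z) E.
rewrite integral_sum// sm_integralE rip_suml.
have If i : (\int[mu]_x (EFin \o h i) x)%E \is a fin_num by exact: integrable_fin_num.
under eq_bigr do rewrite -(fineK (If _)).
rewrite sumEFin /=.
apply: eq_bigr => i _; rewrite -/(Rintegral mu setT (h i)) ripZl.
by rewrite RintegralZl ?(Ii i).2 1?mulrC//; exact: (Ii i).1.
Qed.

Lemma simple_rn_integrable (g : smap) : Int (fun x => rn (sm_eval g x)).
Proof.
have Ii i := integrable_indicR (@sm_measurable _ _ _ g i) (@sm_finite _ _ _ g i).
pose h (i : 'I_(sm_size g)) x : R := rn (sm_val i) * \1_(sm_set i) x.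
have Ih i : Int (h i) by apply: integrableZR; exact: (Ii i).1.
apply: (le_integrableR (k := fun x => \sum_(i <- index_enum 'I_(sm_size g)) h i x)).
- by apply: measurable_rnorm; exact: smeas_simple.
- move=> x; rewrite ger0_norm ?rnorm_ge0// sm_evalE.
  elim/big_ind2 : _ => [|a b c d ab cd|i _]; first by rewrite rnorm0.
    by rewrite (le_trans (rnormD _ _))// lerD.
  by rewrite rnormZ mulrC ger0_norm.
rewrite (_ : EFin \o _ = fun x => \sum_(i <- index_enum 'I_(sm_size g)) (EFin \o h i) x)%E.
  exact: integrable_sum.
by apply/funext => x /=; rewrite sumEFin.
Qed.

Lemma sm_integral_sub (g h : smap) :
  (sm_integral (sm_add g (sm_scale (-1) h)) : W) = (sm_integral g : W) - sm_integral h.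
Proof.
rewrite !sm_integralE big_split_ord/= -sumrN; congr (_ + _); apply: eq_bigr => i _.
  by rewrite (unsplitK (inl i)).
by rewrite (unsplitK (inr i)) scaleN1r scalerN.
Qed.

(** Test the integral against itself. *)
Lemma sm_integral_le (g : smap) : rn (sm_integral g) <= \int[mu]_x rn (sm_eval g x).
Proof.
have [g0|g0] := eqVneq (rn (sm_integral g)) 0.
  by rewrite g0; apply: Rintegral_ge0 => x _; exact: rnorm_ge0.
have gp : 0 < rn (sm_integral g) by rewrite lt_neqAle eq_sym g0 rnorm_ge0.
rewrite -(ler_pM2r gp) -expr2 rnorm_sqr -(simple_rip g _).2 mulrC.
rewrite -RintegralZl//; last exact: simple_rn_integrable.
apply: le_Rintegral => //.
- exact: (simple_rip g _).1.
- by apply: integrableZR; exact: simple_rn_integrable.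
- by move=> x _; rewrite (le_trans (ler_norm _))// mulrC; exact: rip_le.
Qed.

Variable f : R -> W.
Hypotheses (mf : smeas f) (If : Int (fun x => rn (f x))).

Let dist_integrable (g : smap) : Int (fun x => rn (f x - sm_eval g x)).
Proof.
apply: (le_integrableR (k := fun x => rn (f x) + rn (sm_eval g x))).
- by apply: measurable_rnorm; apply: smeasB => //; exact: smeas_simple.
- by move=> x; rewrite ger0_norm ?rnorm_ge0// (le_trans (rnormD _ _))// rnormN.
- by apply: integrableDR => //; exact: simple_rn_integrable.
Qed.

Lemma rip_integrable (z : W) : Int (fun x => rip (f x) z).
Proof.
apply: (le_integrableR (k := fun x => rn z * rn (f x))).
- by apply: measurable_rip => //; exact: smeas_cst.
- by move=> x; rewrite mulrC; exact: rip_le.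
- exact: integrableZR.
Qed.

Let dist_EFin (g : smap) : (\int[mu]_x (rnorm (f x - sm_eval g x))%:E)%E =
  (\int[mu]_x rn (f x - sm_eval g x))%:E.
Proof.
by rewrite /Rintegral fineK//; exact: integrable_fin_num (dist_integrable g).
Qed.

Lemma bochner_exists : exists w, is_bochner_integral f w.
Proof.
have [g [gf gd]] := smeas_dominated mf.
have c0 : (fun n => \int[mu]_x rn (f x - sm_eval (g n) x)) @ \oo --> (0 : R).
  apply: EFin_cvg0.
  rewrite (_ : (fun n => _) = (fun n => \int[mu]_x
      (rn (f x - sm_eval (g n) x))%:E)%E); last first.
    by apply/funext => n; rewrite dist_EFin.
  have := @dominated_cvg _ _ _ mu setT measurableT
    (fun n x => (rn (f x - sm_eval (g n) x))%:E) (fun=> 0%E)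
    (fun x => (3 * rn (f x))%:E).
  rewrite integral0; apply.
  - move=> n; apply/measurable_EFinP; apply: measurable_rnorm.
    by apply: smeasB => //; exact: smeas_simple.
  - move=> x _; have : (fun n => (rn (f x - sm_eval (g n) x))%:E) @ \oo --> (0 : R)%:E.
      apply: cvg_EFin; first by exists 0%N.
      rewrite (_ : fine \o _ = fun n => rn (sm_eval (g n) x - f x)); first exact: gf.
      by apply/funext => n /=; rewrite rnormB.
    by [].
  - by [].
  - exact: integrableZR.
  - move=> n x _; rewrite /= ger0_norm ?rnorm_ge0// lee_fin.
    rewrite (le_trans (rnormD _ _))// rnormN.
    by have := gd n x; lra.
have cg : cauchy_for rn (fun n => sm_integral (g n)).
  move=> e e0; have e20 : 0 < e / 2 by rewrite divr_gt0.
  have [|n0 h] := (cvg0P (fun n => _)).1 c0 (e / 2) e20.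
    by move=> n; apply: Rintegral_ge0 => x _; exact: rnorm_ge0.
  exists n0 => m n n0m n0n; rewrite -sm_integral_sub.
  apply: le_lt_trans (sm_integral_le _) _.
  apply: (@le_lt_trans _ _ (\int[mu]_x rn (f x - sm_eval (g m) x) +
    \int[mu]_x rn (f x - sm_eval (g n) x))); last first.
    by have := h m n0m; have := h n n0n; lra.
  rewrite -RintegralD//; apply: le_Rintegral => //.
  - exact: simple_rn_integrable.
  - exact: integrableDR.
  - move=> x _; rewrite sm_eval_add sm_eval_scale scaleN1r.
    rewrite [X in _ <= X + _]rnormB.
    by rewrite -{1}(subrK (f x) (sm_eval (g m) x)) -addrA; exact: rnormD.
have [w wl] := hilbert_complete cg.
exists w; split=> //; exists g; split; last exact/cvg_rnorm.
rewrite (_ : (fun n => _) = (fun n => (\int[mu]_x rn (f x - sm_eval (g n) x))%:E)).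
  by apply: cvg_EFin; [exists 0%N|exact: c0].
by apply/funext => n; exact: dist_EFin.
Qed.

Lemma is_bochner_weak (w z : W) : is_bochner_integral f w ->
  rip w z = \int[mu]_x rip (f x) z.
Proof.
move=> [_ [g [g0 gw]]].
have {}gw : cvg_semi rn (fun n => sm_integral (g n)) w by have /cvg_rnorm := gw.
have c0 : (fun n => \int[mu]_x rn (f x - sm_eval (g n) x)) @ \oo --> (0 : R).
  apply: EFin_cvg0; rewrite (_ : (fun n => _) = (fun n => \int[mu]_x
      (rnorm (f x - sm_eval (g n) x : U))%:E)%E)//.
  by apply/funext => n; rewrite dist_EFin.
have c1 : (fun n => rip (sm_integral (g n)) z) @ \oo --> rip w z.
  apply: (cvg_form rip_form); rewrite -rnorm_fnorm//.
  exact: (cvg_semi_cst rnorm_seminorm).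
have c2 : (fun n => rip (sm_integral (g n)) z) @ \oo --> \int[mu]_x rip (f x) z.
  apply/cvgrPdist_le => e e0.
  have c3 : (fun n => (\int[mu]_x rn (f x - sm_eval (g n) x)) * rn z) @ \oo --> (0 : R).
    by rewrite -(mul0r (rn z)); apply: cvgM c0 _; exact: cvg_cst.
  move/cvgrPdist_le : c3 => /(_ e e0); apply: filterS => n.
  rewrite sub0r normrN => /(le_trans (ler_norm _)); apply: le_trans.
  rewrite -(simple_rip (g n) z).2 -RintegralB//; last 2 first.
  - exact: rip_integrable.
  - exact: (simple_rip (g n) z).1.
  have Id : Int (fun x => rip (f x) z - rip (sm_eval (g n) x) z).
    rewrite (_ : (fun x => _) = fun x => rip (f x) z + (-1) * rip (sm_eval (g n) x) z).
      by apply: integrableDR; [exact: rip_integrable|apply: integrableZR; exact: (simple_rip (g n) z).1].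
    by apply/funext => x; rewrite mulN1r.
  rewrite (le_trans (le_normr_Rintegral measurableT Id))//.
  rewrite -[X in _ <= X]mulrC -RintegralZl//; apply: le_Rintegral => //.
  - move/integrable_abse : Id; congr (_.-integrable _ _).
  - exact: integrableZR.
  - by move=> x _; rewrite -ripBl mulrC; exact: rip_le.
exact: (cvg_unique _ c1 c2).
Qed.

(** A vector is determined by its products with test vectors: the linearity and the
    estimates of the integral follow from those of scalar integrals. *)
Lemma bochner_weak (z : W) : rip (bochner_integral f) z = \int[mu]_x rip (f x) z.
Proof.
apply: is_bochner_weak; rewrite /bochner_integral; case: xgetP => [w _ //|nw].
by have [w fw] := bochner_exists; case: (nw w).
Qed.
End Bochner.

(** * Self-adjoint operators *)

Section SelfAdjoint.
Context {R : realType} {s : scalars} {H : hilbertType R s}.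
Local Notation W := (realified H).
Local Notation rip := (@rip R s H).
Local Notation rn := (fun w : W => rnorm (w : H)).
Local Notation K := (scalar_field R s).
Variable T : operator H.
Local Notation D := (op_dom T : set W).

Lemma op_dom_real a (x y : W) : D x -> D y -> D (a *: x + y).
Proof. exact: op_dom_lin. Qed.

Lemma op_lin_real a (x y : W) : D x -> D y -> (T (a *: x + y) : W) = a *: (T x : W) + T y.
Proof. exact: op_lin. Qed.

Lemma op_dom_scale (a : K) (x : H) : op_dom T x -> op_dom T (a *: x).
Proof.
by move=> Tx; rewrite -(addr0 (a *: x)); apply: op_dom_lin => //; exact: op_dom0.
Qed.

Lemma op_0 : T 0 = 0.
Proof.
have T0 := op_dom0 T; have := op_lin (1 : K) T0 T0.
by rewrite scaler0 addr0 scale1r => /eqP; rewrite -subr_eq0 opprD addNKr oppr_eq0 => /eqP.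
Qed.

Lemma op_scale (a : K) (x : H) : op_dom T x -> T (a *: x) = a *: T x.
Proof.
move=> Tx; rewrite -[in LHS](addr0 (a *: x)) op_lin ?op_0 ?addr0//.
exact: op_dom0.
Qed.

Lemma op_B (x y : W) : D x -> D y -> D (x - y) /\ (T (x - y) : W) = (T x : W) - T y.
Proof.
move=> Dx Dy; rewrite addrC -scaleN1r; split; first exact: op_dom_real.
by rewrite op_lin_real// scaleN1r addrC.
Qed.

Lemma ip_scaler (a : K) (x y : H) : ip H x (a *: y) = scalar_conj a * ip H x y.
Proof. by rewrite (linearZr_LR (ip H)). Qed.

Lemma ip_scalel (a : K) (x y : H) : ip H (a *: x) y = a * ip H x y.
Proof. by rewrite linearZl_LR. Qed.

Hypothesis Tsa : self_adjoint T.

(** The graph of the adjoint can be tested with real parts only: multiply the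
    test vector by the conjugate of the defect. *)
Lemma self_adjoint_weak (y z : W) :
  (forall x : W, D x -> rip (T x) y = rip x z) -> D y /\ (T y : W) = z.
Proof.
move=> h; apply/Tsa.2 => x Dx; apply/eqP; rewrite -subr_eq0; apply/eqP.
apply: scalar_Re_normsq_eq0.
set d := _ - _; have := h _ (op_dom_scale (scalar_conj d) Dx).
rewrite !ripE op_scale// !ip_scalel => hd.
by rewrite mulrC {2}/d mulrBr scalar_ReD scalar_ReN hd subrr.
Qed.

Lemma self_adjoint_sym (x y : W) : D x -> D y -> rip (T x) y = rip x (T y).
Proof.
move=> Dx Dy; rewrite !ripE.
by have /(_ x Dx) -> := (Tsa.2 y (T y)).2 (conj Dy erefl).
Qed.

(** [h] orthogonal to the domain means that [(0, h)] is in the graph of the adjoint. *)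
Lemma self_adjoint_orth (h : W) : (forall x : W, D x -> rip h x = 0) -> h = 0.
Proof.
move=> h0; have [_] : D 0 /\ (T 0 : W) = h.
  by apply: self_adjoint_weak => x Dx; rewrite rip0r ripC h0.
by rewrite op_0.
Qed.

Lemma self_adjoint_closed (u : nat -> W) (x y : W) : (forall n, D (u n)) ->
  cvg_semi rn u x -> cvg_semi rn (fun n => T (u n)) y -> D x /\ (T x : W) = y.
Proof.
move=> Du ux Ty; apply: self_adjoint_weak => w Dw.
rewrite rnorm_fnorm in ux Ty.
have cst (v : W) : cvg_semi (fnorm rip) (fun=> v) v.
  exact: (cvg_semi_cst (form_seminorm rip_form)).
have c1 := cvg_form rip_form (cst (T w)) ux.
have c2 := cvg_form rip_form (cst w) Ty.
have E : (fun n => rip (T w) (u n)) = (fun n => rip w (T (u n))).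
  by apply/funext => n; exact: self_adjoint_sym.
by rewrite E in c1; exact: (cvg_unique _ c1 c2).
Qed.
End SelfAdjoint.

Section Coercivity.
Context {R : realType} {s : scalars} {H : hilbertType R s}.
Local Notation W := (realified H).
Local Notation rip := (@rip R s H).
Local Notation rn := (fun w : W => rnorm (w : H)).
Variables A S : operator H.
Hypotheses (Asa : self_adjoint A) (Apos : strictly_positive A) (SA : is_sqrt A S).

Lemma strictly_positive_real : exists2 m : R, 0 < m &
  forall x : W, op_dom A x -> m * rn x ^+ 2 <= rip (A x) x.
Proof.
have [m m0 h] := Apos; have [mE _] := scalar_ge0_of (ltW m0).
exists (scalar_Re m); first by rewrite -(@scalar_of_lt R s) scalar_of0 -mE.
move=> x Ax; have /scalar_le_Re := h x Ax.
by rewrite {1}mE normrE expr2 !scalar_ReM scalar_Re_of expr2.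
Qed.

(** The range of [A] is closed, and its orthogonal is the kernel of [A]: the
    projection of [x] on the range is given by the representation of
    [z |-> rip x (A z)] for the form [rip (A y) (A z)]. *)
Lemma strictly_positive_onto (x : W) : exists2 y : W, op_dom A y & (A y : W) = x.
Proof.
have [m m0 Am] := strictly_positive_real.
have lower (y : W) : op_dom A y -> m * rn y <= rn (A y).
  move=> Ay; have [->|y0] := eqVneq (rn y) 0; first by rewrite mulr0 rnorm_ge0.
  have yp : 0 < rn y by rewrite lt_neqAle eq_sym y0 rnorm_ge0.
  rewrite -(ler_pM2r yp) -mulrA -expr2 (le_trans (Am _ Ay))//.
  by rewrite (le_trans (ler_norm _))// rip_le.
pose b (y z : W) := rip (A y) (A z).
have bP : form_on (op_dom A : set W) b.
  split.
  - exact: op_dom0.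
  - by move=> a y z Ay Az; exact: op_dom_real.
  - by move=> y z _ _; exact: ripC.
  - by move=> a y z w Ay Az Aw; rewrite /b op_lin_real// ripDl ripZl.
  - by move=> y Ay; exact: rip_ge0.
have bN y : fnorm b y = rn (A y) by rewrite /fnorm /b -rnorm_sqr sqrtr_sqr ger0_norm ?rnorm_ge0.
have bc : complete_on (op_dom A : set W) (fnorm b).
  move=> u Du cu.
  have [v vl] : exists v : W, cvg_semi rn (fun n => (A (u n) : W)) v.
    apply: hilbert_complete => e e0; have [n0 h] := cu e e0.
    exists n0 => i j ni nj; have [_ <-] := op_B (Du i) (Du j).
    by rewrite -bN; exact: h.
  have [l ll] : exists l : W, cvg_semi rn u l.
    apply: hilbert_complete => e e0; have [n0 h] := cu (m * e) (mulr_gt0 m0 e0).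
    exists n0 => i j ni nj; have := h i j ni nj; rewrite bN.
    have [Dij _] := op_B (Du i) (Du j).
    by move=> /(le_lt_trans (lower _ Dij)); rewrite ltr_pM2l.
  have [Dl Al] := self_adjoint_closed Asa Du ll vl.
  exists l => //; rewrite (_ : (fun n => _) = fun n => rn ((A (u n) : W) - v)) => //.
  by apply/funext => n; rewrite bN; have [_ ->] := op_B (Du n) Dl; rewrite Al.
have [|z Az|y Ay yx] := riesz bP (l := fun z => rip x (A z)) (C := rn x) bc.
- by move=> a y z Ay Az; rewrite op_lin_real// ripDr ripZr.
- by rewrite bN; exact: rip_le.
exists y => //.
have [Dd Ad] : op_dom A ((A y : W) - x) /\ (A ((A y : W) - x) : W) = 0.
  apply: (self_adjoint_weak Asa) => z Az.
  by rewrite ripBr rip0r (ripC (A z) (A y)) -/(b y z) yx// (ripC x) subrr.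
have := lower _ Dd; rewrite Ad rnorm0 => h.
apply/eqP; rewrite -subr_eq0; apply/eqP/rnorm_eq0/le_anti.
by rewrite rnorm_ge0 andbT -(ler_pM2l m0) mulr0.
Qed.

(** With [m] the lower bound of [A], let [x = A y] and apply the Cauchy-Schwarz inequality
    to [|x|^2 = <S x, S y>] and [|S y|^2 = <x, y>], where [m |y| <= |x|]. *)
Lemma sqrt_coercive : exists2 c : R, 0 < c &
  forall x : W, op_dom S x -> c * rn x <= rn (S x).
Proof.
have [m m0 Am] := strictly_positive_real.
have [Ssa _ domA ASS] := SA.
exists (Num.sqrt m); first by rewrite sqrtr_gt0.
move=> x Sx; have [y Ay yx] := strictly_positive_onto x.
have [Sy SSy] := (domA y).1 Ay.
have yxS : (S (S y) : W) = x by rewrite -yx ASS.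
have xx : rn x ^+ 2 <= rn (S x) * rn (S y).
  rewrite rnorm_sqr -{2}yxS -(self_adjoint_sym Ssa)//.
  by rewrite (le_trans (ler_norm _))// rip_le.
have yy : rn (S y) ^+ 2 <= rn x * rn y.
  rewrite rnorm_sqr -(self_adjoint_sym Ssa)// yxS.
  by rewrite (le_trans (ler_norm _))// rip_le.
have ym : m * rn y <= rn x.
  have [->|y0] := eqVneq (rn y) 0; first by rewrite mulr0 rnorm_ge0.
  have yp : 0 < rn y by rewrite lt_neqAle eq_sym y0 rnorm_ge0.
  rewrite -(ler_pM2r yp) -mulrA -expr2 (le_trans (Am _ Ay))// yx.
  by rewrite (le_trans (ler_norm _))// rip_le.
have Sym : Num.sqrt m * rn (S y) <= rn x.
  rewrite -(@ler_pXn2r _ 2) ?nnegrE ?mulr_ge0 ?sqrtr_ge0 ?rnorm_ge0//.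
  rewrite exprMn (sqr_sqrtr (ltW m0)) (le_trans (ler_wpM2l (ltW m0) yy))//.
  by rewrite mulrCA expr2 ler_wpM2l ?rnorm_ge0.
have [->|x0] := eqVneq (rn x) 0; first by rewrite mulr0 rnorm_ge0.
have xp : 0 < rn x by rewrite lt_neqAle eq_sym x0 rnorm_ge0.
rewrite -(ler_pM2r xp) -mulrA -expr2.
rewrite (le_trans (ler_wpM2l (sqrtr_ge0 m) xx))// mulrCA.
by rewrite ler_wpM2l ?rnorm_ge0.
Qed.
End Coercivity.

Section ControlOperator.
Context {R : realType} {s : scalars} {H U : hilbertType R s}.
Variables (S : operator H) (B : U -> H -> scalar_field R s) (Bs : H -> U).
Hypotheses (Ssa : self_adjoint S) (Bb : bounded_into_Hmhalf S B)
  (BsB : is_adjoint S B Bs).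
Local Notation W := (realified H).
Local Notation WU := (realified U).
Local Notation K := (scalar_field R s).

Lemma control_rip (w : U) (x : H) : op_dom S x -> scalar_Re (B w x) = @rip R s U w (Bs x).
Proof. by move=> Sx; rewrite BsB. Qed.

Lemma control_conjl (w : U) (a : K) (x : H) : op_dom S x ->
  B w (a *: x) = scalar_conj a * B w x.
Proof.
have [+ _ _] := Bb => /(_ w) [Bw _] Sx.
have S0 := op_dom0 S.
have B0 : B w 0 = 0.
  have := Bw 1 _ _ S0 S0; rewrite scaler0 addr0.
  have -> : scalar_conj 1 = 1 :> K by rewrite -(@scalar_of1 R s) scalar_conj_of.
  by rewrite mul1r => /eqP; rewrite -subr_eq0 opprD addNKr oppr_eq0 => /eqP.
by rewrite -[in LHS](addr0 (a *: x)) Bw// B0 addr0.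
Qed.

Lemma control_adjoint_lin (a : R) (x y : W) : op_dom S x -> op_dom S y ->
  (Bs (a *: x + y) : WU) = a *: (Bs x : WU) + Bs y.
Proof.
move=> Sx Sy; apply/eqP; rewrite -subr_eq0; apply/eqP/rip_eq0.
set w : WU := _ - _.
rewrite {2}/w ripBr ripDr ripZr.
rewrite -!control_rip//; last exact: op_dom_real.
have [+ _ _] := Bb => /(_ w) [Bw _].
rewrite [X in scalar_Re X - _](Bw (scalar_of s a) x y Sx Sy) scalar_ReD.
by rewrite scalar_conj_of scalar_ReM subrr.
Qed.

Lemma control_adjoint0 : (Bs 0 : WU) = 0.
Proof.
have S0 := op_dom0 S; have := control_adjoint_lin 1 S0 S0.
rewrite scaler0 addr0 scale1r => /eqP.
by rewrite -subr_eq0 opprD addNKr oppr_eq0 => /eqP.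
Qed.

Lemma control_adjoint_bound : exists2 C : R, 0 <= C &
  forall x : W, op_dom S x -> rnorm (Bs x) <= C * rnorm (S x).
Proof.
have [_ _ [C BC]] := Bb.
exists `|scalar_Re C| => // x Sx.
have [->|x0] := eqVneq (rnorm (Bs x)) 0; first by rewrite mulr_ge0 ?rnorm_ge0.
have xp : 0 < rnorm (Bs x) by rewrite lt_neqAle eq_sym x0 rnorm_ge0.
rewrite -(ler_pM2r xp) -expr2 (rnorm_sqr (Bs x : WU)) -control_rip//.
rewrite (le_trans (scalar_Re_norm _))//.
rewrite (le_trans (scalar_le_Re (BC (Bs x) x Sx)))// !normrE.
rewrite -mulrA -scalar_ofM mulrC scalar_ReM -[leRHS]mulrA mulrC.
rewrite [X in _ <= _ * X]mulrC ler_wpM2r ?ler_norm//.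
by rewrite mulr_ge0 ?rnorm_ge0.
Qed.

(** Membership of a functional of [H_(-1/2)] to [H] can be tested with real
    parts. *)
Lemma represents_real (f : H -> K) (h : H) :
  (forall (a : K) x, op_dom S x -> f (a *: x) = scalar_conj a * f x) ->
  represents S f h <-> forall x : W, op_dom S x -> scalar_Re (f x) = @rip R s H h x.
Proof.
move=> fl; split=> [fh x Sx|fh x Sx]; first by rewrite fh.
apply/eqP; rewrite -subr_eq0; apply/eqP/scalar_Re_normsq_eq0.
set d := _ - _; have := fh _ (op_dom_scale d Sx).
rewrite !ripE fl// ip_scaler => hd.
by rewrite mulrC {2}/d mulrBr scalar_ReD scalar_ReN hd subrr.
Qed.

Lemma represents_unique (f : H -> K) (h k : H) :
  represents S f h -> represents S f k -> h = k.
Proof.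
move=> fh fk; apply/eqP; rewrite -subr_eq0; apply/eqP.
apply: (self_adjoint_orth Ssa) => x Sx.
by rewrite ripBl !ripE -fh// -fk// subrr.
Qed.

Lemma pivot_reprE (f : H -> K) (h : H) : represents S f h -> pivot_repr S f = h.
Proof.
move=> fh; rewrite /pivot_repr; case: xgetP => [k _ fk|nh]; first exact: represents_unique fk fh.
by case: (nh h).
Qed.
End ControlOperator.

(** * The constants of the fractional damping *)

Section Constants.
Context {R : realType}.
Local Notation mu := (@lebesgue_measure R).
Local Notation Int h := (mu.-integrable setT (EFin \o h)).

Let I12 : set R := `[1, 2]%classic.

(** The integral is real-valued, hence possibly [0] by convention when it diverges: it is
    first compared with the density of an exponential law, and then bounded below by the
    integral over [[1, 2]]. *)
Lemma Gamma_fun_gt0 : 0 < Gamma_fun (2^-1 + 1 : R).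
Proof.
pose g (t : R) := t `^ (2^-1 + 1 - 1) * expR (- t).
have gE t : 0 <= t -> g t = Num.sqrt t * expR (- t).
  by move=> t0; rewrite /g addrK powR12_sqrt.
pose I0 : set R := `]0, +oo[%classic.
have mI : measurable I0 by exact: measurable_itv.
have mg : measurable_fun setT g.
  apply: measurable_funM; first exact: measurable_powR.
  by apply: measurableT_comp => //; exact: measurable_funN.
have mg' : measurable_fun I0 (EFin \o g).
  by apply/measurable_EFinP; exact: measurable_funTS.
have g0 t : 0 <= g t by rewrite mulr_ge0 ?powR_ge0 ?expR_ge0.
pose pdf := exponential_pdf (2^-1 : R).
have pdf_int : Int pdf by apply: integrable_exponential_pdf; rewrite ?invr_ge0.
have gpdf t : 0 <= t -> g t <= 4 * pdf t.
  move=> t0; rewrite gE// /pdf /exponential_pdf patchE mem_set; last first.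
    by rewrite /= in_itv/= t0.
  have -> : - t = - 2^-1 * t + - 2^-1 * t by field.
  rewrite expRD mulrA mulrA ler_wpM2r ?expR_ge0//.
  have -> : expR (- 2^-1 * t) = (expR (2^-1 * t))^-1 by rewrite mulNr expRN.
  rewrite ler_pdivrMr ?expR_gt0//.
  have := expR_ge1Dx (2^-1 * t).
  have : 0 <= Num.sqrt t by exact: sqrtr_ge0.
  have := sqr_sqrtr t0; move: (Num.sqrt t) (expR _) => r e <- r0 er.
  have := sqr_ge0 (r - 1); rewrite sqrrB; lra.
have Ig : mu.-integrable I0 (EFin \o g).
  apply: (@le_integrable _ _ _ mu _ mI _ (fun t => (4 * pdf t)%:E)) => //.
    move=> t; rewrite /I0/= in_itv/= andbT => /ltW t0.
    rewrite lee_fin ger0_norm// (le_trans (gpdf _ t0))// ler_norm//.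
  apply: (integrableS measurableT) => //; exact: integrableZR.
have low : (1 * expR (-2)) <= Gamma_fun (2^-1 + 1 : R).
  have Ifin : (\int[mu]_(t in I0) (g t)%:E)%E \is a fin_num.
    by apply: integrable_fin_num Ig; exact: measurable_itv.
  rewrite -lee_fin /Gamma_fun /Rintegral -/I0 fineK//.
  apply: (@le_trans _ _ (\int[mu]_(t in I0) (expR (-2) * \1_I12 t)%:E)%E).
    have me : measurable_fun I0 (EFin \o \1_I12 : R -> \bar R).
      by apply/measurable_EFinP; apply: measurable_indic; exact: measurable_itv.
    have e0 t : I0 t -> (0 <= (EFin \o \1_I12 : R -> \bar R) t)%E by move=> _; rewrite lee_fin.
    have -> : (\int[mu]_(t in I0) (expR (-2) * \1_I12 t)%:E =
        (expR (-2))%:E * \int[mu]_(t in I0) (\1_I12 t)%:E)%E.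
      rewrite -(ge0_integralZl_EFin mu (measurable_itv _) e0 me (expR_ge0 _)).
      by apply: eq_integral => t _; rewrite EFinM.
    rewrite integral_indic; [|exact: measurable_itv|exact: measurable_itv].
    rewrite (_ : _ `&` _ = I12); last first.
      apply/seteqP; split=> [t []//|t]; rewrite /I12/I0/= !in_itv/= => /andP[t1 t2].
      by rewrite t1 t2 (lt_le_trans ltr01).
    have m12 : (mu I12 = 1)%E.
      rewrite /I12 lebesgue_measure_itv/= lte_fin ltr1n/= -EFinB.
      by congr (_%:E); ring.
    by rewrite [X in (_ <= _ * X)%E]m12 mule1 lee_fin mul1r.
  apply: (@ge0_le_integral _ _ _ mu I0 (measurable_itv _)
    (fun t => (expR (-2) * \1_I12 t)%:E) (EFin \o g)).
  - by move=> t _; rewrite lee_fin mulr_ge0 ?expR_ge0.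
  - apply/measurable_EFinP; apply: measurable_funM => //.
    by apply: measurable_indic; exact: measurable_itv.
  - exact: mg'.
  move=> t; rewrite /I0/= in_itv/= andbT => t0; rewrite lee_fin indicE.
  have [|_] := boolP (t \in _); last by rewrite mulr0 -/(g t).
  rewrite inE/I12/= in_itv/= mulr1 => /andP[t1 t2].
  rewrite (gE t (ltW t0)) -[X in X <= _]mul1r; apply: ler_pM; rewrite ?expR_ge0//.
    by rewrite -sqrtr1 ler_wsqrtr.
  by rewrite ler_expR lerN2.
by rewrite (lt_le_trans _ low)// mul1r expR_gt0.
Qed.

Lemma frac_gamma_gt0 (alpha : R) : 0 < alpha -> alpha < 1 -> 0 < frac_gamma alpha.
Proof.
move=> a0 a1; rewrite /frac_gamma divr_gt0 ?powR_gt0 ?pi_gt0//.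
rewrite mulr_gt0 ?Gamma_fun_gt0// mulr_gt0// sin_gt0_pi// mulr_gt0 ?pi_gt0//=.
by rewrite gtr_pMl ?pi_gt0.
Qed.
End Constants.

Section Weight.
Context {R : realType} (alpha : R).
Hypotheses (alpha0 : 0 < alpha) (alpha1 : alpha < 1).
Local Notation mu := (@lebesgue_measure R).
Local Notation Int h := (mu.-integrable setT (EFin \o h)).
Local Notation p := (frac_weight alpha).

Lemma frac_weight_ge0 x : 0 <= p x. Proof. exact: powR_ge0. Qed.

Lemma frac_weight_measurable : measurable_fun setT p.
Proof.
apply: (measurableT_comp (f := fun x : R => x `^ ((2 * alpha - 1) / 2))).
  exact: measurable_powR.
exact: normr_measurable.
Qed.

Lemma frac_weight_sqr x : p x ^+ 2 = `|x| `^ (2 * alpha - 1).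
Proof.
by rewrite /frac_weight -powR_mulrn ?powR_ge0// -powRrM divfK.
Qed.

(** Integrable exactly when [0 < alpha < 1]: the density is of order
    [|x| ^ (2 alpha - 1)] at [0], and of order [|x| ^ (2 alpha - 3)] at infinity. *)
Definition weight_density (x : R) : R := p x ^+ 2 / (1 + x ^+ 2).
Local Notation K := weight_density.

Lemma weight_density_ge0 x : 0 <= K x.
Proof. by rewrite divr_ge0 ?sqr_ge0// addr_ge0 ?sqr_ge0. Qed.

Lemma weight_density_measurable : measurable_fun setT K.
Proof.
apply: measurable_funM; first by apply: measurable_funX; exact: frac_weight_measurable.
apply: continuous_measurable_fun => x.
apply/differentiable_continuous/derivable1_diffP; apply: derivableV.
  by rewrite gt_eqF// ltr_pwDl// sqr_ge0.
by apply: derivableD => //; exact: derivableX.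
Qed.

(** An exponent with [beta <= 2 * alpha] and [beta <= 2 - 2 * alpha]: the function
    [- (1 + x `^ beta)^-1] is bounded and its derivative dominates the density
    both near [0] and near infinity. *)
Let beta : R := 2 * alpha * (1 - alpha).

Let beta0 : 0 < beta. Proof. by rewrite /beta !mulr_gt0// subr_gt0. Qed.

Let beta_le1 : beta <= 2 * alpha.
Proof. by rewrite /beta; nra. Qed.

Let beta_le2 : beta <= 2 - 2 * alpha.
Proof. by rewrite /beta; have := sqr_ge0 (1 - alpha); lra. Qed.

Let f (x : R) : R := (beta * x `^ (beta - 1)) / (1 + x `^ beta) ^+ 2.
Let F (x : R) : R := - (1 + x `^ beta)^-1.

Let den_gt0 x : 0 < 1 + x `^ beta.
Proof. by rewrite ltr_pwDl// powR_ge0. Qed.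

Let F_derive (x : R) : 0 < x -> is_derive x (1 : R) F (f x).
Proof.
move=> x0; have d1 := is_derive1_powR beta x0.
have d2 : is_derive x (1 : R) (fun y : R => 1 + y `^ beta) (beta * x `^ (beta - 1)).
  have h := is_deriveD (is_derive_cst (1 : R) x (1 : R)) d1.
  by rewrite add0r in h.
pose den (y : R) := 1 + y `^ beta.
have nz : den x != 0 by apply: lt0r_neq0; exact: den_gt0.
have [dd dval] := d2.
have {}dd : derivable den x 1 by exact: dd.
have dV : derivable (fun y => (den y)^-1) x 1 by exact: derivableV.
apply: DeriveDef; first exact: (derivableN dV).
have -> : 'D_1 F x = - 'D_1 (fun y => (den y)^-1) x by exact: (deriveN dV).
rewrite (deriveV nz dd).
have -> : 'D_1 den x = beta * x `^ (beta - 1) by exact: dval.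
by rewrite scaleNr opprK /f -[LHS]/(_ * _) mulrC.
Qed.

Let f_derivable (x : R) : 0 < x -> derivable f x 1.
Proof.
move=> x0; pose den (y : R) := 1 + y `^ beta; pose num (y : R) := y `^ (beta - 1).
have [d1 _] := is_derive1_powR beta x0.
have [d2 _] := is_derive1_powR (beta - 1) x0.
have dden : derivable den x 1 by exact: (derivableD (derivable_cst (1 : R) x (1 : R)) d1).
have dsq : derivable (den * den) x 1 by exact: (derivableM dden dden).
have nz : (den * den) x != 0 by apply: lt0r_neq0; apply: mulr_gt0; exact: den_gt0.
have dV : derivable (fun y => ((den * den) y)^-1) x 1 by exact: (derivableV nz dsq).
have dnum : derivable (cst beta * num) x 1.
  exact: (derivableM (derivable_cst beta x (1 : R)) d2).
have -> : f = (cst beta * num) * (fun y => ((den * den) y)^-1).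
  by apply/funext => y; rewrite /f expr2.
exact: (derivableM dnum dV).
Qed.

Lemma weight_density_le x : 0 < x -> K x <= 4 / beta * f x.
Proof.
move=> x0; rewrite /K frac_weight_sqr gtr0_norm//.
have -> : 4 / beta * f x = 4 * x `^ (beta - 1) / (1 + x `^ beta) ^+ 2.
  have bn : beta != 0 by rewrite gt_eqF.
  have dn : 1 + x `^ beta != 0 by rewrite gt_eqF.
  by rewrite /f; move: (beta) bn dn => b bn dn; field; rewrite dn bn.
have X0 : 0 < 1 + x ^+ 2 by rewrite ltr_pwDl// sqr_ge0.
rewrite ler_pdivrMr// mulrAC ler_pdivlMr ?exprn_gt0//.
have pw_ge0 r : 0 <= x `^ r by exact: powR_ge0.
have powD r t : x `^ (r + t) = x `^ r * x `^ t by rewrite powRD ?(gt_eqF x0) ?implybT.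
have [x1|x1] := leP x 1.
  have b1 : x `^ beta <= 1.
    by rewrite -(powRr0 x) ger_powR ?x0//= ltW.
  have l1 : x `^ (2 * alpha - 1) <= x `^ (beta - 1).
    by rewrite ger_powR ?x0// lerD2r.
  apply: (@le_trans _ _ (x `^ (beta - 1) * 4)).
    apply: ler_pM => //; first exact: sqr_ge0.
    rewrite (_ : 4 = 2 ^+ 2); last by rewrite -natrX.
    have z0 := pw_ge0 beta.
    by rewrite lerXn2r ?nnegrE// ?addr_ge0//; lra.
  by rewrite mulrC ler_peMr ?mulr_ge0// lerDl sqr_ge0.
have b1 : 1 <= x `^ beta.
  by rewrite -(powRr0 x) ler_powR ?ltW.
apply: (@le_trans _ _ (x `^ (2 * alpha - 1) * (4 * x `^ (beta + beta)))).
  apply: ler_wpM2l => //; rewrite powD.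
  rewrite (_ : 4 * (x `^ beta * x `^ beta) = (2 * x `^ beta) ^+ 2); last by ring.
  have z0 := pw_ge0 beta.
  by rewrite lerXn2r ?nnegrE ?mulr_ge0 ?addr_ge0//; lra.
rewrite mulrCA -mulrA ler_pM2l// -powD.
apply: (@le_trans _ _ (x `^ (beta - 1 + 2))).
  rewrite ler_powR ?(ltW x1)//.
  by have := beta_le2; move: (beta) => b hb; lra.
rewrite powD ler_wpM2l// -[leLHS]/(x `^ 2%:R) (powR_mulrn 2 (ltW x0)).
by rewrite lerDr.
Qed.

Let dominant (x : R) : R := 4 / beta * f x.

Let dominant_continuous (x : R) : 0 < x -> {for x, continuous dominant}.
Proof.
move=> x0; apply: differentiable_continuous; apply/derivable1_diffP.
have := derivableM (derivable_cst (4 / beta) x (1 : R)) (f_derivable x0).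
exact.
Qed.

Let dominant_ge0 (x : R) : 0 <= dominant x.
Proof.
have b4 : 0 <= 4 / beta by rewrite divr_ge0// ltW.
apply: (mulr_ge0 b4); apply: divr_ge0; last exact: sqr_ge0.
by apply: mulr_ge0; [exact: ltW|exact: powR_ge0].
Qed.

Let dominant_integral (a b : R) : 0 < a -> a < b ->
  (\int[mu]_(x in `[a, b]) (dominant x)%:E <= (4 / beta)%:E)%E.
Proof.
move=> a0 ab.
have pos x : x \in `]a, b[ -> 0 < x.
  by rewrite in_itv/= => /andP[ax _]; exact: lt_trans ax.
have b0 : 0 < b by exact: lt_trans ab.
have c0 : 0 < 4 / beta by rewrite divr_gt0.
pose G (x : R) : R := 4 / beta * F x.
have dG (x : R) : 0 < x -> is_derive x (1 : R) G (dominant x).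
  move=> x0; exact: (is_deriveZ (4 / beta) (F_derive x0)).
have cG (x : R) : 0 < x -> {for x, continuous G}.
  move=> x0; have [d _] := dG x x0.
  by apply: differentiable_continuous; exact/derivable1_diffP.
rewrite (@continuous_FTC2 _ dominant G)//.
- rewrite -EFinB lee_fin /G -mulrBr ler_piMr ?(ltW c0)// /F.
  have := den_gt0 a; have := den_gt0 b => hb ha.
  rewrite opprK addrC lerBlDr; apply: (@le_trans _ _ 1).
    by rewrite invf_le1// lerDl powR_ge0.
  by rewrite lerDl invr_ge0 ltW.
- apply: continuous_in_subspaceT => x; rewrite inE/= in_itv/= => /andP[ax _].
  exact/dominant_continuous/(lt_le_trans a0).
- split.
  + by move=> x /pos x0; have [] := dG x x0.
  + exact: cvg_at_right_filter (cG _ a0).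
  + exact: cvg_at_left_filter (cG _ b0).
- by move=> x /pos x0; rewrite derive1E; have [_ ->] := dG x x0.
Qed.

Let annulus_pos (n : nat) : set R := `[n.+2%:R^-1, n.+2%:R]%classic.
Let annulus_neg (n : nat) : set R := `[- n.+2%:R, - n.+2%:R^-1]%classic.

Let ends (n : nat) : 0 < (n.+2%:R^-1 : R) /\ (n.+2%:R^-1 : R) < n.+2%:R.
Proof.
split; first by rewrite invr_gt0 ltr0n.
by apply: (@lt_trans _ _ 1); rewrite ?invf_lt1 ?ltr1n ?ltr0n.
Qed.

Let annulus_pos_integral n : (\int[mu]_(x in annulus_pos n) (K x)%:E <= (4 / beta)%:E)%E.
Proof.
have [e0 e1] := ends n.
apply: (le_trans _ (dominant_integral e0 e1)).
have pos x : annulus_pos n x -> 0 < x.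
  by rewrite /annulus_pos/= in_itv/= => /andP[+ _]; exact: lt_le_trans.
apply: ge0_le_integral => //=.
- exact: measurable_itv.
- by move=> x _; rewrite lee_fin weight_density_ge0.
- apply/measurable_EFinP; apply: measurable_funS weight_density_measurable => //.
- apply/measurable_EFinP; apply: subspace_continuous_measurable_fun.
    exact: measurable_itv.
  apply: continuous_in_subspaceT => x /[!inE] /pos; exact: dominant_continuous.
- by move=> x /pos x0; rewrite lee_fin weight_density_le.
Qed.

Let weight_density_even x : K (- x) = K x.
Proof. by rewrite /weight_density /frac_weight normrN sqrrN. Qed.

Let annulus_neg_integral n : (\int[mu]_(x in annulus_neg n) (K x)%:E <= (4 / beta)%:E)%E.
Proof.
have [e0 e1] := ends n.
apply: (le_trans _ (dominant_integral e0 e1)).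
have neg x : annulus_neg n x -> 0 < - x.
  rewrite /annulus_neg/= in_itv/= => /andP[_]; rewrite lerNr.
  exact: lt_le_trans.
have cd : {within annulus_neg n, continuous (dominant \o -%R)}.
  apply: continuous_in_subspaceT => x /[!inE] /neg x0.
  by apply: continuous_comp; [exact: oppr_continuous|exact: dominant_continuous].
rewrite -[X in (_ <= \int[mu]_(x in X) _)%E]/(annulus_pos n).
have -> : (\int[mu]_(x in annulus_pos n) (dominant x)%:E =
           \int[mu]_(x in annulus_neg n) ((dominant \o -%R) x)%:E)%E.
  rewrite [RHS](integration_by_substitution_oppr (ltW e1) cd).
  by apply: eq_integral => x _ /=; rewrite opprK.
apply: ge0_le_integral => //=.
- exact: measurable_itv.
- by move=> x _; rewrite lee_fin weight_density_ge0.
- apply/measurable_EFinP; apply: measurable_funS weight_density_measurable => //.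
- apply/measurable_EFinP; apply: subspace_continuous_measurable_fun => //.
  exact: measurable_itv.
- by move=> x /neg x0; rewrite lee_fin -weight_density_even weight_density_le.
Qed.

(** The annuli [1 / (n + 2) <= |x| <= n + 2] exhaust the complement of [0]. *)
Lemma weight_density_integrable : Int K.
Proof.
have K0 x : 0 <= K x := weight_density_ge0 x.
have mK : measurable_fun setT (EFin \o K).
  by apply/measurable_EFinP; exact: weight_density_measurable.
apply/integrableP; split=> //.
pose A n := annulus_pos n `|` annulus_neg n.
have mP n : measurable (annulus_pos n) by exact: measurable_itv.
have mN n : measurable (annulus_neg n) by exact: measurable_itv.
have mA n : measurable (A n) by exact: measurableU.
have inc : {homo (fun n => n.+2%:R : R) : m n / (m <= n)%N >-> m <= n}.
  by move=> m n mn; rewrite ler_nat ltnS.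
have ndA : nondecreasing_seq A.
  move=> m n mn; rewrite subsetEset => x [|]; rewrite /annulus_pos/annulus_neg/= !in_itv/=.
    move=> /andP[h1 h2]; left; rewrite /annulus_pos/= in_itv/= (le_trans h2 (inc _ _ mn)) andbT.
    by apply: le_trans h1; rewrite lef_pV2 ?posrE ?ltr0n ?ler_nat.
  move=> /andP[h1 h2]; right; rewrite /annulus_neg/= in_itv/=; apply/andP; split.
    by apply: le_trans h1; rewrite lerN2 inc.
  by apply: (le_trans h2); rewrite lerN2 lef_pV2 ?posrE ?ltr0n ?ler_nat.
have cv : (\int[mu]_(x in A i) (K x)%:E @[i --> \oo] -->
           \int[mu]_(x in \bigcup_i A i) (K x)%:E)%E.
  apply: ge0_nondecreasing_set_cvg_integral => //.
    by move=> i; exact: measurable_funS mK.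
  by move=> i x _; rewrite lee_fin.
have AE : \bigcup_i A i = ~` [set 0].
  apply/seteqP; split=> x /=.
    move=> [n _ [|]]; rewrite /annulus_pos/annulus_neg/= in_itv/= => /andP[h1 h2] x0;
      have [e0 _] := ends n.
      by move: h1; rewrite x0 leNgt e0.
    by move: h2; rewrite x0 oppr_ge0 leNgt e0.
  move=> /eqP x0; have nx : 0 < `|x| by rewrite normr_gt0.
  pose n := Num.truncn (Num.max `|x| `|x|^-1).
  have hn : Num.max `|x| `|x|^-1 < n.+2%:R.
    apply: (lt_le_trans (Num.Theory.truncnS_gt _)).
    by rewrite ler_nat.
  move: hn; rewrite gt_max => /andP[h1 h2].
  have h3 : n.+2%:R^-1 <= `|x|.
    by rewrite -(invrK `|x|) lef_pV2 ?posrE ?invr_gt0 ?ltr0n// ltW.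
  exists n => //; case: (ltrgtP 0 x) x0 => // xs _.
    rewrite gtr0_norm// in h1 h3; left.
    by rewrite /annulus_pos/= in_itv/= h3 ltW.
  rewrite ltr0_norm// in h1 h3; right.
  by rewrite /annulus_neg/= in_itv/= lerNr h3 lerNl ltW.
have -> : (\int[mu]_x `|(EFin \o K) x| = \int[mu]_(x in \bigcup_i A i) (K x)%:E)%E.
  under eq_integral do rewrite /= ger0_norm//.
  rewrite AE -[in LHS](setvU [set (0 : R)]).
  rewrite ge0_integral_setU//=; last 4 first.
  - exact: measurableC.
  - by rewrite setvU.
  - by move=> x _; rewrite lee_fin.
  - by apply/disj_setPS => x /= [? ?].
  by rewrite [X in (_ + X)%E]integral_set1 adde0.
apply: (@le_lt_trans _ _ ((4 / beta)%:E + (4 / beta)%:E)%E); last by rewrite -EFinD ltry.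
rewrite -(cvg_lim _ cv)//; apply: lime_le; first by apply/cvg_ex; eexists; exact: cv.
apply: nearW => n; rewrite ge0_integral_setU//=.
- by apply: leeD; [exact: annulus_pos_integral|exact: annulus_neg_integral].
- exact: mP.
- exact: mN.
- by apply: (measurable_funS measurableT _ mK).
- by move=> x _; rewrite lee_fin.
- apply/disj_setPS => x /= []; rewrite /annulus_pos/annulus_neg/= !in_itv/=.
  move=> /andP[h1 _] /andP[_ h2]; have [e0 _] := ends n.
  have := lt_le_trans e0 h1; have := le_lt_trans h2 (_ : _ < 0).
  by rewrite oppr_lt0 => /(_ e0) xl xg; have := lt_trans xl xg; rewrite ltxx.
Qed.

End Weight.

(** * The energy space *)

Section EnergyForm.
Context {R : realType} {s : scalars} {H U : hilbertType R s}.
Variables (S : operator H) (alpha : R).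
Hypotheses (Ssa : self_adjoint S) (alpha0 : 0 < alpha) (alpha1 : alpha < 1).
Hypothesis S_coercive : exists2 c : R, 0 < c &
  forall x : realified H, op_dom S x -> c * rnorm (x : H) <= rnorm (S x).
Local Notation W := (realified H).
Local Notation WU := (realified U).
Local Notation V0 := (W * W * (R -> WU))%type.
Local Notation gam := (frac_gamma alpha).
Local Notation ip2 := (@l2form R s U (fun=> 1)).
Local Notation L2 := (@in_L2 R s U : set (R -> WU)).
Local Notation mu := (@lebesgue_measure R).
Local Notation E := (in_energy S : set V0).

(** The real part of the inner product of the energy space. *)
Definition energy_form (x y : V0) : R :=
  rip (S x.1.1 : W) (S y.1.1) + rip x.1.2 y.1.2 + gam * ip2 x.2 y.2.

Let gam0 : 0 < gam. Proof. exact: frac_gamma_gt0. Qed.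

Lemma energy_form_on : form_on E energy_form.
Proof.
have [L0 Ll Ls Lli Lge] := @ip2_on R s U.
split.
- by split; [exact: op_dom0|exact: L0].
- by move=> a x y [Sx Lx] [Sy Ly]; split; [exact: op_dom_real|exact: Ll].
- move=> x y [Sx Lx] [Sy Ly].
  by rewrite /energy_form (Ls _ _ Lx Ly) (ripC (S _ : W)) (ripC x.1.2).
- move=> a x y z [Sx Lx] [Sy Ly] [Sz Lz]; rewrite /energy_form/=.
  rewrite (op_lin_real a Sx Sy) !ripDl !ripZl (Lli a _ _ _ Lx Ly Lz).
  by ring.
- move=> x [Sx Lx]; rewrite /energy_form !addr_ge0 ?rip_ge0//.
  by rewrite mulr_ge0 ?(ltW gam0)// Lge.
Qed.

Lemma sqnormE (x : V0) : sqnorm S alpha x = energy_form x x.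
Proof. by rewrite /energy_form -!rnorm_sqr ip2E. Qed.

Lemma state_normE (x : V0) : state_norm S alpha x = fnorm energy_form x.
Proof. by rewrite /state_norm sqnormE. Qed.

Local Notation N := (fnorm energy_form).

Lemma energy_form_bounds (x : V0) : E x ->
  [/\ rnorm (S x.1.1) <= N x, rnorm (x.1.2 : H) <= N x &
      Num.sqrt gam * fnorm ip2 x.2 <= N x].
Proof.
move=> [Sx Lx]; have L0 := form_ge0 ip2_on Lx.
have g0 : 0 <= gam * ip2 x.2 x.2 by rewrite mulr_ge0// ltW.
have le_N (y : R) : 0 <= y -> y ^+ 2 <= energy_form x x -> y <= N x.
  by move=> y0 h; rewrite -(ger0_norm y0) -sqrtr_sqr ler_wsqrtr.
have h1 := rip_ge0 (S x.1.1 : W); have h2 := rip_ge0 x.1.2.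
split; apply: le_N; rewrite ?rnorm_ge0 ?mulr_ge0 ?sqrtr_ge0//.
- by rewrite (rnorm_sqr (S x.1.1 : W)) /energy_form -addrA lerDl addr_ge0.
- by rewrite (rnorm_sqr x.1.2) /energy_form addrAC lerDr addr_ge0.
- rewrite exprMn (fnorm_sqr ip2_on)// (sqr_sqrtr (ltW gam0)) /energy_form.
  by rewrite lerDr addr_ge0.
Qed.

Lemma energy_null (x : V0) : E x -> N x = 0 <->
  [/\ x.1.1 = 0, x.1.2 = 0 & {ae mu, forall xi, x.2 xi = 0}].
Proof.
move=> Ex; have [Sx Lx] := Ex; have [c c0 cS] := S_coercive; split.
  move=> Nx; have [h1 h2 h3] := energy_form_bounds Ex.
  rewrite Nx in h1 h2 h3; split.
  - apply: rnorm_eq0; apply/le_anti; rewrite rnorm_ge0 andbT.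
    by rewrite -(ler_pM2l c0) mulr0 (le_trans (cS _ Sx)).
  - by apply: rnorm_eq0; apply/le_anti; rewrite rnorm_ge0 andbT.
  - apply: ip2_null => //; rewrite -(fnorm_sqr ip2_on)//.
    have s0 : 0 < Num.sqrt gam by rewrite sqrtr_gt0.
    have -> : fnorm ip2 x.2 = 0; last by rewrite expr0n.
    by apply/le_anti; rewrite sqrtr_ge0 andbT -(ler_pM2l s0) mulr0.
move=> [x1 x2 x3]; rewrite /fnorm /energy_form x1 x2 op_0 !rip0l (ip2_ae0 Lx x3).
by rewrite mulr0 !addr0 sqrtr0.
Qed.

Lemma state_eqP (x y : V0) : E x -> E y -> state_eq x y <-> N (x - y) = 0.
Proof.
move=> Ex Ey; rewrite energy_null; last exact: (dom_sub energy_form_on).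
split=> -[h1 h2 h3]; split.
- by rewrite /= (_ : x.1.1 = y.1.1) ?subrr.
- by rewrite /= (_ : x.1.2 = y.1.2) ?subrr.
- by apply: (ae_imply (mu := lebesgue_measure) _ h3) => xi h; apply/eqP; rewrite subr_eq0; exact/eqP.
- by apply/eqP; rewrite -subr_eq0; exact/eqP.
- by apply/eqP; rewrite -subr_eq0; exact/eqP.
- apply: (ae_imply (mu := lebesgue_measure) _ h3) => xi /= h.
  by apply/eqP; rewrite -subr_eq0; exact/eqP.
Qed.

(** The component in [H_(1/2)] converges in [H] by coercivity, together with its image
    by [S]; the limit is in the domain since [S] is closed. *)
Lemma energy_complete : complete_on E N.
Proof.
move=> u Eu cu; have [c c0 cS] := S_coercive.
have s0 : 0 < Num.sqrt gam by rewrite sqrtr_gt0.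
have bounds i j := energy_form_bounds (dom_sub energy_form_on (Eu i) (Eu j)).
have SB i j : rnorm ((S (u i).1.1 : W) - S (u j).1.1) <= N (u i - u j).
  have [h _ _] := bounds i j; have [Si _] := Eu i; have [Sj _] := Eu j.
  by have [_ <-] := op_B Si Sj.
have [a al] : exists a : W, cvg_semi (fun w : W => rnorm (w : H)) (fun n => (u n).1.1) a.
  apply: hilbert_complete => e e0; have [n0 h] := cu (c * e) (mulr_gt0 c0 e0).
  exists n0 => i j ni nj; have := h i j ni nj.
  have [hS _ _] := bounds i j; have [Sij _] := dom_sub energy_form_on (Eu i) (Eu j).
  by move=> /(le_lt_trans (le_trans (cS _ Sij) hS)); rewrite ltr_pM2l.
have [d dl] : exists d : W, cvg_semi (fun w : W => rnorm (w : H)) (fun n => (S (u n).1.1 : W)) d.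
  apply: hilbert_complete => e e0; have [n0 h] := cu e e0.
  by exists n0 => i j ni nj; exact: le_lt_trans (SB i j) (h i j ni nj).
have [v vl] : exists v : W, cvg_semi (fun w : W => rnorm (w : H)) (fun n => (u n).1.2) v.
  apply: hilbert_complete => e e0; have [n0 h] := cu e e0.
  by exists n0 => i j ni nj; have [_ hv _] := bounds i j; exact: le_lt_trans hv (h i j ni nj).
have [phi Lphi phil] : exists2 phi : R -> WU, L2 phi &
    (fun n => fnorm ip2 ((u n).2 - phi)) @ \oo --> (0 : R).
  apply: L2_complete => [n|]; first by have [] := Eu n.
  move=> e e0; have [n0 h] := cu (Num.sqrt gam * e) (mulr_gt0 s0 e0).
  exists n0 => i j ni nj; have [_ _ hp] := bounds i j.
  by have := le_lt_trans hp (h i j ni nj); rewrite ltr_pM2l.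
have [Sa Sad] : op_dom S a /\ (S a : W) = d.
  by apply: (self_adjoint_closed Ssa _ al dl) => n; have [] := Eu n.
have El : E (a, v, phi) by split.
exists (a, v, phi) => //.
have E2 n : N (u n - (a, v, phi)) =
    Num.sqrt (rnorm ((S (u n).1.1 : W) - d) ^+ 2 + rnorm ((u n).1.2 - v : H) ^+ 2 +
              gam * fnorm ip2 ((u n).2 - phi) ^+ 2).
  have [Sn Ln] := Eu n; rewrite (fnorm_sqr ip2_on); last exact: in_L2B.
  rewrite /fnorm /energy_form/= -!rnorm_sqr.
  by have [_ ->] := op_B Sn Sa; rewrite Sad.
under eq_fun do rewrite E2.
have -> : 0 = Num.sqrt (0 ^+ 2 + 0 ^+ 2 + gam * 0 ^+ 2) :> R.
  by rewrite expr0n/= mulr0 !addr0 sqrtr0.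
apply: (continuous_cvg _ (@sqrt_continuous _ _)).
have sq (f : nat -> R) : f @ \oo --> (0 : R) -> (fun n => f n ^+ 2) @ \oo --> (0 ^+ 2 : R).
  by move=> fl; rewrite expr2; under eq_fun do rewrite expr2; exact: cvgM.
apply: cvgD; first by apply: cvgD; apply: sq.
by apply: cvgMr; exact: sq.
Qed.
End EnergyForm.

Section EnergySpace.
Context {R : realType} {s : scalars} {H U : hilbertType R s}.
Variable (S : operator H).
Local Notation W := (realified H).
Local Notation WU := (realified U).
Local Notation V0 := (W * W * (R -> WU))%type.

Definition energy_pred : {pred V0} := fun x => `[< in_energy S x >].

Fact energy_pred_submod : submod_closed energy_pred.
Proof.
split.
  by apply/asboolP; split; [exact: op_dom0|exact: in_L2_0].
move=> a x y /asboolP[Sx Lx] /asboolP[Sy Ly]; apply/asboolP; split.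
  exact: op_dom_real.
by apply: in_L2D => //; exact: in_L2Z.
Qed.
HB.instance Definition _ := GRing.isSubmodClosed.Build R V0 energy_pred
  energy_pred_submod.

(** The states of finite energy, as a vector space on which the form is total. *)
Record energy_space : Type := EnergySpace {
  energy_val :> V0; energy_valP : energy_val \in energy_pred }.
HB.instance Definition _ := [isSub for energy_val].
HB.instance Definition _ := [Choice of energy_space by <:].
HB.instance Definition _ := [SubChoice_isSubLmodule of energy_space by <:].

Lemma energy_inP (x : energy_space) : in_energy S (val x : V0).
Proof. by have /asboolP := valP x. Qed.

Lemma energy_valL a (x y : energy_space) : val (a *: x + y) = a *: (val x : V0) + val y.
Proof. by []. Qed.

Lemma energy_valD (x y : energy_space) : val (x + y) = (val x : V0) + val y.
Proof. by []. Qed.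

Lemma energy_valB (x y : energy_space) : val (x - y) = (val x : V0) - val y.
Proof. by []. Qed.

Lemma energy_valZ a (x : energy_space) : val (a *: x) = a *: (val x : V0).
Proof. by []. Qed.

(** States outside the energy space are sent to [0]. *)
Definition lift (x : V0) : energy_space := insubd 0 x.

Lemma liftK (x : V0) : in_energy S x -> val (lift x) = x.
Proof. by move=> Ex; rewrite insubdK//; exact/asboolP. Qed.
End EnergySpace.

(** * The memory variable *)

Section Memory.
Context {R : realType} {s : scalars} {U : hilbertType R s}.
Variables (alpha eta : R).
Hypotheses (alpha0 : 0 < alpha) (alpha1 : alpha < 1) (eta0 : 0 <= eta).
Local Notation WU := (realified U).
Local Notation mu := (@lebesgue_measure R).
Local Notation rip := (@rip R s U).
Local Notation rn := (fun w : WU => rnorm (w : U)).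
Local Notation p := (frac_weight alpha).
Local Notation L2 := (@in_L2 R s U : set (R -> WU)).
Local Notation Int h := (mu.-integrable setT (EFin \o h)).
Local Notation K := (weight_density alpha).

Lemma normr_measurable_setT : measurable_fun setT (fun x : R => `|x|).
Proof. exact: normr_measurable. Qed.

(** [p |phi| <= p^2 / (1 + xi^2) + (1 + xi^2) |phi|^2]: the integral [\int p phi] makes sense
    although [p] is not square integrable. *)
Lemma memory_integrable (phi : R -> WU) : L2 phi ->
  L2 (fun xi => `|xi| *: phi xi) -> Int (fun xi => p xi * rn (phi xi)).
Proof.
move=> Lp Lxp; have [mp Ip] := (in_L2P _).1 Lp; have [_ Ixp] := (in_L2P _).1 Lxp.
have Ik : Int (fun xi => K xi + (rn (phi xi) ^+ 2 + rn (`|xi| *: phi xi) ^+ 2)).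
  by apply: integrableDR; [exact: weight_density_integrable|exact: integrableDR].
apply: le_integrableR Ik.
  by apply: measurable_funM; [exact: frac_weight_measurable|exact: measurable_rnorm].
move=> xi; rewrite ger0_norm ?mulr_ge0 ?frac_weight_ge0 ?rnorm_ge0//.
rewrite rnormZ normr_id exprMn real_normK ?num_real// /weight_density.
have X0 : 0 < 1 + xi ^+ 2 by rewrite ltr_pwDl// sqr_ge0.
have q0 := frac_weight_ge0 alpha xi; have r0 := rnorm_ge0 (phi xi : U).
move: (p xi) (rnorm _) q0 r0 => q r q0 r0.
have -> : r ^+ 2 + xi ^+ 2 * r ^+ 2 = (1 + xi ^+ 2) * r ^+ 2 by ring.
rewrite -(ler_pM2r X0) mulrDl divfK ?gt_eqF//.
move: (1 + xi ^+ 2) X0 => X X0.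
have -> : X * r ^+ 2 * X = (r * X) ^+ 2 by ring.
have h := sqr_ge0 (q - r * X).
have : 0 <= q * (r * X) by rewrite mulr_ge0// mulr_ge0// ltW.
rewrite -mulrA; nra.
Qed.

Lemma memory_smeas (phi : R -> WU) : L2 phi ->
  @strongly_measurable R s U (fun xi => p xi *: phi xi).
Proof.
move=> [mp _]; apply: smeasM mp; first exact: frac_weight_measurable.
exact: frac_weight_ge0.
Qed.

Definition memory_mean (phi : R -> WU) : WU :=
  bochner_integral (fun xi => rscale (p xi) (phi xi : U)).

Section Mean.
Variable phi : R -> WU.
Hypotheses (Lp : L2 phi) (Lxp : L2 (fun xi => `|xi| *: phi xi)).

Let If : Int (fun xi => rn (p xi *: phi xi)).
Proof.
rewrite (_ : (fun xi => rn _) = fun xi => p xi * rn (phi xi)).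
  exact: memory_integrable.
by apply/funext => xi; rewrite rnormZ ger0_norm// frac_weight_ge0.
Qed.

Lemma memory_mean_integrable (z : WU) : Int (fun xi => p xi * rip (phi xi) z).
Proof.
have := rip_integrable (memory_smeas Lp) If z.
rewrite (_ : (fun xi => rip (p xi *: phi xi) z) = fun xi => p xi * rip (phi xi) z)//.
by apply/funext => xi; rewrite ripZl.
Qed.

Lemma memory_meanE (z : WU) :
  rip (memory_mean phi) z = \int[mu]_xi (p xi * rip (phi xi) z).
Proof.
rewrite (bochner_weak (memory_smeas Lp) If).
by apply: eq_Rintegral => xi _; rewrite ripZl.
Qed.
End Mean.

Lemma memory_mean_lin a (phi psi : R -> WU) :
  L2 phi -> L2 (fun xi => `|xi| *: phi xi) ->
  L2 psi -> L2 (fun xi => `|xi| *: psi xi) ->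
  memory_mean (a *: phi + psi) = a *: memory_mean phi + memory_mean psi.
Proof.
move=> L1 L1x L2p L2x.
have L3 : L2 (a *: phi + psi) by apply: in_L2D => //; exact: in_L2Z.
have L3x : L2 (fun xi => `|xi| *: (a *: phi + psi) xi).
  rewrite (_ : (fun xi => _) = fun xi => a *: (`|xi| *: phi xi) + `|xi| *: psi xi).
    by apply: in_L2D => //; exact: in_L2Z.
  by apply/funext => xi; rewrite scalerDr !scalerA mulrC.
apply/eqP; rewrite -subr_eq0; apply/eqP/rip_eq0.
set z := (X in rip _ X); rewrite {1}/z ripBl ripDl ripZl.
rewrite (memory_meanE L3 L3x) (memory_meanE L1 L1x) (memory_meanE L2p L2x).
rewrite -RintegralZl//; last exact: memory_mean_integrable.
rewrite -RintegralD//; last 2 first.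
- by apply: integrableZR; exact: memory_mean_integrable.
- exact: memory_mean_integrable.
apply/eqP; rewrite subr_eq0; apply/eqP/eq_Rintegral => xi _.
by rewrite ripDl ripZl; ring.
Qed.

Lemma memory_mean_null (phi : R -> WU) : L2 phi -> L2 (fun xi => `|xi| *: phi xi) ->
  {ae mu, forall xi, phi xi = 0} -> memory_mean phi = 0.
Proof.
move=> Lp Lxp phi0; apply: rip_eq0; rewrite memory_meanE// /Rintegral.
rewrite (_ : (\int[mu]_xi _)%E = 0%E)//.
rewrite -(integral0 mu setT); apply: ae_eq_integral => //.
- by have /integrableP[] := memory_mean_integrable Lp Lxp (memory_mean phi).
- apply: (ae_imply (mu := lebesgue_measure) _ phi0) => xi -> _.
  by rewrite rip0l mulr0.
Qed.

Definition damping (xi : R) : R := `|xi| ^+ 2 + eta.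
Local Notation kap := damping.

Lemma dampingE xi : kap xi = xi ^+ 2 + eta.
Proof. by rewrite /damping real_normK ?num_real. Qed.

Lemma damping_ge0 xi : 0 <= kap xi.
Proof. by rewrite addr_ge0// sqr_ge0. Qed.

Lemma damping_measurable : measurable_fun setT kap.
Proof.
by apply: measurable_funD => //; apply: measurable_funX; exact: normr_measurable.
Qed.

Lemma damping_integrable (phi : R -> WU) : L2 phi -> L2 (fun xi => `|xi| *: phi xi) ->
  Int (fun xi => kap xi * rn (phi xi) ^+ 2).
Proof.
move=> /in_L2P[mp Ip] /in_L2P[_ Ixp].
have := integrableDR Ixp (integrableZR eta Ip).
congr (mu.-integrable _ (EFin \o _)); apply/funext => xi.
by rewrite rnormZ normr_id exprMn -mulrDl.
Qed.

(** The first term is what the dissipation of the memory variable exchanges with the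
    velocity. *)
Lemma memory_rhs_pairing (phi : R -> WU) (w : WU) :
  L2 phi -> L2 (fun xi => `|xi| *: phi xi) ->
  l2form (fun=> 1) (fun xi => p xi *: w - kap xi *: phi xi) phi =
  rip (memory_mean phi) w - \int[mu]_xi (kap xi * rn (phi xi) ^+ 2).
Proof.
move=> Lp Lxp; rewrite memory_meanE// -RintegralB//; last 2 first.
- exact: memory_mean_integrable.
- exact: damping_integrable.
apply: eq_Rintegral => xi _.
by rewrite mul1r ripBl !ripZl (rnorm_sqr (phi xi)) (ripC w).
Qed.

(** Solving [phi - h (p w - (xi^2 + eta) phi) = f] divides by [1 + h (xi^2 + eta)]. *)
Section Multiplier.
Variable h : R.
Hypothesis h0 : 0 < h.
Definition multiplier (xi : R) : R := (1 + h * kap xi)^-1.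
Local Notation m := multiplier.
Let M : R := 1 + h^-1.

Let den_gt0 xi : 0 < 1 + h * kap xi.
Proof. by rewrite ltr_pwDl// mulr_ge0 ?damping_ge0// ltW. Qed.

Lemma multiplier_gt0 xi : 0 < m xi. Proof. by rewrite invr_gt0. Qed.
Local Hint Resolve multiplier_gt0 : core.

Lemma multiplier_le1 xi : m xi <= 1.
Proof. by rewrite invf_le1// lerDl mulr_ge0 ?damping_ge0// ltW. Qed.

Lemma multiplier_measurable : measurable_fun setT m.
Proof.
have mk := damping_measurable.
have mg : measurable_fun setT (fun x : R => (1 + h * `|x|)^-1).
  apply: continuous_measurable_fun => x; apply: cvgV.
    by rewrite gt_eqF// ltr_pwDl// mulr_ge0// ltW.
  apply: cvgD; first exact: cvg_cst.
  by apply: cvgMr; exact: norm_continuous.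
rewrite (_ : m = (fun x : R => (1 + h * `|x|)^-1) \o kap).
  exact: measurableT_comp.
by apply/funext => xi /=; rewrite ger0_norm// damping_ge0.
Qed.

Let M_ge0 : 0 <= M. Proof. by rewrite addr_ge0// invr_ge0 ltW. Qed.

Lemma multiplier_decay xi : (1 + xi ^+ 2) * m xi <= M.
Proof.
rewrite ler_pdivrMr ?den_gt0// dampingE /M.
have -> : (1 + h^-1) * (1 + h * (xi ^+ 2 + eta)) =
  1 + xi ^+ 2 + (eta + h^-1 + h * xi ^+ 2 + h * eta) by field; rewrite gt_eqF.
by have h1 := ltW h0; rewrite lerDl !addr_ge0 ?invr_ge0 //; apply: mulr_ge0 => //; exact: sqr_ge0.
Qed.

Lemma multiplier_normr xi : `|xi| * m xi <= M.
Proof.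
apply: le_trans (multiplier_decay xi); rewrite ler_pM2r//.
by rewrite -(real_normK (num_real xi)); have := sqr_ge0 (`|xi| - 1); nra.
Qed.

Lemma multiplier_density xi : p xi ^+ 2 * m xi <= M * K xi.
Proof.
have X0 : 0 < 1 + xi ^+ 2 by rewrite ltr_pwDl// sqr_ge0.
rewrite /weight_density mulrCA ler_wpM2l ?sqr_ge0//.
by rewrite ler_pdivlMr// mulrC multiplier_decay.
Qed.

(** Used for [g = p m] and for [g = |xi| p m]. *)
Lemma in_L2_multiple (g : R -> R) (C : R) (w : WU) : measurable_fun setT g ->
  (forall xi, 0 <= g xi) -> (forall xi, g xi ^+ 2 <= C * K xi) ->
  L2 (fun xi => g xi *: w).
Proof.
move=> mg g0 gC; apply: (in_L2_le (h := fun xi => (C * rn w ^+ 2) * K xi)).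
- exact: smeasM (smeas_cst w).
- by apply: integrableZR; exact: weight_density_integrable.
- move=> xi; rewrite rnormZ exprMn real_normK ?num_real// [leRHS]mulrAC.
  by rewrite ler_wpM2r ?sqr_ge0.
Qed.

Let pm_measurable : measurable_fun setT (fun xi => p xi * m xi).
Proof.
by apply: measurable_funM; [exact: frac_weight_measurable|exact: multiplier_measurable].
Qed.

Let pm_ge0 xi : 0 <= p xi * m xi.
Proof. by rewrite mulr_ge0 ?frac_weight_ge0// ltW. Qed.

(** The solution [phi] of [phi - h (p w - (xi^2 + eta) phi) = f]. *)
Definition resolvent_memory (f : R -> WU) (w : WU) : R -> WU :=
  fun xi => m xi *: (f xi + h *: (p xi *: w)).

Lemma resolvent_memoryP f w xi :
  resolvent_memory f w xi - h *: (p xi *: w - kap xi *: resolvent_memory f w xi) = f xi.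
Proof.
have d0 : 1 + h * kap xi != 0 by rewrite gt_eqF.
rewrite scalerBr opprB addrA scalerA -{1}(scale1r (resolvent_memory f w xi)) -scalerDl.
by rewrite /resolvent_memory /multiplier !scalerA mulfV// scale1r addrK.
Qed.

Lemma resolvent_memory_L2 (f : R -> WU) (w : WU) : L2 f ->
  L2 (resolvent_memory f w) /\ L2 (fun xi => `|xi| *: resolvent_memory f w xi).
Proof.
move=> Lf; rewrite /resolvent_memory; have mn := normr_measurable_setT.
have L1 : L2 (fun xi => (p xi * m xi) *: w).
  apply: (@in_L2_multiple _ M) => // xi.
  rewrite exprMn (expr2 (m xi)) mulrA.
  apply: le_trans (multiplier_density xi); rewrite ler_piMr ?multiplier_le1//.
  by apply: mulr_ge0; [exact: sqr_ge0|exact: ltW].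
have L2x : L2 (fun xi => (`|xi| * (p xi * m xi)) *: w).
  apply: (@in_L2_multiple _ (M * M)) => [|xi|xi].
  - exact: measurable_funM.
  - by apply: mulr_ge0 => //; exact: pm_ge0.
  rewrite (_ : (_ * _) ^+ 2 = (xi ^+ 2 * m xi) * (p xi ^+ 2 * m xi)); last first.
    by rewrite -(real_normK (num_real xi)); ring.
  rewrite -[leRHS]mulrA; apply: ler_pM.
  - by apply: mulr_ge0; [exact: sqr_ge0|exact: ltW].
  - by apply: mulr_ge0; [exact: sqr_ge0|exact: ltW].
  - by apply: le_trans (multiplier_decay xi); rewrite ler_pM2r// lerDr.
  - exact: multiplier_density.
split.
  have := in_L2D (in_L2M multiplier_measurable (fun xi => ltW (multiplier_gt0 xi)) multiplier_le1 Lf) (in_L2Z h L1).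
  congr L2; apply/funext => xi; rewrite scalerDr !scalerA; congr (_ + _ *: _); ring.
have mxm : measurable_fun setT (fun xi : R => `|xi| * m xi).
  by apply: measurable_funM => //; exact: multiplier_measurable.
have xm0 xi : 0 <= `|xi| * m xi by rewrite mulr_ge0// ltW.
have := in_L2D (in_L2M mxm xm0 multiplier_normr Lf) (in_L2Z h L2x).
congr L2; apply/funext => xi; rewrite !scalerDr !scalerA; congr (_ + _ *: _); ring.
Qed.

(** Eliminating the memory variable adds the bounded term [h * coupling] times
    [Bs^* Bs] to the equation of the velocity. *)
Definition coupling : R := \int[mu]_xi (p xi ^+ 2 * m xi).

Let pm2_ge0 xi : 0 <= p xi ^+ 2 * m xi.
Proof. by apply: mulr_ge0; [exact: sqr_ge0|exact: ltW]. Qed.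

Lemma coupling_ge0 : 0 <= coupling.
Proof. by apply: Rintegral_ge0 => xi _. Qed.

Lemma coupling_integrable : Int (fun xi => p xi ^+ 2 * m xi).
Proof.
apply: le_integrableR (integrableZR M (weight_density_integrable alpha0 alpha1)).
  apply: measurable_funM; last exact: multiplier_measurable.
  by apply: measurable_funX; exact: frac_weight_measurable.
by move=> xi; rewrite ger0_norm// multiplier_density.
Qed.

Lemma resolvent_mean (f : R -> WU) (w z : WU) : L2 f ->
  rip (memory_mean (resolvent_memory f w)) z =
  rip (memory_mean (resolvent_memory f 0)) z + h * coupling * rip w z.
Proof.
move=> Lf; have [L1 L1x] := resolvent_memory_L2 w Lf.
have [L2 L2x] := resolvent_memory_L2 0 Lf.
rewrite (memory_meanE L1 L1x) (memory_meanE L2 L2x) [h * coupling]mulrC -mulrA [X in _ + X]mulrC.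
rewrite -RintegralZl//; last exact: coupling_integrable.
rewrite -RintegralD//; last 2 first.
- exact: memory_mean_integrable.
- by apply: integrableZR; exact: coupling_integrable.
apply: eq_Rintegral => xi _.
by rewrite /resolvent_memory !ripZl !ripDl !ripZl rip0l; ring.
Qed.
End Multiplier.
End Memory.

(** * The generator of the augmented system *)

Section AugmentedGenerator.
Context {R : realType} {s : scalars} {H U : hilbertType R s}.
Variables (S : operator H) (B : U -> H -> scalar_field R s) (Bs : H -> U).
Variables (alpha eta : R).
Hypotheses (Ssa : self_adjoint S).
Hypothesis S_coercive : exists2 c : R, 0 < c &
  forall x : realified H, op_dom S x -> c * rnorm (x : H) <= rnorm (S x).
Hypotheses (B_bounded : bounded_into_Hmhalf S B) (BsB : is_adjoint S B Bs).
Hypotheses (alpha0 : 0 < alpha) (alpha1 : alpha < 1) (eta0 : 0 <= eta).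
Local Notation W := (realified H).
Local Notation WU := (realified U).
Local Notation V0 := (W * W * (R -> WU))%type.
Local Notation gam := (frac_gamma alpha).
Local Notation p := (frac_weight alpha).
Local Notation kap := (damping eta).
Local Notation L2 := (@in_L2 R s U : set (R -> WU)).
Local Notation mu := (@lebesgue_measure R).
Local Notation E := (in_energy S : set V0).
Local Notation DS := (op_dom S : set W).
Local Notation Sf := (fun x : W => S x : W).
Local Notation Bf := (fun x : W => Bs x : WU).
Local Notation mean := (@memory_mean R s U alpha).
Local Notation dom := (gen_dom S B Bs alpha eta : set V0).
Local Notation gen := (gen S B Bs alpha eta : V0 -> V0).
Local Notation rn := (fun w => rnorm w).

Let gam0 : 0 < gam. Proof. exact: frac_gamma_gt0. Qed.

(** The weak form of [A u + gamma B (\int p phi) = h]. *)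
Definition weak_force (x : V0) (h : W) : Prop := forall y : W, DS y ->
  rip (Sf x.1.1) (Sf y) + gam * rip (mean x.2) (Bf y) = rip h y.

Lemma force_represents (x : V0) (h : H) :
  represents S (force S B alpha x) h <-> weak_force x h.
Proof.
have hom (a : scalar_field R s) (y : H) : op_dom S y ->
    force S B alpha x (a *: y) = scalar_conj a * force S B alpha x y.
  move=> Sy; rewrite /force /extend op_scale// ip_scaler (control_conjl B_bounded)//.
  by rewrite mulrDr mulrCA.
have Fr (y : W) : DS y -> scalar_Re (force S B alpha x y) =
    rip (Sf x.1.1) (Sf y) + gam * rip (mean x.2) (Bf y).
  by move=> Sy; rewrite /force scalar_ReD scalar_ReM (control_rip BsB _ Sy).
by rewrite (represents_real _ hom); split=> h1 y Sy; have := h1 y Sy; rewrite Fr.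
Qed.

Lemma genE (x : V0) (h : W) : weak_force x h -> gen x =
  (x.1.2, - h, (fun xi => p xi *: Bf x.1.2 - kap xi *: x.2 xi)) :> V0.
Proof.
by move=> xh; rewrite /Defs.gen (pivot_reprE Ssa ((force_represents _ _).2 xh)).
Qed.

Lemma domP (x : V0) : dom x <->
  [/\ E x, DS x.1.2, L2 (fun xi => `|xi| *: x.2 xi),
      L2 (fun xi => p xi *: Bf x.1.2 - kap xi *: x.2 xi) &
      exists h, weak_force x h].
Proof.
split=> [[h1 h2 [h h3] h4 h5]|[h1 h2 h3 h4 [h h5]]]; split=> //.
  by exists h; exact/force_represents.
by exists h; exact/force_represents.
Qed.

Lemma gen_energy (x : V0) : dom x -> E (gen x).
Proof. by move=> /domP[_ Sv _ Lr [h /genE ->]]. Qed.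

Lemma weak_force_lin a (x y : V0) h k : dom x -> dom y ->
  weak_force x h -> weak_force y k -> weak_force (a *: x + y) (a *: h + k).
Proof.
move=> /domP[[Sx Lx] _ Lxx _ _] /domP[[Sy Ly] _ Lxy _ _] xh yk z Sz.
rewrite /= (op_lin_real a Sx Sy) memory_mean_lin// !ripDl !ripZl -xh// -yk//.
by rewrite !mulrDr (mulrCA gam a) addrACA.
Qed.

Let rhs_lin a (x y : V0) : DS x.1.2 -> DS y.1.2 ->
  (fun xi => p xi *: Bf (a *: x + y).1.2 - kap xi *: (a *: x + y).2 xi) =
  a *: (fun xi => p xi *: Bf x.1.2 - kap xi *: x.2 xi) +
    (fun xi => p xi *: Bf y.1.2 - kap xi *: y.2 xi).
Proof.
move=> Sx Sy; apply/funext => xi.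
rewrite -[RHS]/(a *: (p xi *: Bf x.1.2 - kap xi *: x.2 xi) +
  (p xi *: Bf y.1.2 - kap xi *: y.2 xi)).
rewrite -[LHS]/(p xi *: (Bs (a *: x.1.2 + y.1.2) : WU) - kap xi *: (a *: x.2 xi + y.2 xi)).
have e := control_adjoint_lin B_bounded BsB a Sx Sy.
rewrite [X in _ *: X - _]e scalerBr !scalerDr opprD.
by rewrite addrACA !scalerA (mulrC a) (mulrC a).
Qed.

Lemma dom_lin a (x y : V0) : dom x -> dom y -> dom (a *: x + y).
Proof.
move=> Dx Dy; have /domP[Ex Svx Lxx Lrx [h xh]] := Dx.
have /domP[Ey Svy Lxy Lry [k yk]] := Dy.
apply/domP; split.
- exact: (form_dom_lin (energy_form_on S alpha0 alpha1)).
- exact: op_dom_real.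
- rewrite (_ : (fun xi => _) = fun xi => a *: (`|xi| *: x.2 xi) + `|xi| *: y.2 xi).
    by apply: in_L2D => //; exact: in_L2Z.
  by apply/funext => xi; rewrite scalerA (mulrC a) -scalerA -scalerDr.
- by rewrite rhs_lin//; apply: in_L2D => //; exact: in_L2Z.
- by exists (a *: h + k); exact: weak_force_lin.
Qed.

Lemma gen_linear a (x y : V0) : dom x -> dom y -> gen (a *: x + y) = a *: gen x + gen y.
Proof.
move=> Dx Dy; have /domP[Ex Svx Lxx Lrx [h xh]] := Dx.
have /domP[Ey Svy Lxy Lry [k yk]] := Dy.
rewrite (genE (weak_force_lin a Dx Dy xh yk)) (genE xh) (genE yk) rhs_lin//.
by congr (_, _, _); rewrite opprD -scalerN.
Qed.

Lemma dom_0 : dom 0.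
Proof.
have [L0 _ _ _ _] := @ip2_on R s U.
have z0 : (fun xi : R => `|xi| *: (0 : R -> WU) xi) = 0.
  by apply/funext => xi; exact: scaler0.
have B0 : Bf 0 = 0 := control_adjoint0 B_bounded BsB.
apply/domP; split.
- by split; [exact: op_dom0|exact: L0].
- exact: op_dom0.
- by rewrite z0.
- rewrite (_ : (fun xi => _) = 0)//; apply/funext => xi.
  by rewrite B0 !scaler0 subrr.
- exists 0 => y Sy /=; rewrite op_0 memory_mean_null ?z0//.
    by rewrite !rip0l mulr0 addr0.
  exact: aeW.
Qed.

(** The elastic terms cancel, and so do the coupling terms: [weak_force] tested
    with the velocity produces [gam <\int p phi, Bs v>], which is what
    [memory_rhs_pairing] gives back. *)
Lemma gen_dissipation (x : V0) : dom x -> energy_form S alpha (gen x) x =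
  - (gam * \int[mu]_xi (kap xi * rnorm (x.2 xi) ^+ 2)).
Proof.
move=> Dx; have /domP[[Sx Lx] Sv Lxx Lr [h xh]] := Dx.
rewrite (genE xh) /energy_form/= ripNl -xh// memory_rhs_pairing//.
rewrite (ripC (Sf x.1.1)); ring.
Qed.

Lemma gen_null (x : V0) : dom x -> fnorm (energy_form S alpha) x = 0 ->
  fnorm (energy_form S alpha) (gen x) = 0.
Proof.
move=> Dx; have /domP[Ex Sv Lxx Lr _] := Dx; have [Sx Lx] := Ex.
move/(energy_null alpha0 alpha1 S_coercive Ex) => [x1 x2 x3].
have x0 : weak_force x 0.
  move=> y Sy; rewrite x1 op_0 memory_mean_null//.
  by rewrite !rip0l mulr0 addr0.
have Eg := gen_energy Dx; apply/(energy_null alpha0 alpha1 S_coercive Eg).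
rewrite (genE x0) x2; split=> //=; first by rewrite oppr0.
have B0 : Bf 0 = 0 := control_adjoint0 B_bounded BsB.
apply: (ae_imply (mu := lebesgue_measure) _ x3) => xi ->.
by rewrite B0 !scaler0 subrr.
Qed.

(** By dissipativity [x] is null; its first two components are then zero, and the third
    one solves [(1 + h (xi^2 + eta)) phi = 0] at every [xi]. *)
Lemma gen_injective (h : R) (x : V0) : 0 < h -> dom x -> x - h *: gen x = 0 -> x = 0.
Proof.
move=> h0 Dx; have /domP[Ex Sv Lxx Lr [k xk]] := Dx => x0.
have N0 : fnorm (energy_form S alpha) x = 0.
  have bP := energy_form_on S alpha0 alpha1 : form_on E _.
  have : energy_form S alpha (x - h *: gen x) x = 0.
    by rewrite x0 (form_0l bP).
  have Eg := gen_energy Dx.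
  rewrite (form_subl bP)//; last exact: (dom_scale bP).
  rewrite (form_scalel bP)// gen_dissipation//.
  have := form_ge0 bP Ex => e0; set I := \int[mu]_xi _ => he.
  have I0 : 0 <= I.
    by apply: Rintegral_ge0 => xi _; rewrite mulr_ge0 ?damping_ge0 ?sqr_ge0.
  rewrite /fnorm; have := mulr_ge0 (ltW h0) (mulr_ge0 (ltW gam0) I0).
  move: he; rewrite mulrN opprK => he hI; have -> : energy_form S alpha x x = 0 by lra.
  by rewrite sqrtr0.
have [x1 x2 _] := (energy_null alpha0 alpha1 S_coercive Ex).1 N0.
move: x0; rewrite (genE xk) => /(congr1 (fun y : V0 => y.2)) x3.
case: x Dx Ex Sv Lxx Lr xk N0 x1 x2 x3 => [[u v] phi]/= _ _ _ _ _ _ _ -> -> x3.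
congr (_, _, _); apply/funext => xi.
have B0 : Bf 0 = 0 := control_adjoint0 B_bounded BsB.
have := congr1 (fun f : R -> WU => f xi) x3.
rewrite -[LHS]/(phi xi - h *: (p xi *: Bf 0 - kap xi *: phi xi)).
rewrite [X in _ *: (_ *: X - _)]B0 scaler0 sub0r.
rewrite scalerN opprK scalerA -{1}(scale1r (phi xi)) -scalerDl => /eqP.
rewrite scaler_eq0 gt_eqF/=; first by move/eqP.
by rewrite ltr_pwDl// mulr_ge0 ?damping_ge0// ltW.
Qed.

(** With [x = (u, v, phi)], the position is [f1 + h v] and [phi] is an explicit function of
    [f3] and [Bs v]. The remaining equation, tested with [y], is [a v y = l y] where the form
    [a] is equivalent to the norm of [H_(1/2)]. *)
Lemma gen_surjective (h : R) (f : V0) : 0 < h -> E f ->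
  exists2 x : V0, dom x & x - h *: gen x = f.
Proof.
move=> h0 Ef; case: f Ef => [[f1 f2] f3] [/= Sf1 Lf3].
have [c c0 cS] := S_coercive.
have [C C0 CB] := control_adjoint_bound B_bounded BsB.
pose k := h ^+ 2 * gam * coupling alpha eta h.
have h2 : 0 <= h ^+ 2 by exact: sqr_ge0.
have k0 : 0 <= k.
  by apply: mulr_ge0; [exact: mulr_ge0 (ltW gam0)|exact: coupling_ge0].
pose a (v x : W) : R := rip v x + h ^+ 2 * rip (Sf v) (Sf x) + k * rip (Bf v) (Bf x).
have aP : form_on DS a.
  split; first exact: op_dom0.
  - by move=> r x y; exact: op_dom_real.
  - move=> x y _ _; rewrite /a (ripC x) (ripC (Sf x)) (ripC (Bf x)); ring.
  - move=> r x y z Sx Sy Sz; rewrite /a (op_lin_real r Sx Sy).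
    have -> : Bf (r *: x + y) = r *: Bf x + Bf y.
      exact: (control_adjoint_lin B_bounded BsB).
    by rewrite !ripDl !ripZl; ring.
  - by move=> x _; rewrite /a !addr_ge0 ?(mulr_ge0 h2) ?(mulr_ge0 k0) ?rip_ge0.
have lower (x : W) : h * rnorm (S x) <= fnorm a x.
  rewrite -(ger0_norm (mulr_ge0 (ltW h0) (rnorm_ge0 (S x)))) -sqrtr_sqr ler_wsqrtr//.
  rewrite exprMn (rnorm_sqr (Sf x)) /a addrAC lerDr.
  by rewrite addr_ge0 ?(mulr_ge0 k0) ?rip_ge0.
pose M := c^-1 ^+ 2 + h ^+ 2 + k * C ^+ 2.
have upper (x : W) : DS x -> fnorm a x <= Num.sqrt M * rnorm (S x).
  move=> Sx; have M0 : 0 <= M by rewrite !addr_ge0 ?(mulr_ge0 k0) ?sqr_ge0.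
  rewrite -(ger0_norm (rnorm_ge0 (S x))) -sqrtr_sqr -sqrtrM// ler_wsqrtr//.
  rewrite /a -!rnorm_sqr /M !mulrDl -(mulrA k) -!exprMn.
  apply: lerD; [apply: lerD => //|apply: (ler_wpM2l k0)].
    rewrite lerXn2r ?nnegrE ?rnorm_ge0 ?(mulr_ge0 _ (rnorm_ge0 _)) ?invr_ge0 ?(ltW c0)//.
    by rewrite mulrC ler_pdivlMr// mulrC cS.
  by rewrite lerXn2r ?nnegrE ?rnorm_ge0 ?(mulr_ge0 C0 (rnorm_ge0 _))// CB.
have ac : complete_on DS (fnorm a).
  move=> u Du cu.
  have SB i j : rnorm ((Sf (u i)) - Sf (u j)) <= h^-1 * fnorm a (u i - u j).
    have [_ <-] := op_B (Du i) (Du j).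
    by rewrite mulrC ler_pdivlMr// mulrC lower.
  have [d dl] : exists d : W, cvg_semi (fun w : W => rnorm (w : H)) (fun n => Sf (u n)) d.
    apply: hilbert_complete => e e0; have [n0 hn] := cu (h * e) (mulr_gt0 h0 e0).
    exists n0 => i j ni nj; apply: (le_lt_trans (SB i j)).
    by rewrite mulrC ltr_pdivrMr// mulrC hn.
  have [l ll] : exists l : W, cvg_semi (fun w : W => rnorm (w : H)) u l.
    apply: hilbert_complete => e e0.
    have [n0 hn] := cu (h * (c * e)) (mulr_gt0 h0 (mulr_gt0 c0 e0)).
    exists n0 => i j ni nj; rewrite -(ltr_pM2l c0) -(ltr_pM2l h0).
    apply: le_lt_trans (hn i j ni nj); apply: le_trans (lower _).
    have [Dij _] := op_B (Du i) (Du j).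
    by rewrite ler_pM2l// cS.
  have [Sl Sld] := self_adjoint_closed Ssa Du ll dl; exists l => //.
  apply: (@squeeze_cvgr _ _ _ _ (fun=> 0) (fun n => Num.sqrt M * rnorm (Sf (u n) - d))).
  - apply: nearW => n; rewrite fnorm_ge0/=.
    have [Dn En] := op_B (Du n) Sl.
    by apply: (le_trans (upper _ Dn)); rewrite En Sld.
  - exact: cvg_cst.
  - by rewrite -(mulr0 (Num.sqrt M)); apply: cvgMr.
pose w0 := mean (resolvent_memory alpha eta h f3 0).
pose l (x : W) : R := rip f2 x - h * rip (Sf f1) (Sf x) - h * gam * rip w0 (Bf x).
have [||v Sv vx] := riesz aP (l := l)
  (C := (rnorm (f2 : H) / c + h * rnorm (S f1) + h * gam * (rnorm (w0 : U) * C)) / h) ac.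
- move=> r x y Sx Sy; rewrite /l (op_lin_real r Sx Sy).
  have -> : Bf (r *: x + y) = r *: Bf x + Bf y.
    exact: (control_adjoint_lin B_bounded BsB).
  by rewrite !ripDr !ripZr; ring.
- move=> x Sx; rewrite -mulrA.
  have hl : rnorm (S x) <= h^-1 * fnorm a x by rewrite mulrC ler_pdivlMr// mulrC lower.
  apply: (@le_trans _ _ ((rnorm (f2 : H) / c + h * rnorm (S f1) +
      h * gam * (rnorm (w0 : U) * C)) * rnorm (S x))); last first.
    have h1 := ltW h0; have g1 := ltW gam0; have c1 := ltW c0.
    apply: ler_wpM2l hl; apply: addr_ge0; first apply: addr_ge0.
    - by rewrite divr_ge0 ?rnorm_ge0.
    - by rewrite mulr_ge0 ?rnorm_ge0.
    - apply: mulr_ge0; first exact: mulr_ge0.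
      by apply: mulr_ge0; first exact: rnorm_ge0.
  rewrite !mulrDl /l (le_trans (ler_normB _ _))// lerD//.
    rewrite (le_trans (ler_normB _ _))// lerD//.
      apply: (le_trans (rip_le _ _)); rewrite -mulrA ler_wpM2l ?rnorm_ge0//.
      by rewrite mulrC ler_pdivlMr// mulrC cS.
    by rewrite normrM gtr0_norm// -mulrA ler_pM2l// rip_le.
  rewrite normrM (gtr0_norm (mulr_gt0 h0 gam0)) -(mulrA (h * gam)).
  rewrite (ler_pM2l (mulr_gt0 h0 gam0)) -mulrA.
  by apply: (le_trans (rip_le _ _)); rewrite ler_wpM2l ?rnorm_ge0// CB.
pose phi := resolvent_memory alpha eta h f3 (Bf v).
have [Lphi Lxphi] := resolvent_memory_L2 alpha0 alpha1 eta0 h0 (Bf v) Lf3.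
have Su : DS (f1 + h *: v) by rewrite addrC; exact: op_dom_real.
have wf : weak_force (f1 + h *: v, v, phi) (h^-1 *: (f2 - v)).
  move=> y Sy /=; rewrite (resolvent_mean alpha0 alpha1 eta0 h0 _ _ Lf3) -/w0.
  have -> : Sf (f1 + h *: v) = h *: Sf v + Sf f1 by rewrite addrC; exact: op_lin_real.
  have := vx y Sy; rewrite /a /l /k ripDl !ripZl ripBl => e.
  apply: (mulfI (lt0r_neq0 h0)); rewrite mulrA mulfV ?gt_eqF// mul1r.
  by move: e; lra.
have Lr : L2 (fun xi => p xi *: Bf v - kap xi *: phi xi).
  rewrite (_ : (fun xi => _) = fun xi => h^-1 *: (phi xi - f3 xi)).
    by apply: in_L2Z; exact: in_L2B.
  apply/funext => xi; rewrite -(resolvent_memoryP alpha eta0 h0 f3 (Bf v) xi) -/phi.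
  by rewrite subKr [RHS]scalerA mulVf ?gt_eqF// scale1r.
exists (f1 + h *: v, v, phi).
  by apply/domP; split=> //; exists (h^-1 *: (f2 - v)).
rewrite (genE wf); congr (_, _, _).
- by rewrite -[LHS]/(f1 + h *: v - h *: v) addrK.
- rewrite -[LHS]/(v - h *: - (h^-1 *: (f2 - v))) scalerN opprK scalerA mulfV ?gt_eqF//.
  by rewrite scale1r addrC subrK.
- by apply/funext => xi; exact: (resolvent_memoryP alpha eta0 h0).
Qed.
End AugmentedGenerator.

(** * The augmented system as an evolution equation *)

Section Augmented.
Context {R : realType} {s : scalars} {H U : hilbertType R s}.
Variables (S : operator H) (B : U -> H -> scalar_field R s) (Bs : H -> U).
Variables (alpha eta : R).
Hypotheses (Ssa : self_adjoint S).
Hypothesis S_coercive : exists2 c : R, 0 < c &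
  forall x : realified H, op_dom S x -> c * rnorm (x : H) <= rnorm (S x).
Hypotheses (B_bounded : bounded_into_Hmhalf S B) (BsB : is_adjoint S B Bs).
Hypotheses (alpha0 : 0 < alpha) (alpha1 : alpha < 1) (eta0 : 0 <= eta).
Local Notation WU := (realified U).
Local Notation V0 := (realified H * realified H * (R -> WU))%type.
Local Notation V := (@energy_space R s H U S).
Local Notation gam := (frac_gamma alpha).
Local Notation kap := (damping eta).
Local Notation mu := (@lebesgue_measure R).
Local Notation E := (in_energy S : set V0).
Local Notation dom := (gen_dom S B Bs alpha eta : set V0).
Local Notation gen0 := (gen S B Bs alpha eta : V0 -> V0).
Local Notation lft := (@lift R s H U S).

Let gam0 : 0 < gam. Proof. exact: frac_gamma_gt0. Qed.

Definition energy_ip (x y : V) : R := energy_form S alpha (val x) (val y).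
Definition adom : set V := [set x | dom (val x)].
Definition agen (x : V) : V := lft (gen0 (val x)).

Lemma energy_ip_on : form_on setT energy_ip.
Proof.
have bP := energy_form_on S alpha0 alpha1 : form_on E _.
split=> //.
- by move=> x y _ _; exact: (form_sym bP (energy_inP x) (energy_inP y)).
- move=> a x y z _ _ _.
  exact: (form_lin bP a (energy_inP x) (energy_inP y) (energy_inP z)).
- by move=> x _; exact: (form_ge0 bP (energy_inP x)).
Qed.

Lemma energy_ip_complete : complete_on setT (fnorm energy_ip).
Proof.
move=> u _ cu.
have [|//|l El ul] := energy_complete Ssa alpha0 alpha1 S_coercive
  (u := fun n => val (u n) : V0).
  by move=> n; exact: energy_inP.
exists (lft l) => //.
suff -> : (fun n => fnorm energy_ip (u n - lft l)) =
  (fun n => fnorm (energy_form S alpha) ((val (u n) : V0) - l)) by [].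
apply/funext => n.
by rewrite /fnorm /energy_ip energy_valB liftK.
Qed.

Lemma agenE (x : V) : adom x -> val (agen x) = gen0 (val x).
Proof. by move=> Dx; rewrite liftK//; exact: (gen_energy Ssa B_bounded BsB). Qed.

Lemma agen_generator : generator (fnorm energy_ip) adom agen.
Proof.
apply: (dissipative_generator energy_ip_on energy_ip_complete).
- exact: (dom_0 eta B_bounded BsB alpha0 alpha1).
- move=> a x y Dx Dy; exact: (dom_lin B_bounded BsB alpha0 alpha1 a Dx Dy).
- move=> a x y Dx Dy; apply: val_inj; rewrite energy_valL !agenE//.
    exact: gen_linear.
  exact: dom_lin.
- move=> h x h0; have [y Dy yx] := gen_surjective Ssa S_coercive B_bounded BsB
    alpha0 alpha1 eta0 h0 (energy_inP x).
  have [Ey _ _ _ _] := Dy.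
  have Dy' : adom (lft y) by rewrite /adom/= liftK.
  exists (lft y) => //; apply: val_inj.
  by rewrite energy_valB energy_valZ (agenE Dy') liftK.
- move=> x Dx; rewrite /energy_ip (agenE Dx) (gen_dissipation Ssa B_bounded)//.
  rewrite oppr_le0 mulr_ge0 ?(ltW gam0)//; apply: Rintegral_ge0 => xi _.
  by rewrite mulr_ge0 ?damping_ge0 ?sqr_ge0.
- move=> x Dx; rewrite /fnorm /energy_ip (agenE Dx).
  exact: (gen_null Ssa S_coercive B_bounded BsB alpha0 alpha1 Dx).
- move=> h y h0 Dy y0; apply: val_inj.
  apply: (gen_injective Ssa S_coercive B_bounded BsB alpha0 alpha1 eta0 h0 Dy).
  by rewrite -(agenE Dy) -energy_valZ -energy_valB y0.
Qed.

(** The dissipation is the supremum of bounded quadratic forms, which only see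
    the frequencies [|xi| <= m]. *)
Definition truncation (m : nat) (xi : R) : R :=
  \1_(`[- m%:R, m%:R]%classic) xi * kap xi.

Lemma truncation_measurable m : measurable_fun setT (truncation m).
Proof.
apply: measurable_funM; last exact: damping_measurable.
exact: measurable_indic (measurable_itv _).
Qed.

Lemma truncation_ge0 m xi : 0 <= truncation m xi.
Proof. by rewrite mulr_ge0 ?damping_ge0. Qed.

Lemma truncation_le m xi : truncation m xi <= m%:R ^+ 2 + eta.
Proof.
rewrite /truncation indicE; case: (boolP (_ \in _)) => [|_]; last first.
  by rewrite mul0r addr_ge0 ?sqr_ge0.
rewrite inE/= in_itv/= mul1r -ler_norml => h.
by rewrite lerD2r lerXn2r ?nnegrE.
Qed.

Lemma truncation_nondecreasing m n xi : (m <= n)%N ->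
  truncation m xi <= truncation n xi.
Proof.
move=> mn; rewrite /truncation ler_wpM2r ?damping_ge0// !indicE.
case: (boolP (xi \in _)) => [|_]; last by case: (_ \in _).
rewrite !inE/= !in_itv/= => /andP[h1 h2]; rewrite mem_set//= in_itv/=.
have mnR : m%:R <= n%:R :> R by rewrite ler_nat.
by rewrite (le_trans h2)// andbT (le_trans _ h1)// lerN2.
Qed.

Lemma truncation_near xi : \forall m \near \oo, truncation m xi = kap xi.
Proof.
exists (Num.truncn `|xi|).+1 => // m /= hm.
rewrite /truncation indicE mem_set ?mul1r//= in_itv/= -ler_norml.
apply: (le_trans (ltW (Num.Theory.truncnS_gt _))).
by rewrite ler_nat.
Qed.

Definition dissip_form (m : nat) (x y : V) : R :=
  gam * l2form (truncation m) (val x).2 (val y).2.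

Lemma dissip_form_on m : form_on setT (dissip_form m).
Proof.
have [_ _ qs ql q0] := l2form_on (U := U) (truncation_measurable m)
  (truncation_ge0 m) (truncation_le m).
have L2 (x : V) : in_L2 (val x).2 by have [] := energy_inP x.
split=> //.
- by move=> x y _ _; rewrite /dissip_form qs.
- move=> a x y z _ _ _; rewrite /dissip_form.
  rewrite energy_valL [X in l2form _ X]/= (ql a _ _ _ (L2 x) (L2 y) (L2 z)).
  by rewrite mulrDr (mulrCA gam).
- by move=> x _; rewrite mulr_ge0 ?(ltW gam0) ?q0.
Qed.

Lemma l2form_sqr (w : R -> R) (f : R -> WU) :
  l2form w f f = \int[mu]_xi (w xi * rnorm (f xi : U) ^+ 2).
Proof. by apply: eq_Rintegral => xi _; rewrite -rnorm_sqr. Qed.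

Lemma l2form_le (w w' : R -> R) (C : R) (f : R -> WU) :
  measurable_fun setT w -> measurable_fun setT w' ->
  (forall xi, 0 <= w xi) -> (forall xi, w xi <= w' xi) -> (forall xi, w' xi <= C) ->
  in_L2 (f : R -> U) -> l2form w f f <= l2form w' f f.
Proof.
move=> mw mw' w0 ww' w'C Lf; apply: le_Rintegral => //.
- apply: (l2form_integrable (C := C)) => // xi.
  by rewrite ger0_norm// (le_trans (ww' xi)).
- apply: (l2form_integrable (C := C)) => // xi.
  by rewrite ger0_norm// (le_trans (w0 xi)).
- by move=> xi _; rewrite ler_wpM2r ?rip_ge0.
Qed.

Lemma dissip_form_bounded m x :
  dissip_form m x x <= (m%:R ^+ 2 + eta) * energy_ip x x.
Proof.
have [Sx Lx] := energy_inP x; set c := m%:R ^+ 2 + eta.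
have c0 : 0 <= c by rewrite addr_ge0 ?sqr_ge0.
have h : l2form (truncation m) (val x).2 (val x).2 <=
    c * l2form (fun=> 1) (val x).2 (val x).2.
  apply: (@le_trans _ _ (l2form (fun=> c) (val x).2 (val x).2)).
    apply: (@l2form_le _ _ c) => //.
    - exact: truncation_measurable.
    - exact: truncation_ge0.
    - exact: truncation_le.
  suff -> : l2form (fun=> c) (val x).2 (val x).2 =
    c * l2form (fun=> 1) (val x).2 (val x).2 by [].
  rewrite [in RHS]/l2form -RintegralZl//.
    by apply: eq_Rintegral => xi _; rewrite mul1r.
  by apply: (l2form_integrable (C := 1)) => // xi; rewrite normr1.
rewrite /dissip_form (le_trans (ler_wpM2l (ltW gam0) h))// mulrCA ler_wpM2l//.
by rewrite /energy_ip /energy_form lerDr addr_ge0 ?rip_ge0.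
Qed.

Lemma dissip_form_nondecreasing m x : dissip_form m x x <= dissip_form m.+1 x x.
Proof.
have [Sx Lx] := energy_inP x; rewrite ler_wpM2l ?(ltW gam0)//.
apply: l2form_le Lx; first exact: truncation_measurable.
- exact: truncation_measurable.
- exact: truncation_ge0.
- by move=> xi; exact: truncation_nondecreasing.
- exact: truncation_le.
Qed.

Definition dissip (x : V) : \bar R := (gam%:E *
  \int[mu]_xi ((`|xi| ^+ 2 + eta) * rnorm (memory (val x) xi) ^+ 2)%:E)%E.

Lemma dissip_form_cvg x : (fun m => (dissip_form m x x)%:E) @ \oo --> dissip x.
Proof.
have [Sx Lx] := energy_inP x; pose f := (val x).2 : R -> U.
have mf : measurable_fun setT (fun xi => rnorm (f xi) ^+ 2).
  by apply: measurable_rnorm2; case: Lx.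
have g0 m xi : (0 <= (truncation m xi * rnorm (f xi) ^+ 2)%:E)%E.
  by rewrite lee_fin mulr_ge0 ?truncation_ge0 ?sqr_ge0.
have mg m : measurable_fun setT (fun xi => (truncation m xi * rnorm (f xi) ^+ 2)%:E).
  by apply/measurable_EFinP; apply: measurable_funM => //; exact: truncation_measurable.
have -> : (fun m => (dissip_form m x x)%:E) =
    (fun m => gam%:E * \int[mu]_xi (truncation m xi * rnorm (f xi) ^+ 2)%:E)%E.
  apply/funext => m; rewrite /dissip_form EFinM l2form_sqr /Rintegral fineK//.
  apply: integrable_fin_num => //.
  have := l2form_integrable (f := f) (g := f) (truncation_measurable m) (C := m%:R ^+ 2 + eta)
    _ Lx Lx.
  rewrite (_ : (fun xi => truncation m xi * rip (f xi) (f xi)) =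
    fun xi => truncation m xi * rnorm (f xi) ^+ 2); last first.
    by apply/funext => xi; rewrite -(rnorm_sqr (f xi : WU)).
  by apply => xi; rewrite ger0_norm ?truncation_ge0 ?truncation_le.
apply: cvgeZl => //.
have cv : (fun m => \int[mu]_xi (truncation m xi * rnorm (f xi) ^+ 2)%:E)%E @ \oo -->
    (\int[mu]_xi limn (fun m => (truncation m xi * rnorm (f xi) ^+ 2)%:E))%E.
  apply: cvg_monotone_convergence => //.
  by move=> xi _ m n mn; rewrite lee_fin ler_wpM2r ?sqr_ge0 ?truncation_nondecreasing.
rewrite (_ : (\int[mu]_xi _)%E =
    (\int[mu]_xi limn (fun m => (truncation m xi * rnorm (f xi) ^+ 2)%:E))%E)//.
apply: eq_integral => xi _; apply/esym/lim_near_cst => //.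
by apply: filterS (truncation_near xi) => m ->.
Qed.

Lemma dissip_agen x : adom x -> dissip x = (- energy_ip (agen x) x)%:E.
Proof.
move=> Dx; have /(domP alpha eta B_bounded BsB)[[Sx Lx] _ Lxx _ _] := Dx.
rewrite /energy_ip (agenE Dx) (gen_dissipation Ssa B_bounded BsB)//.
rewrite opprK [RHS]EFinM /dissip; congr (_ * _)%E.
rewrite /Rintegral fineK//.
by apply: integrable_fin_num => //; exact: damping_integrable.
Qed.

End Augmented.

(** * Solutions of the augmented system *)

Section Assembly.
Context {R : realType} {s : scalars} {H U : hilbertType R s}.
Variables (S : operator H) (B : U -> H -> scalar_field R s) (Bs : H -> U).
Variables (alpha eta : R).
Hypotheses (Ssa : self_adjoint S).
Hypothesis S_coercive : exists2 c : R, 0 < c &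
  forall x : realified H, op_dom S x -> c * rnorm (x : H) <= rnorm (S x).
Hypotheses (B_bounded : bounded_into_Hmhalf S B) (BsB : is_adjoint S B Bs).
Hypotheses (alpha0 : 0 < alpha) (alpha1 : alpha < 1) (eta0 : 0 <= eta).
Local Notation WU := (realified U).
Local Notation V0 := (realified H * realified H * (R -> WU))%type.
Local Notation V := (@energy_space R s H U S).
Local Notation lft := (@lift R s H U S).
Local Notation b := (@energy_ip R s H U S alpha).
Local Notation N := (fnorm b).
Local Notation D := (@adom R s H U S B Bs alpha eta).
Local Notation G := (@agen R s H U S B Bs alpha eta).
Local Notation abs := (fun x : R^o => `|x : R|).
Local Notation state := (state H U).

Let bP := @energy_ip_on R s H U S alpha alpha0 alpha1.
Let NP := form_seminorm bP.
Let GP := agen_generator Ssa S_coercive B_bounded BsB alpha0 alpha1 eta0.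

Let Gdiss (x : V) : D x -> b (G x) x <= 0.
Proof.
apply: (dissipative_of_Dis (Dis := dissip alpha eta) (dissip_form_on S alpha0 alpha1 eta0)).
- by move=> y; exact: dissip_form_cvg.
- by move=> y; exact: dissip_agen.
Qed.

Lemma state_norm_lift (x y : state) : in_energy S x -> in_energy S y ->
  state_norm S alpha (state_sub x y) = N (lft x - lft y).
Proof.
move=> Ex Ey; rewrite (state_normE S alpha (state_sub x y)) /fnorm /energy_ip.
by rewrite energy_valB !liftK.
Qed.

Lemma state_eq_lift (x y : state) : in_energy S x -> in_energy S y ->
  state_eq x y <-> N (lft x - lft y) = 0.
Proof.
move=> Ex Ey; rewrite -state_norm_lift// state_normE.
exact: (state_eqP alpha0 alpha1 S_coercive Ex Ey).
Qed.

Lemma C0_energyP (X : R -> state) : C0_energy S alpha X <->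
  (forall t, 0 <= t -> in_energy S (X t)) /\ half_cont N (fun t => lft (X t)).
Proof.
have pos (r : R) : half_line R r -> 0 <= r by rewrite /half_line/= in_itv/= andbT.
split=> -[EX cX]; split=> // t t0; have := cX t t0; apply: within_eq_cvg => r /pos r0.
  by rewrite state_norm_lift//; exact: EX.
by rewrite state_norm_lift//; exact: EX.
Qed.

Lemma has_time_derivativeP (X dX : R -> state) :
  (forall t, 0 <= t -> in_energy S (X t)) ->
  (forall t, 0 <= t -> in_energy S (dX t)) ->
  has_time_derivative S alpha X dX <->
  half_deriv N (fun t => lft (X t)) (fun t => lft (dX t)).
Proof.
move=> EX EdX.
have E t r : 0 <= t -> 0 <= r ->
    state_norm S alpha
      (state_sub (state_scale (r - t)^-1 (state_sub (X r) (X t))) (dX t)) =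
    N ((r - t)^-1 *: (lft (X r) - lft (X t)) - lft (dX t)).
  move=> t0 r0; rewrite state_normE /fnorm /energy_ip.
  by rewrite !(energy_valB, energy_valZ) !liftK//; [exact: EdX|exact: EX|exact: EX].
have pos (r : R) : half_line R r -> 0 <= r by rewrite /half_line/= in_itv/= andbT.
split=> h t t0; have := h t t0; apply: within_eq_cvg => r /pos r0; first exact: E.
by rewrite E.
Qed.

Let liftX (x : V) : lft (val x) = x.
Proof. by apply: val_inj; rewrite liftK//; exact: energy_inP. Qed.

Let eX (Z : R -> V) : (fun t => lft (val (Z t))) = Z.
Proof. by apply/funext => t; exact: liftX. Qed.

Lemma C0_energy_val (X : R -> V) : half_cont N X ->
  C0_energy S alpha (fun t => val (X t)).
Proof.
move=> cX; apply: (C0_energyP (fun t => val (X t))).2; split.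
  by move=> t _; exact: energy_inP.
rewrite eX; exact: cX.
Qed.

Lemma has_time_derivative_val (X dX : R -> V) : half_deriv N X dX ->
  has_time_derivative S alpha (fun t => val (X t)) (fun t => val (dX t)).
Proof.
move=> XdX.
have EX (Z : R -> V) (t : R) : 0 <= t -> in_energy S (val (Z t)).
  by move=> _; exact: energy_inP.
apply: (has_time_derivativeP (EX X) (EX dX)).2.
rewrite !eX; exact: XdX.
Qed.

(** A strong solution satisfies the equation for [0 < t]; both sides being continuous
    on the closed half-line, it holds at [0] as well. *)
Lemma strong_lift (X0 : state) (X : R -> state) :
  strong_solution S B Bs alpha eta X0 X -> in_energy S X0 ->
  exists dX, strong_sol (b := b) (D := D) (G := G) (fun t => lft (X t)) dX /\
    N (lft (X 0) - lft X0) = 0.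
Proof.
move=> [[domX /C0_energyP[EX cX] /C0_energyP[EgX cgX]] [dX [_ /C0_energyP[EdX cdX] dXX] dXE] X0E] E0.
have DX (t : R) : 0 <= t -> D (lft (X t)).
  by move=> t0; rewrite /adom/= liftK; [exact: domX|exact: EX].
have GX (t : R) : 0 <= t -> G (lft (X t)) = lft (gen S B Bs alpha eta (X t)).
  by move=> t0; rewrite /agen liftK//; exact: EX.
exists (fun t => lft (dX t)); split; last first.
  by apply/(state_eq_lift (EX 0 (lexx 0)) E0).
split; [exact: cdX| |exact: DX|].
  exact: (has_time_derivativeP EX EdX).1.
pose Z (t : R) := lft (dX t) - lft (gen S B Bs alpha eta (X t)).
have Zpos (t : R) : 0 < t -> N (Z t) = 0.
  move=> t0; have t1 := ltW t0.
  exact/(state_eq_lift (EdX t t1) (EgX t t1))/dXE.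
suff Z0 : N (Z 0) = 0.
  move=> t t0; rewrite (GX t t0) -/(Z t).
  have [/Zpos Zt|tn] := ltP 0 t; first exact: Zt.
  by have -> : t = 0 by apply/le_anti; rewrite tn.
have /(half_contP NP) cZ : half_cont N Z := half_contB NP cdX cgX.
apply/le_anti; rewrite (semi_ge0 NP) andbT.
apply: (@le_eps0 _ _ 1) => // e e0; rewrite mul1r.
have [d d0 hd] := cZ 0 e (lexx 0) e0.
have d2 : 0 < d / 2 by rewrite divr_gt0.
have h : N (Z (d / 2) - Z 0) < e.
  by apply: hd; [exact: ltW|rewrite subr0 gtr0_norm// ltr_pdivrMr// ltr_pMr// ltr1n].
have := semi_dist NP (Z (d / 2)) (Z 0); rewrite (Zpos _ d2) sub0r normrN.
by rewrite (ger0_norm (semi_ge0 NP _)) => /le_lt_trans/(_ h)/ltW.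
Qed.

Lemma mild_lift (X0 : state) (X : R -> state) :
  mild_solution S B Bs alpha eta X0 X -> in_energy S X0 ->
  exists Y, mild_sol (b := b) (D := D) (G := G) (lft X0) (fun t => lft (X t)) Y /\
    N (Y 0) = 0.
Proof.
move=> [/C0_energyP[EX cX] [Y [[/C0_energyP[EY cY] _ YX] Y0 YE]]] E0.
exists (fun t => lft (Y t)); split; last first.
  have ES0 : in_energy S (state0 H U).
    by split; [exact: op_dom0|exact: in_L2_0].
  move/(state_eq_lift (EY 0 (lexx 0)) ES0) : Y0.
  rewrite (_ : lft (state0 H U) = 0) ?subr0//.
  by apply: val_inj; rewrite liftK.
split; first exact: cX.
- exact: (has_time_derivativeP EY EX).1.
- by move=> t t0; rewrite /adom/= liftK; [case: (YE t t0)|exact: EY].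
- move=> t t0; have [DY YXE] := YE t t0.
  have Eg := gen_energy Ssa B_bounded BsB DY.
  have Es : in_energy S (state_add X0 (gen S B Bs alpha eta (Y t))).
    exact: (dom_add (energy_form_on S alpha0 alpha1) E0 Eg).
  move/(state_eq_lift (EX t t0) Es) : YXE => <-.
  have DY' : D (lft (Y t)) by rewrite /adom/= liftK//; exact: EY.
  congr (N (_ - _)); apply: val_inj.
  rewrite energy_valD (agenE Ssa B_bounded BsB DY') (liftK E0) (liftK (EY t t0)).
  by rewrite (liftK Es).
Qed.

Lemma mild_solution_unique (X0 : state) : in_energy S X0 ->
  unique_solution (mild_solution S B Bs alpha eta X0).
Proof.
move=> E0; have [X [Y [XY Y0]]] := mild_sol_exists bP GP (lft X0).
have [cX YX DY XE] := XY.
have CX := C0_energy_val cX.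
exists (fun t => val (X t)).
  split; first exact: CX.
  exists (fun t => val (Y t)); split.
  - split; [exact: (C0_energy_val (half_deriv_cont NP YX))|exact: CX|].
    exact: has_time_derivative_val.
  - have ES0 : in_energy S (state0 H U) by split; [exact: op_dom0|exact: in_L2_0].
    apply/(state_eq_lift (energy_inP (Y 0)) ES0).
    rewrite liftX (_ : lft (state0 H U) = 0) ?subr0//.
    by apply: val_inj; rewrite liftK.
  - move=> t t0; split; first exact: DY.
    have Eg := gen_energy Ssa B_bounded BsB (DY t t0).
    have Es : in_energy S (state_add X0 (gen S B Bs alpha eta (val (Y t)))).
      exact: (dom_add (energy_form_on S alpha0 alpha1) E0 Eg).
    apply/(state_eq_lift (energy_inP (X t)) Es); rewrite liftX -[RHS](XE t t0).
    congr (N (_ - _)); apply: val_inj.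
    by rewrite energy_valD (agenE Ssa B_bounded BsB (DY t t0)) (liftK E0) (liftK Es).
move=> Z solZ t t0; have [[EZ _] _] := solZ.
apply/(state_eq_lift (EZ t t0) (energy_inP (X t))); rewrite liftX.
have [Y' [ZY' Y'0]] := mild_lift solZ E0.
apply: (mild_sol_unique bP GP Gdiss ZY' XY _ t0).
apply/le_anti; rewrite (semi_ge0 NP) andbT (le_trans (semiB NP _ _))//.
by rewrite Y0 Y'0 addr0.
Qed.

Lemma strong_solution_unique (X0 : state) : gen_dom S B Bs alpha eta X0 ->
  unique_solution (strong_solution S B Bs alpha eta X0).
Proof.
move=> D0; have [E0 _ _ _ _] := D0.
have DX0 : D (lft X0) by rewrite /adom/= liftK.
have [X [dX [solX X0E]]] := strong_sol_exists bP GP DX0.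
have [cdX XdX DX dXE] := solX.
have CX := C0_energy_val (half_deriv_cont NP XdX).
have CdX := C0_energy_val cdX.
have EX (t : R) := energy_inP (X t).
have EgX (t : R) (t0 : 0 <= t) := gen_energy Ssa B_bounded BsB (DX t t0).
have gX (t : R) : 0 <= t -> lft (gen S B Bs alpha eta (val (X t))) = G (X t) by [].
exists (fun t => val (X t)).
  split.
  - split; [exact: DX|exact: CX|].
    apply: (C0_energyP (fun t => gen S B Bs alpha eta (val (X t)))).2.
    split; first exact: EgX.
    apply: (half_cont_ext NP _ cdX) => t t0.
    by rewrite -[RHS](dXE t t0).
  - exists (fun t => val (dX t)).
      by split; [exact: CX|exact: CdX|exact: has_time_derivative_val].
    move=> t /ltW t0; apply/(state_eq_lift (energy_inP (dX t)) (EgX t t0)).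
    by rewrite liftX -[RHS](dXE t t0).
  - by apply/(state_eq_lift (EX 0) E0); rewrite liftX.
move=> Z solZ t t0; have [[_ [EZ _] _] _ _] := solZ.
apply/(state_eq_lift (EZ t t0) (energy_inP (X t))); rewrite liftX.
have [dZ [sZ Z0]] := strong_lift solZ E0.
apply: (strong_sol_unique bP GP Gdiss sZ solX _ t0).
apply/le_anti; rewrite (semi_ge0 NP) andbT (le_trans (semi_trans NP (lft X0) _ _))//.
by rewrite Z0 (semiBC NP) X0E addr0.
Qed.

Lemma gen_dom_is_dense : gen_dom_dense S B Bs alpha eta.
Proof.
move=> x Ex e e0; have [y Dy h] := gen_dense GP (lft x) e0.
exists (val y); first exact: Dy.
by rewrite (state_norm_lift Ex (energy_inP y)) liftX.
Qed.

Lemma energy_lift (X : R -> state) (t : R) : in_energy S (X t) ->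
  energy S alpha X t = b (lft (X t)) (lft (X t)) / 2.
Proof. by move=> EX; rewrite /energy sqnormE /energy_ip liftK. Qed.

Lemma strong_energy_decay (X0 : state) (X : R -> state) :
  gen_dom S B Bs alpha eta X0 -> strong_solution S B Bs alpha eta X0 X ->
  forall t, 0 <= t ->
    (energy S alpha X r - energy S alpha X t) / (r - t)
      @[r --> within (half_line R) t^'] --> - dissipation alpha eta X t.
Proof.
move=> D0 solX t t0; have [E0 _ _ _ _] := D0.
have [[domX [EX _] _] _ _] := solX.
have [dX [[_ XdX DX dXE] _]] := strong_lift solX E0.
have DXt := DX t t0.
have dE : b (dX t) (lft (X t)) = - dissipation alpha eta X t.
  have -> : b (dX t) (lft (X t)) = b (G (lft (X t))) (lft (X t)).
    apply/eqP; rewrite -subr_eq0 -(form_subl bP I I I); apply/eqP.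
    exact: (form_null bP _ (dXE t t0)).
  rewrite /energy_ip (agenE Ssa B_bounded BsB DXt).
  rewrite (gen_dissipation Ssa B_bounded BsB alpha0 alpha1)//.
  by rewrite liftK//; exact: EX.
have := half_deriv_form bP XdX t0; rewrite dE => h.
have pos (r : R) : half_line R r -> 0 <= r by rewrite /half_line/= in_itv/= andbT.
apply/subr_cvg0/norm_cvg0P; move: h; apply: within_eq_cvg => r /pos r0.
rewrite !energy_lift; [|exact: EX|exact: EX].
move: (b _ _) (b _ _) (dissipation _ _ _ _) => u v w.
by congr (Num.norm (_ - _)); exact: mulrC.
Qed.

Lemma mild_energy_identity (X0 : state) (X : R -> state) :
  in_energy S X0 -> mild_solution S B Bs alpha eta X0 X ->
  forall t1 t2, 0 <= t1 -> t1 <= t2 ->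
    (energy S alpha X t1 - energy S alpha X t2)%:E =
    (\int[@lebesgue_measure R]_(t in `[t1, t2]) edissipation alpha eta X t)%E.
Proof.
move=> E0 solX t1 t2 t10; rewrite le_eqVlt => /orP[/eqP <-|t12].
  by rewrite subrr set_itv1 integral_set1.
have t20 : 0 <= t2 by rewrite ltW// (le_lt_trans t10).
have [[EX _] _] := solX; have [Y [XY _]] := mild_lift solX E0.
have h := mild_energy bP GP (dissip_form_on S alpha0 alpha1 eta0)
  (C := fun m => m%:R ^+ 2 + eta) (Dis := dissip alpha eta) _ _ _ _ XY t10 t12.
rewrite !energy_lift; [|exact: EX|exact: EX].
rewrite -h; first last.
- by move=> x; exact: dissip_agen.
- by move=> x; exact: dissip_form_cvg.
- by move=> m x; exact: dissip_form_nondecreasing.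
- by move=> m x; exact: dissip_form_bounded.
apply: eq_integral => t; rewrite inE/= in_itv/= => /andP[tt _].
by rewrite /dissip /edissipation liftK//; apply: EX; exact: le_trans tt.
Qed.
End Assembly.

Theorem proposition3p1 (R : realType) (s : scalars) (H U : hilbertType R s)
  (A S : operator H) (B : U -> H -> scalar_field R s) (Bs : H -> U)
  (alpha eta : R)
  (A_self_adjoint : self_adjoint A) (A_positive : strictly_positive A)
  (S_sqrt : is_sqrt A S)
  (B_bounded : bounded_into_Hmhalf S B) (Bs_adjoint : is_adjoint S B Bs)
  (alpha_gt0 : 0 < alpha) (alpha_lt1 : alpha < 1) (eta_ge0 : 0 <= eta) :
  [/\ (* (1) *)
      forall u0 u1 : H, in_energy S (initial U u0 u1) ->
        unique_solution (mild_solution S B Bs alpha eta (initial U u0 u1)),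
      (* (2) *)
      forall u0 u1 : H, gen_dom S B Bs alpha eta (initial U u0 u1) ->
        unique_solution (strong_solution S B Bs alpha eta (initial U u0 u1)),
      (* density of the domain, used in (3) *)
      gen_dom_dense S B Bs alpha eta,
      (* (3), solutions with data in the domain *)
      forall (u0 u1 : H) (X : R -> state H U),
        gen_dom S B Bs alpha eta (initial U u0 u1) ->
        strong_solution S B Bs alpha eta (initial U u0 u1) X ->
        forall t, 0 <= t ->
          (energy S alpha X r - energy S alpha X t) / (r - t)
            @[r --> within (half_line R) t^'] --> - dissipation alpha eta X t &
      (* (3), solutions with data in the energy space: integrated identity *)
      forall (u0 u1 : H) (X : R -> state H U),
        in_energy S (initial U u0 u1) ->
        mild_solution S B Bs alpha eta (initial U u0 u1) X ->
        forall t1 t2, 0 <= t1 -> t1 <= t2 ->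
          (energy S alpha X t1 - energy S alpha X t2)%:E =
          (\int[@lebesgue_measure R]_(t in `[t1, t2])
             edissipation alpha eta X t)%E].
Proof.
have [Ssa _ _ _] := S_sqrt.
have S_coercive := sqrt_coercive A_self_adjoint A_positive S_sqrt.
split.
- by move=> u0 u1 E0; exact: mild_solution_unique.
- by move=> u0 u1 D0; exact: strong_solution_unique.
- exact: gen_dom_is_dense.
- by move=> u0 u1 X D0; exact: strong_energy_decay.
- by move=> u0 u1 X E0; exact: mild_energy_identity.
Qed.
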